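(* Let $G$ be a finite planar graph with $n$ vertices that contains no cycle of length 3 and no cycle of length 5. Then $\mathrm{diam}(\mathcal{C}_5(G))\le 4n^2$.
   Context: A proper $k$-coloring of $G$ is a map $\varphi:V(G)\to\{1,\dots,k\}$ with $\varphi(u)\neq\varphi(v)$ whenever $uv\in E(G)$. The reconfiguration graph $\mathcal{C}_k(G)$ has as vertex set all proper $k$-colorings of $G$, two colorings being adjacent if they differ on exactly one vertex of $G$. The diameter of a graph $H$ is $\max_{x,y\in V(H)}\mathrm{dist}_H(x,y)$, where $\mathrm{dist}_H(x,y)$ is the length of a shortest $x,y$-path in $H$ (so the claim in particular asserts that any two proper 5-colorings of $G$ are joined by a path in $\mathcal{C}_5(G)$ of length at most $4n^2$). *)

(* Defs.v *)
From HB Require Import structures.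
From mathcomp Require Import all_boot all_order all_algebra.
From mathcomp Require Import all_classical all_reals all_analysis.

Set Implicit Arguments.
Unset Strict Implicit.
Unset Printing Implicit Defensive.

Import Order.TTheory GRing.Theory Num.Theory.
Import numFieldNormedType.Exports.

Local Open Scope classical_set_scope.
Local Open Scope ring_scope.

(* Throughout, a finite simple graph is a symmetric irreflexive relation
   e : rel T on a finType T of vertices. *)

Section Drawing.
Context {R : realType} {T : finType}.
Implicit Types (e : rel T) (pt : T -> R * R) (arc : T -> T -> R -> R * R).

Definition simple_arc (a b : R * R) (g : R -> R * R) : Prop :=
  [/\ {within `[0, 1], continuous g}, {in `[0, 1] &, injective g},
      g 0 = a & g 1 = b].

(* [arc u v] draws the edge uv, parametrised from u to v.  An edge is seen here
   as two ordered pairs; the third clause makes [arc v u] the reverse of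
   [arc u v], so that each edge is drawn as a single curve. *)
Definition plane_drawing e pt arc : Prop :=
  [/\ injective pt,
      forall u v, e u v -> simple_arc (pt u) (pt v) (arc u v),
      forall u v (t : R), e u v -> t \in `[0, 1] -> arc v u t = arc u v (1 - t),
      forall u v w (t : R), e u v -> t \in `]0, 1[ -> arc u v t <> pt w &
      forall u v x y (s t : R), e u v -> e x y ->
        s \in `]0, 1[ -> t \in `]0, 1[ -> arc u v s = arc x y t ->
        (u = x /\ v = y) \/ (u = y /\ v = x)].

End Drawing.

Definition planar (R : realType) (T : finType) (e : rel T) : Prop :=
  exists (pt : T -> R * R) (arc : T -> T -> R -> R * R),
    plane_drawing e pt arc.

(* The cycle need not be induced.  The bound on l matters because
   [ucycle e [:: u; v]] holds for every edge uv. *)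
Definition has_cycle (T : finType) (e : rel T) (l : nat) : Prop :=
  (2 < l)%N /\ exists2 c : seq T, size c = l & ucycle e c.

Section Reconfiguration.
Context {T : finType}.
Variables (e : rel T) (k : nat).

Definition proper_coloring (f : {ffun T -> 'I_k}) : bool :=
  [forall u, forall v, e u v ==> (f u != f v)].

Definition coloring : finType := {f : {ffun T -> 'I_k} | proper_coloring f}.

Definition reconf : rel coloring :=
  fun f g => #|[pred x | val f x != val g x]| == 1%N.

End Reconfiguration.

Arguments reconf {T} e k f g.

Section Diameter.
Context (R : realType) {V : finType}.
Variable r : rel V.

(* +oo when no path joins x to y *)
Definition dist (x y : V) : \bar R :=
  ereal_inf [set (size p)%:R%:E | p in
    [set p : seq V | [/\ path r x p, uniq (x :: p) & last x p = y]]].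

Definition diam : \bar R := ereal_sup [set dist z.1 z.2 | z in [set: V * V]].

End Diameter.

(* Main.v *)
Require Import Defs.
From mathcomp Require Import all_boot zify.
From mathcomp Require boolp.

(* The continuous drawing enters once: sampling it on a fine grid shows that the
   graph is a minor of a square grid, hence carries a combinatorial map of genus
   0.  Genus 0 is used in cohomological form (every closed F_2-cochain is exact),
   which is preserved by deleting edges and by merging two corners of a face, and
   which gives both Euler's inequality and the two sides of a cycle.

   Without 3- and 5-cycles there is no closed walk of odd length at most 5.  The
   number of vertices is reduced as follows.  A vertex of degree at most 2 is
   deleted; it moves at most once for every two moves of its neighbours.
   Otherwise there is a vertex v of degree 3 on a 4-face v w1 x w2, such that x
   has degree 3 or the third neighbour of v has degree at most 4; with at most
   two moves of each vertex v and x receive the same colour, and are then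
   identified.  This creates a short odd closed walk only if some walk of length
   5 joins v to x.  Such a walk closes up with w1, and with w2, to a 7-cycle, and
   one recurses into the side of one of these cycles; when no such walk is left,
   discharging (charges degree - 4 and length - 4) produces v.

   In this way every 5-colouring is moved to one with colours in a prescribed set
   of three, each vertex moving at most 2n - 1 times.  Two colourings with colours
   in {0, 1, 2} and in {2, 3, 4} are joined directly, by at most 2n moves. *)

Set Implicit Arguments.
Unset Strict Implicit.
Unset Printing Implicit Defensive.

(** * Plane maps *)

Section PlaneMap.
Variables (T D : finType).
Implicit Types (ed n : D -> D) (vt : D -> T).

(** Three colours are the fewest with which a vertex of degree at most 2 can always be given a final
    colour, and two such palettes covering the five colours share just one. A deleted vertex moves
    at most once more than the bound for the rest, an identification costs at most two more moves,
    and a single vertex needs one: hence 2n - 1. The total n(2n - 1) + 2n + n(2n - 1) is exactly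
    4n^2.

    The obstacle is the recursion behind the identification. After a cut the vertices of the 7-cycle
    may have lost neighbours, so their degrees are unknown. The statement proved by induction
    therefore allows one exceptional 7-face, whose vertices are exempt from the degree condition. A
    configuration found on the kept side is one of the whole graph: its degrees and its face are
    unchanged, and a walk of length 5 that leaves the kept side can be rerouted along the 7-cycle
    with the same parity and no greater length. *)

Definition face ed n (d : D) := n (ed d).

(* [ed] reverses a dart, [n] turns around its origin [vt], and the orbits of
   [face] are the faces.  The last clause, the vanishing of the first cohomology
   with coefficients in F_2, says that the genus is 0: if the jumps of p agree on
   the two darts of every edge, then p is a vertex function plus a face function. *)
Definition plane_map ed n vt : Prop :=
  [/\ involutive ed, injective n, forall d d', (vt d == vt d') = fconnect n d d' &
   forall p : D -> bool,
     (forall d, p (n d) (+) p d = p (n (ed d)) (+) p (ed d)) ->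
     exists (h : T -> bool) (q : D -> bool),
       (forall d, q (face ed n d) = q d) /\ (forall d, p d = h (vt d) (+) q d)].

End PlaneMap.

(** * The permutation induced on a set of darts *)

Section FirstReturn.
Variables (D : finType) (B : pred D) (n : D -> D).
Hypothesis n_inj : injective n.
Local Notation D' := {d : D | B d}.

(** The search includes [d] itself, which is why [return_map] starts it at [n (val x)]. *)
Definition first_live (d : D) : option D' := ohead (pmap insub (orbit n d)).

Lemma first_live_val (x : D') : first_live (val x) = Some x.
Proof. by rewrite /first_live /orbit -orderSpred /= valK. Qed.

Lemma first_live_dead d : ~~ B d -> first_live (n d) = first_live d.
Proof.
move=> Bd; rewrite /first_live.
have -> : orbit n (n d) = rot 1 (orbit n d).
  rewrite (orbitE (cycle_orbit n_inj d) (orbit_uniq n d)); last first.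
    by rewrite -fconnect_orbit fconnect1.
  have := orbit_uniq n d; rewrite /orbit.
  have: iter (order n d) n d = d by exact: iter_order.
  case: (order n d) (order_gt0 n d) => [//|[|k]] /= _ kd; first by rewrite kd eqxx.
  by rewrite inE; case: eqP => [<-|_] /=; rewrite ?eqxx.
rewrite /orbit -orderSpred /= rot1_cons; set s := traject _ _ _.
by rewrite -cats1 pmap_cat /= insubN // cats0.
Qed.

Lemma first_liveP d x : first_live d = Some x ->
  exists2 i, val x = iter i n d & forall k, k < i -> ~~ B (iter k n d).
Proof.
rewrite /first_live /orbit; move: (order n d) => m.
elim: m d => [//|m IH] d /=.
case: insubP => [u Bd ud [<-]|Bd /IH[i xi ki]]; first by exists 0; rewrite ?ud.
exists i.+1; first by rewrite iterSr.
by case=> [|k] //=; rewrite -iterS iterSr => /ki.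
Qed.

Lemma first_live_some d y : B y -> fconnect n d y -> first_live d != None.
Proof.
move=> By; rewrite fconnect_orbit /first_live; elim: (orbit n d) => [//|z s IH] /=.
by rewrite inE; case: insubP => //= Bz; case: eqP => [e|_ /IH//]; rewrite -e By in Bz.
Qed.

Definition return_map (x : D') : D' := odflt x (first_live (n (val x))).

Lemma return_mapE (x : D') : first_live (n (val x)) = Some (return_map x).
Proof.
rewrite /return_map; case E: first_live => [//|].
have fx : fconnect n (n (val x)) (val x) by rewrite fconnect_sym // fconnect1.
by have := first_live_some (valP x) fx; rewrite E.
Qed.

Lemma return_mapP (x : D') : exists2 i, val (return_map x) = iter i.+1 n (val x) &
  forall k, k < i -> ~~ B (iter k.+1 n (val x)).
Proof.
have [i ei ki] := first_liveP (return_mapE x).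
by exists i => [|k /ki]; rewrite ?iterSr // -iterSr.
Qed.

Lemma return_map_live (x : D') : B (n (val x)) -> val (return_map x) = n (val x).
Proof. by move=> Bn; have := return_mapE x; rewrite (first_live_val (Sub _ Bn)) => -[<-]. Qed.

Lemma return_map_inj : injective return_map.
Proof.
have inji i : injective (iter i n) by elim: i => [|i IH] x y //= /n_inj /IH.
(* After cancelling the first [i.+1] steps, either [i = j] and the darts agree, or the live dart [x]
   is met on the way from [y] before the supposed first return. *)
have key (x y : D') i j : iter i.+1 n (val x) = iter j.+1 n (val y) -> i <= j ->
    (forall k, k < j -> ~~ B (iter k.+1 n (val y))) -> x = y.
  move=> e ij kj; have := e; rewrite -(subnK ij) -addnS addnC iterD => /inji {}e.
  move: e kj; case E: (j - i) => [|k] /= e kj; first exact/val_inj.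
  by have := kj k _; rewrite /= -e (valP x) => /(_ _)/implyP; lia.
move=> x y exy; have [i ei ki] := return_mapP x; have [j ej kj] := return_mapP y.
rewrite exy ej in ei; case: (leqP i j) => ij; first exact: (key _ _ _ _ (esym ei)).
by apply/esym/(key _ _ _ _ ei) => //; apply: ltnW.
Qed.

Lemma return_map_fconnect (x y : D') :
  fconnect return_map x y = fconnect n (val x) (val y).
Proof.
apply/idP/idP => [|/iter_findex].
  move=> /iter_findex <-; elim: (findex _ _ _) => [|k IH] /=; first exact: connect0.
  apply: connect_trans IH _.
  by have [i -> _] := return_mapP (iter k return_map x); exact: fconnect_iter.
move: (findex _ _ _) => k; elim/ltn_ind: k x => -[|k] IH x.
  by move=> /= /val_inj->; exact: connect0.
have [i ei ki] := return_mapP x => ek.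
case: (leqP i k) => ik; last first.
  by have := ki _ ik; rewrite ek (valP y).
have := IH (k - i) _ (return_map x); rewrite ei -iterD.
have -> : k - i + i.+1 = k.+1 by lia.
move=> /(_ ltac:(lia) ek); exact/connect_trans/fconnect1.
Qed.

End FirstReturn.

Section Delete.
Variables (T D : finType) (ed n : D -> D) (vt : D -> T) (B : pred D).
Hypothesis M : plane_map ed n vt.
Hypothesis B_ed : forall d, B (ed d) = B d.
Local Notation D' := {d : D | B d}.

Definition restrict_ed (x : D') : D' := Sub (ed (val x)) (etrans (B_ed (val x)) (valP x)).

(** A closed cochain on the live darts extends to every dart by its value at the next live dart.
    Then it has no jump at a dead dart, so it is closed for the old map, and the old vertex and face
    functions restrict. *)
Lemma delete_plane_map :
  plane_map restrict_ed (@return_map D B n) (fun x : D' => vt (val x)).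
Proof.
have [edK n_inj vtE plan] := M.
split=> [x|||p' p'P].
- by apply/val_inj; rewrite /= edK.
- exact: return_map_inj.
- by move=> x y; rewrite return_map_fconnect.
pose p d := if first_live B n d is Some x then p' x else false.
have pval (x : D') : p (val x) = p' x by rewrite /p first_live_val.
have pdead d : ~~ B d -> p (n d) = p d by move=> Bd; rewrite /p first_live_dead.
have pn (x : D') : p (n (val x)) = p' (return_map n x) by rewrite /p return_mapE.
have [|h [q [qf pE]]] := plan p.
  move=> d; case: (boolP (B d)) => Bd; last first.
    by rewrite !pdead ?B_ed // !addbb.
  have := p'P (Sub d Bd); rewrite -!pn -!pval /=; exact.
exists h, (fun x => q (val x)); split=> [x|x]; last by rewrite -pval pE.
(* A face step of the smaller map skips a run of dead darts at one vertex. Along the run [p] and the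
   vertex do not change, hence neither does [q]. *)
rewrite /face -[in RHS]qf /face.
have [i ei ki] := return_mapP n_inj (restrict_ed x); rewrite ei /= => {ei}.
elim: i ki => [//|i IH] ki; rewrite -IH /=; last by move=> k kl; apply: ki; lia.
have:= pdead _ (ki i (ltnSn i)); rewrite !pE => /(congr1 (addb (h (vt (iter i.+2 n (ed (val x))))))).
rewrite addbA addbb /= => ->.
have /eqP-> : vt (iter i.+2 n (ed (val x))) == vt (iter i.+1 n (ed (val x))).
  by rewrite vtE fconnect_sym // -[iter i.+2 _ _]/(n _) fconnect1.
by rewrite addbA addbb.
Qed.

End Delete.

Section Merge.
Variables (T D : finType) (ed n : D -> D) (vt : D -> T) (a b : D).
Hypothesis M : plane_map ed n vt.
Hypothesis vt_neq : vt a != vt b.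
Hypothesis same_face : fconnect (face ed n) (n a) (n b).

(** Composing the rotation with the transposition of [a] and [b], which lie in different cycles,
    joins these two cycles into one. *)
Definition merge_map (x : D) := n (if x == a then b else if x == b then a else x).
Definition merge_vt (d : D) := if vt d == vt b then vt a else vt d.

Let edK : involutive ed. Proof. by case: M. Qed.
Let n_inj : injective n. Proof. by case: M. Qed.
Let vtE d d' : (vt d == vt d') = fconnect n d d'. Proof. by case: M. Qed.
Let ab : a != b. Proof. by apply: contraNneq vt_neq => ->. Qed.
Let vt_n d : vt (n d) = vt d.
Proof. by apply/eqP; rewrite vtE fconnect_sym // fconnect1. Qed.

Lemma merge_map_inj : injective merge_map.
Proof.
have /eqP nab := ab.
by move=> x y /n_inj; case: (x =P a) => xa; case: (y =P a) => ya;
  case: (x =P b) => xb; case: (y =P b) => yb; congruence.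
Qed.

Let mE x : x != a -> x != b -> merge_map x = n x.
Proof. by rewrite /merge_map => /negbTE-> /negbTE->. Qed.

Let m_agree k x : (forall i, i < k -> (iter i n x != a) && (iter i n x != b)) ->
  iter k merge_map x = iter k n x.
Proof.
elim: k => [//|k IH] H /=; rewrite IH => [|i ik]; last by apply: H; lia.
by have /andP[? ?] := H k (ltnSn k); rewrite mE.
Qed.

Let iter_findex_neq x y i : fconnect n x y -> i < findex n x y -> iter i n x != y.
Proof.
move=> c il; apply/eqP => e.
have io := ltn_trans il (findex_max c).
by move: il; rewrite -e findex_iter // ltnn.
Qed.

Let m_to c x : c \in [:: a; b] -> vt x = vt c -> fconnect merge_map x c.
Proof.
move=> cab /eqP; rewrite vtE => xc.
rewrite -{1}(iter_findex xc) -m_agree ?fconnect_iter // => i il.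
have nc := iter_findex_neq xc il.
have vi : vt (iter i n x) = vt c.
  by apply/eqP; move: xc; rewrite !vtE; apply: connect_trans; rewrite fconnect_sym // fconnect_iter.
have nab : (vt b == vt a) = false by rewrite eq_sym (negbTE vt_neq).
move: cab nc vi; rewrite !inE => /orP[]/eqP-> ->.
  by move=> vi; apply: contra_neq vt_neq => <-.
by move=> vi; rewrite andbT; apply: contra_neq vt_neq => <-.
Qed.

Let vt_m x : merge_vt (merge_map x) = merge_vt x.
Proof.
rewrite /merge_vt /merge_map vt_n; case: (eqVneq x a) => [->|xa].
  by rewrite eqxx (negbTE vt_neq).
by case: (eqVneq x b) => [->|xb]; rewrite ?eqxx ?(negbTE vt_neq).
Qed.

Lemma merge_vtE d d' : (merge_vt d == merge_vt d') = fconnect merge_map d d'.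
Proof.
have m_sym := fconnect_sym merge_map_inj.
apply/eqP/idP; last first.
  move/iter_findex <-; elim: (findex _ _ _) => [//|k ->] /=; by rewrite vt_m.
have mab : fconnect merge_map a b.
  apply: connect_trans (fconnect1 _ _) _.
  have -> : merge_map a = n b by rewrite /merge_map eqxx.
  by apply: m_to; rewrite ?inE ?eqxx ?orbT ?vt_n.
have big x : vt x \in [:: vt a; vt b] -> fconnect merge_map x a.
  rewrite !inE => /orP[]/eqP vx; first by apply: m_to; rewrite ?inE ?eqxx.
  by rewrite m_sym; apply: connect_trans mab _; rewrite m_sym; apply: m_to; rewrite ?inE ?eqxx ?orbT.
move=> e; case: (boolP (vt d \in [:: vt a; vt b])) => din.
  apply: connect_trans (big _ din) _; rewrite m_sym; apply: big.
  move: e din; rewrite /merge_vt !inE.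
  by case: (vt d == vt b); case: (vt d' == vt b); rewrite ?orbT // => <-; rewrite ?eqxx.
have din' : vt d = vt d'.
  move: e din; rewrite /merge_vt !inE negb_or => + /andP[da db].
  rewrite (negbTE db); case: ifP => // _ e; by rewrite e eqxx in da.
have := din'; move/eqP; rewrite vtE => dd.
rewrite -{1}(iter_findex dd) -m_agree ?fconnect_iter // => i il.
have vi : vt (iter i n d) = vt d by apply/eqP; rewrite eq_sym vtE fconnect_iter.
move: din; rewrite !inE negb_or -vi => /andP[da db].
by rewrite (contraNneq _ da) ?(contraNneq _ db) // => ->.
Qed.

(* Merging the two corners splits their common face in two; [F1] is the part
   that runs from [n a] to just before [n b]. *)
Lemma merge_plane_map : plane_map ed merge_map merge_vt.
Proof.
split; [exact: edK|exact: merge_map_inj|exact: merge_vtE|move=> p pP].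
pose phi := face ed n; pose phi' := face ed merge_map.
have phi_inj : injective phi by move=> x y /n_inj /(can_inj edK).
have phi'_inj : injective phi' by move=> x y /merge_map_inj /(can_inj edK).
(* Closedness rearranged: the jump of [p] along faces takes the same value on both darts of an
   edge. *)
pose g x := p (phi' x) (+) p x.
have gE x : g (ed x) = g x.
  by rewrite /g /phi' /face edK; have := pP x; do 4!case: (p _).
pose k := findex phi (n a) (n b).
pose F1 x := [exists i : 'I_k, x == iter i phi (n a)].
have kb : iter k phi (n a) = n b by exact: iter_findex.
have before i : i < k -> iter i phi (n a) != n b.
  move=> il; apply/eqP => e.
  have io := ltn_trans il (findex_max same_face).
  by move: il; rewrite /k -e findex_iter // ltnn.
have k_gt0 : 0 < k.
  rewrite lt0n; apply/eqP => k0; move: kb; rewrite k0 /= => /n_inj /eqP.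
  by rewrite (negbTE ab).
have lastE : iter k.-1 phi (n a) = ed b.
  by apply: phi_inj; rewrite -iterS prednK // kb /phi /face edK.
have noA i : i < k -> iter i phi (n a) != ed a.
  move=> ik; apply/eqP => e; have := before (k - i.+1) ltac:(lia).
  have e1: iter i.+1 phi (n a) = n a by rewrite /= e /phi /face edK.
  by rewrite -{1}e1 -iterD subnK // kb eqxx.
have F1b : F1 (ed b).
  apply/existsP; have kk : k.-1 < k by rewrite ltn_predL.
  by exists (Ordinal kk); rewrite /= lastE.
have F1na : F1 (n a) by apply/existsP; exists (Ordinal k_gt0).
have F1nb : F1 (n b) = false.
  by apply: negbTE; apply/existsP => -[i /eqP e]; have := before i (ltn_ord i); rewrite -e eqxx.
have F1a : F1 (ed a) = false.
  by apply: negbTE; apply/existsP => -[i /eqP e]; have := noA i (ltn_ord i); rewrite -e eqxx.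
have ed_neq x c : (ed x == c) = (x == ed c) by rewrite -{1}(edK c) (can_eq edK).
have phi'E x : x != ed a -> x != ed b -> phi' x = phi x.
  by move=> xa xb; rewrite /phi' /face mE // ed_neq.
have phi'a : phi' (ed a) = n b by rewrite /phi' /face edK /merge_map eqxx.
have phi'b : phi' (ed b) = n a.
  by rewrite /phi' /face edK /merge_map eqxx eq_sym (negbTE ab).
have phia : phi (ed a) = n a by rewrite /phi /face edK.
have phib : phi (ed b) = n b by rewrite /phi /face edK.
have F1phi x : x != ed a -> x != ed b -> F1 (phi x) = F1 x.
  move=> xa xb; apply/existsP/existsP => -[[i ik] /= /eqP e].
    case: i ik e => [|i] ik e; last by exists (Ordinal (ltnW ik)); rewrite /= -(inj_eq phi_inj) e.
    have: x = ed a by apply: phi_inj; rewrite e /phi /face edK.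
    by move=> xe; rewrite xe eqxx in xa.
  have ik1 : i.+1 < k.
    rewrite ltn_neqAle ik andbT; apply: contra xb => /eqP ke.
    by rewrite -lastE -ke /= e.
  by exists (Ordinal ik1); rewrite /= e.
(* Adding [delta] on [F1] turns the face jumps of the merged map into those of the original one, so
   [p0] is closed there; it also makes [p0] agree at [n a] and [n b]. *)
pose delta := p (n a) (+) p (n b).
pose p0 x := p x (+) (delta && F1 x).
have p0g x : p0 (phi x) (+) p0 x = g x.
  rewrite /p0 /g; case: (eqVneq x (ed a)) => [->|xa].
    rewrite phi'a phia F1a F1na /delta.
    by do 3!case: (p _).
  case: (eqVneq x (ed b)) => [->|xb].
    rewrite phi'b phib F1b F1nb /delta.
    by do 3!case: (p _).
  by rewrite F1phi // phi'E //; do 2!case: (p _); case: (_ && _).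
have [_ _ _ /(_ p0)[]] := M.
  move=> d; have := p0g (ed d); rewrite gE -(p0g d) /phi /face edK.
  by move: (p0 (n d)) (p0 (n (ed d))) (p0 d) (p0 (ed d)) => [] [] [] [].
move=> h [q [qphi p0E]].
(* Both darts lie on one original face. As [p0] agrees there too, [h] agrees at the two vertices and
   so descends to the merged one. *)
have qab : q (n a) = q (n b).
  rewrite -kb; elim: (k) => [//|i -> /=]; by rewrite /phi qphi.
have hab : h (vt a) = h (vt b).
  have := p0E (n a); have := p0E (n b); rewrite /p0 F1na F1nb !vt_n qab /delta.
  by move: (p (n a)) (p (n b)) (h (vt a)) (h (vt b)) (q (n b)) => [] [] [] [] [].
exists h, (fun x => q x (+) (delta && F1 x)); split=> d; last first.
  have -> : h (merge_vt d) = h (vt d) by rewrite /merge_vt; case: eqP => // ->.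
  by rewrite addbA -p0E /p0 -addbA addbb addbF.
rewrite -/(phi' d); case: (eqVneq d (ed a)) => [->|da].
  by rewrite phi'a F1a F1nb -(qphi (ed a)) /face edK qab.
case: (eqVneq d (ed b)) => [->|db].
  by rewrite phi'b F1b F1na -(qphi (ed b)) /face edK qab.
by rewrite phi'E // F1phi // /phi qphi.
Qed.

End Merge.

Definition carries (T D : finType) (ed : D -> D) (vt : D -> T) (e : rel T) :=
  forall u w, e u w = [exists d, (vt d == u) && (vt (ed d) == w)].

Definition has_plane_map (T : finType) (e : rel T) : Prop :=
  exists (D : finType) (ed n : D -> D) (vt : D -> T),
    plane_map ed n vt /\ carries ed vt e.

Definition quot (T T' : finType) (r : T -> T') (e : rel T) : rel T' := fun u w =>
  (u != w) && [exists x, exists y, [&& r x == u, r y == w & e x y]].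

Section HasPlaneMap.
Variable T : finType.
Implicit Types (e : rel T).

Lemma has_plane_map_eq e e' : e =2 e' -> has_plane_map e -> has_plane_map e'.
Proof.
move=> ee [D [ed [n [vt [M C]]]]]; exists D, ed, n, vt; split=> // u w.
by rewrite -ee C.
Qed.

Lemma has_plane_map_sub e e' : symmetric e' -> subrel e' e ->
  has_plane_map e -> has_plane_map e'.
Proof.
move=> sym' sub [D [ed [n [vt [M C]]]]].
have [edK _ _ _] := M.
pose B d := e' (vt d) (vt (ed d)).
have B_ed d : B (ed d) = B d by rewrite /B edK sym'.
exists {d | B d}, (restrict_ed B_ed), (@return_map D B n), (fun x => vt (val x)).
split=> [|u w]; first exact: delete_plane_map.
apply/idP/existsP => [euw|[x /andP[/eqP<- /eqP<-]]]; last exact: (valP x).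
have := sub _ _ euw; rewrite C => /existsP[d /andP[/eqP du /eqP dw]].
have Bd : B d by rewrite /B du dw.
by exists (Sub d Bd); rewrite /= du dw !eqxx.
Qed.

Lemma has_plane_map_merge e (D : finType) (ed n : D -> D) (vt : D -> T) a b :
    plane_map ed n vt -> carries ed vt e -> vt a != vt b ->
    fconnect (face ed n) (n a) (n b) ->
  has_plane_map (quot (fun x => if x == vt b then vt a else x) e).
Proof.
move=> M C nab same; have M' := merge_plane_map M nab same.
set r := (fun x => _); set n' := merge_map _ _ _ in M'.
have [edK _ _ _] := M.
pose B d := r (vt d) != r (vt (ed d)).
have B_ed d : B (ed d) = B d by rewrite /B edK eq_sym.
exists {d | B d}, (restrict_ed B_ed), (@return_map D B n'), (fun x => r (vt (val x))).
split=> [|u w]; first exact: delete_plane_map M' _.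
apply/andP/existsP => [[uw /existsP[x /existsP[y /and3P[/eqP xu /eqP yw]]]]|[d /andP[/eqP<- /eqP<-]]].
  rewrite C => /existsP[d /andP[/eqP dx /eqP dy]].
  have Bd : B d by rewrite /B dx dy xu yw.
  by exists (Sub d Bd); rewrite /= dx dy xu yw !eqxx.
split; first exact: (valP d : r _ != r _).
apply/existsP; exists (vt (val d)); apply/existsP; exists (vt (ed (val d))).
by rewrite !eqxx C; apply/existsP; exists (val d); rewrite !eqxx.
Qed.

(** Merging and contracting produce parallel edges. One of two parallel edges can be deleted, as the
    other still carries the adjacency. *)
Lemma has_plane_map_simple e : irreflexive e -> has_plane_map e ->
  exists (D : finType) (ed n : D -> D) (vt : D -> T),
    [/\ plane_map ed n vt, carries ed vt e &
     forall d d', vt d = vt d' -> vt (ed d) = vt (ed d') -> d = d'].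
Proof.
move=> irr [D [ed [n [vt [M C]]]]].
have [k] := ubnP #|D|; elim: k D ed n vt M C => [//|k IH] D ed n vt M C Dk.
have [edK _ _ _] := M.
pose bad d d' := [&& d != d', vt d == vt d' & vt (ed d) == vt (ed d')].
case: (pickP (fun z : D * D => bad z.1 z.2)) => [[d d'] /= /and3P[dd' /eqP v1 /eqP v2]|nobad].
  pose B x := (x != d) && (x != ed d).
  have B_ed x : B (ed x) = B x.
    by rewrite /B -{1}(edK d) !(inj_eq (can_inj edK)) andbC.
  have dw : vt d != vt (ed d).
    apply/eqP => vdd; have := irr (vt d); rewrite C => /existsP[].
    by exists d; rewrite eqxx -vdd eqxx.
  have d'B : B d'.
    rewrite /B eq_sym dd'; apply: contraNneq dw => e'.
    by rewrite v1 e'.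
  apply: (IH {x | B x} (restrict_ed B_ed) (return_map (B:=B) n) (fun x => vt (val x))).
  - exact: delete_plane_map.
  - move=> u w; rewrite C; apply/existsP/existsP => [[x /andP[/eqP<- /eqP<-]]|[x xP]]; last by exists (val x).
    case: (boolP (B x)) => [Bx|]; first by exists (Sub x Bx); rewrite /= !eqxx.
    rewrite negb_and !negbK => /orP[]/eqP->.
      by exists (Sub d' d'B); rewrite /= v1 v2 !eqxx.
    have Be : B (ed d') by rewrite B_ed.
    by exists (Sub _ Be); rewrite /= !edK v1 v2 !eqxx.
  rewrite -ltnS; apply: leq_trans Dk; rewrite ltnS card_sig; apply: proper_card.
  by rewrite properE subset_predT /=; apply/subsetPn; exists d => //; rewrite inE /B eqxx.
exists D, ed, n, vt; split=> // d d' v1 v2; apply/eqP; apply: contraFT (nobad (d, d')) => dd'.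
by rewrite /bad /= dd' v1 v2 !eqxx.
Qed.

End HasPlaneMap.

(** * Contraction of connected fibres *)

Section Contract.
Variables (T T' : finType) (r : T -> T').
Implicit Types (e : rel T).

(** A vertex without edges has no dart, so a map cannot see it. Merging [b] into [a] keeps the type
    [T] but makes [b] such a vertex, so the number of active vertices drops. *)
Definition active e x := [exists y, e x y].

Lemma has_plane_map_inj e : symmetric e ->
    {in active e &, injective r} -> has_plane_map e -> has_plane_map (quot r e).
Proof.
move=> sym r_inj [D [ed [n [vt [M C]]]]].
have [edK n_inj vtE plan] := M.
have ev d : e (vt d) (vt (ed d)) by rewrite C; apply/existsP; exists d; rewrite !eqxx.
have act d : vt d \in active e by apply/existsP; exists (vt (ed d)).
pose B d := r (vt d) != r (vt (ed d)).
have B_ed d : B (ed d) = B d by rewrite /B edK eq_sym.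
have M' : plane_map ed n (r \o vt).
  split=> // [d d'|p pP]; first by rewrite -vtE /= (inj_in_eq r_inj).
  have [h [q [qf pE]]] := plan p pP.
  pose h' u := if [pick x in active e | r x == u] is Some x then h x else false.
  exists h', q; split=> // d; rewrite pE /h' /=; case: pickP => [x /andP[ax /eqP/r_inj->//]|].
  by move/(_ (vt d)); rewrite act eqxx.
exists {d | B d}, (restrict_ed B_ed), (return_map (B:=B) n), (fun x => r (vt (val x))).
split=> [|u w]; first exact: delete_plane_map M' _.
apply/andP/existsP => [[uw /existsP[x /existsP[y /and3P[/eqP xu /eqP yw]]]]|[d /andP[/eqP<- /eqP<-]]].
  rewrite C => /existsP[d /andP[/eqP dx /eqP dy]].
  have Bd : B d by rewrite /B dx dy xu yw.
  by exists (Sub d Bd); rewrite /= dx dy xu yw !eqxx.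
split; first exact: (valP d : r _ != r _).
apply/existsP; exists (vt (val d)); apply/existsP; exists (vt (ed (val d))).
by rewrite !eqxx ev.
Qed.

Lemma quot_sym (T1 T2 : finType) (s : T1 -> T2) (e : rel T1) :
  symmetric e -> symmetric (quot s e).
Proof.
move=> sym u w; rewrite /quot eq_sym; congr andb.
by apply/existsP/existsP => -[x /existsP[y /and3P[xu yw exy]]];
  exists y; apply/existsP; exists x; rewrite xu yw sym.
Qed.

Lemma quot_irr (T1 T2 : finType) (s : T1 -> T2) (e : rel T1) : irreflexive (quot s e).
Proof. by move=> u; rewrite /quot eqxx. Qed.

(** Edges inside the fibres are contracted one by one: merging the corners at the two ends of an
    edge, on the same side of it, makes it a loop, and loops are deleted. *)
Lemma has_plane_map_contract e : symmetric e -> irreflexive e ->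
    (forall x y, active e x -> active e y -> r x = r y ->
       connect [rel x y | e x y && (r x == r y)] x y) ->
  has_plane_map e -> has_plane_map (quot r e).
Proof.
have [k] := ubnP #|active e|; elim: k e => [//|k IH] e ek sym irr conn PM.
pose bad x y := e x y && (r x == r y).
case: (pickP (fun z : T * T => bad z.1 z.2)) => [[a b] /= /andP[eab /eqP rab]|nobad]; last first.
  apply: has_plane_map_inj => // x y ax ay rxy.
  have /connectP[[|z p]] := conn x y ax ay rxy; first by [].
  by rewrite /= -/(bad x z) (nobad (x, z)).
have ab : a != b by apply: contraTneq eab => ->; rewrite irr.
pose r0 x := if x == b then a else x.
have rr0 x : r (r0 x) = r x by rewrite /r0; case: eqP => // ->.
have r0b x : r0 x != b by rewrite /r0; case: ifP => // ->.
have aa : active e a by apply/existsP; exists b.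
have act x : active (quot r0 e) x -> active e x /\ x != b.
  move=> /existsP[y /andP[_ /existsP[x' /existsP[y' /and3P[/eqP<- _ exy]]]]].
  split=> //; rewrite /r0; case: ifP => // _; by apply/existsP; exists y'.
have [D [ed [n [vt [M C]]]]] := PM; have [edK n_inj vtE _] := M.
move: (eab); rewrite C => /existsP[d0 /andP[/eqP d0a /eqP d0b]].
have vt_n d : vt (n d) = vt d by apply/eqP; rewrite vtE fconnect_sym // fconnect1.
(* [pd] and [ed d0] are chosen so that the corners to merge begin with [n pd = d0] and with
   [n (ed d0)], the successor of [d0] on its face. *)
pose pd := finv n d0.
have npd : n pd = d0 by rewrite /pd f_finv.
have vpd : vt pd = a by rewrite -vt_n npd.
apply: (has_plane_map_eq (e := quot r (quot r0 e))).
  move=> u w; apply/andP/andP => -[uw /existsP[x /existsP[y /and3P[/eqP xu /eqP yw]]]].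
    move=> /andP[_ /existsP[x' /existsP[y' /and3P[/eqP xx /eqP yy exy]]]]; split=> //.
    apply/existsP; exists x'; apply/existsP; exists y'.
    by rewrite exy -(rr0 x') -(rr0 y') xx yy xu yw !eqxx.
  move=> exy; split=> //; apply/existsP; exists (r0 x); apply/existsP; exists (r0 y).
  rewrite !rr0 xu yw !eqxx /=; apply/andP; split.
    by apply: contra_neq uw => /(congr1 r); rewrite !rr0 xu yw.
  by apply/existsP; exists x; apply/existsP; exists y; rewrite exy !eqxx.
apply: IH.
- rewrite -ltnS; apply: leq_trans ek; rewrite ltnS; apply: proper_card; rewrite properE.
  apply/andP; split; first by apply/subsetP => x /act[].
  apply/subsetPn; exists b; first by apply/existsP; exists a; rewrite sym.
  by apply/negP => /act[_]; rewrite eqxx.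
- exact: quot_sym.
- exact: quot_irr.
- move=> x y /act[ax xb] /act[ay yb] rxy.
  have := conn x y ax ay rxy.
  have -> : x = r0 x by rewrite /r0 (negbTE xb).
  have -> : y = r0 y by rewrite /r0 (negbTE yb).
  rewrite {1}/r0 (negbTE xb) {1}/r0 (negbTE yb).
  move=> /connectP[p]; elim: p x {ax xb rxy} => [|z p IHp] x /=; first by move=> _ ->; exact: connect0.
  case/andP=> /andP[exz /eqP rxz] pz ly; apply: connect_trans (IHp z pz ly).
  case: (eqVneq (r0 x) (r0 z)) => [->|nxz]; first exact: connect0.
  apply: connect1; rewrite /= !rr0 rxz eqxx andbT /quot nxz.
  by apply/existsP; exists x; apply/existsP; exists z; rewrite exz !eqxx.
have := @has_plane_map_merge T e D ed n vt pd (ed d0) M C.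
rewrite vpd d0b npd; apply=> //.
by rewrite (fconnect1 (face ed n)).
Qed.

End Contract.

(** * Euler's inequality *)

Section Euler.
Variables (T D : finType) (ed n : D -> D) (vt : D -> T) (d0 : D).
Hypothesis M : plane_map ed n vt.
Hypothesis ed_neq : forall d, ed d != d.
Local Notation phi := (face ed n).

Let jump (p : D -> bool) d := p (n d) (+) p d.
Let defect (p : D -> bool) d := jump p d (+) jump p (ed d).
Let R := [set d : D | enum_rank d < enum_rank (ed d)].

Let edK : involutive ed. Proof. by case: M. Qed.
Let n_inj : injective n. Proof. by case: M. Qed.

Let edR d : (ed d \in R) = (d \notin R).
Proof.
rewrite !inE edK -leqNgt [RHS]leq_eqVlt; case: eqP => // e.
have := ed_neq d; rewrite (enum_rank_inj (val_inj e)) eqxx; by [].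
Qed.

Lemma card_darts : #|D| = #|R|.*2.
Proof.
rewrite -(cardsC R) -addnn; congr addn.
have -> : ~: R = ed @^-1: R by apply/setP => d; rewrite in_setC [RHS]inE edR.
by rewrite card_preimset //; exact: can_inj edK.
Qed.

Let defect_ed p d : defect p (ed d) = defect p d.
Proof. by rewrite /defect edK addbC. Qed.

(** The defects add up the jumps of all darts, and [n] permutes the darts, so every value of [p]
    occurs twice. The defect of one edge thus follows from the others. *)
Let sum_defect p : \big[addb/false]_(d in R) defect p d = false.
Proof.
rewrite big_split /=.
have -> : \big[addb/false]_(d in R) jump p (ed d) = \big[addb/false]_(d in ~: R) jump p d.
  rewrite [RHS](reindex_inj (can_inj edK)) /=.
  by apply: eq_bigl => d; rewrite in_setC edR negbK.
have -> : \big[addb/false]_(d in ~: R) jump p d = \big[addb/false]_(d | d \notin R) jump p d.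
  by apply: eq_bigl => d; rewrite in_setC.
rewrite -(bigID (fun d => d \in R) xpredT) /= big_split /=.
by rewrite -(reindex_inj n_inj (P := xpredT)) addbb.
Qed.

(** All functions [p] on darts are counted. Up to a chosen function [sec] with the same defects, [p]
    is closed, hence a vertex function plus a face function. The defects at all edges but [r0], a
    vertex function normalised to vanish at [vt d0], and a face function determine [p]; so #|D| is
    at most (E - 1) + (V - 1) + F, where #|D| = 2E. *)
Lemma euler_inequality : #|D| + 4 <= 2 * (#|vt @: D| + #|froots phi|).
Proof.
have phi_inj : injective phi by move=> x y /n_inj/(can_inj edK).
have [r0 r0R] : exists r0, r0 \in R.
  by case: (boolP (d0 \in R)) => [|nR]; [exists d0 | exists (ed d0); rewrite edR].
pose Dset (p : {ffun D -> bool}) := [set d in R :\ r0 | defect p d].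
pose sec c := odflt [ffun=> false] [pick p | Dset p == c].
have secP p d : defect (sec (Dset p)) d = defect p d.
  have E : Dset (sec (Dset p)) = Dset p.
    rewrite /sec; case: pickP => [p' /eqP-> //|/(_ p)]; by rewrite eqxx.
  have Er0 x : x \in R :\ r0 -> defect (sec (Dset p)) x = defect p x.
    by move=> xR; have /setP/(_ x) := E; rewrite ![_ \in Dset _]inE xR.
  have ER x : x \in R -> defect (sec (Dset p)) x = defect p x.
    case: (eqVneq x r0) => [-> _|xr xR]; last by rewrite Er0 // in_setD1 xr.
    have := sum_defect p; rewrite (bigD1 r0) //=.
    have := sum_defect (sec (Dset p)); rewrite (bigD1 r0) //=.
    have -> : \big[addb/false]_(i in R | i != r0) defect (sec (Dset p)) i =
              \big[addb/false]_(i in R | i != r0) defect p i.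
      by apply: eq_bigr => i /andP[iR ir]; rewrite Er0 // in_setD1 ir.
    by move: (defect _ r0) (defect _ r0) (\big[_/_]_(i in R | _) _) => [] [] [].
  by case: (boolP (d \in R)) => dR; [exact: ER | rewrite -!(defect_ed _ d) ER // edR].
pose V := vt @: D; pose F := [set d | froots phi d].
pose X := setX (setX (powerset (R :\ r0)) (powerset (V :\ vt d0))) (powerset F).
pose G (z : {set D} * {set T} * {set D}) : {ffun D -> bool} :=
  [ffun d => sec z.1.1 d (+) (vt d \in z.1.2) (+) (froot phi d \in z.2)].
have sub : [set: {ffun D -> bool}] \subset G @: X.
  apply/subsetP => p _.
  have [_ _ _ /(_ (fun d => p d (+) sec (Dset p) d))[]] := M.
    move=> d; have := secP p d; rewrite /defect /jump.
    do 4!move: (sec _ _) => []; by move: (p (n d)) (p d) (p (n (ed d))) (p (ed d)) => [] [] [] [].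
  move=> h0 [q0 [q0f pE0]].
  pose h u := h0 u (+) h0 (vt d0); pose q u := q0 u (+) h0 (vt d0).
  have qf d : q (phi d) = q d by rewrite /q q0f.
  have pE d : p d (+) sec (Dset p) d = h (vt d) (+) q d.
    by rewrite pE0 /h /q; case: (h0 (vt d)) (h0 (vt d0)) (q0 d) => [] [] [].
  have qroot d : q (froot phi d) = q d.
    have /iter_findex <- : fconnect phi d (froot phi d) by exact: connect_root.
    by elim: (findex _ _ _) => [//|k <- /=]; rewrite qf.
  apply/imsetP; exists (Dset p, [set u in V | h u], [set d in F | q d]).
    rewrite !inE /=; apply/andP; split; first (apply/andP; split).
    - by apply/subsetP => d; rewrite inE => /andP[].
    - apply/subsetP => u; rewrite !inE => /andP[-> hu]; rewrite andbT.
      by apply: contraTneq hu => ->; rewrite /h addbb.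
    - by apply/subsetP => d; rewrite inE => /andP[].
  apply/ffunP => d; rewrite ffunE /= !inE imset_f //= -/(froots phi (froot phi d)).
  rewrite roots_root ?qroot; last exact: fconnect_sym.
  by rewrite -addbA -pE addbC -addbA addbb addbF.
have := leq_trans (subset_leq_card sub) (leq_imset_card _ _).
rewrite cardsT card_ffun card_bool !cardsX !card_powerset -!expnD leq_exp2l //.
have := cardsD1 r0 R; rewrite r0R; have := cardsD1 (vt d0) V; rewrite imset_f //.
have -> : #|F| = #|froots phi| by apply: eq_card => d; rewrite inE.
rewrite -/V card_darts; lia.
Qed.

End Euler.

(** * The grid *)

Section Grid.
Variable N : nat.
Local Notation W := ('I_N.+1 * 'I_N.+1)%type.

Definition grid_adj : rel W := fun a b =>
  ((a.1 == b.1) && (((a.2).+1 == b.2 :> nat) || ((b.2).+1 == a.2 :> nat)))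
  || ((a.2 == b.2) && (((a.1).+1 == b.1 :> nat) || ((b.1).+1 == a.1 :> nat))).


Local Notation Q := (W * 'I_4)%type.

Definition grid_dart (i j k : nat) : Q := ((inord i, inord j), inord k).

(* directions 0, 1, 2, 3 are east, north, west, south *)
Definition grid_valid (z : Q) : bool :=
  match val z.2 with
  | 0 => z.1.1 < N | 1 => z.1.2 < N | 2 => 0 < z.1.1 | _ => 0 < z.1.2
  end.

Definition grid_flip (z : Q) : Q :=
  if grid_valid z then
    match val z.2 with
    | 0 => grid_dart z.1.1.+1 z.1.2 2 | 1 => grid_dart z.1.1 z.1.2.+1 3
    | 2 => grid_dart z.1.1.-1 z.1.2 0 | _ => grid_dart z.1.1 z.1.2.-1 1
    end
  else z.

(** Adding 3 modulo 4 is a clockwise turn, so that inside the grid the face of an east dart is the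
    unit square above it, run through counterclockwise. *)
Definition grid_turn (z : Q) : Q := (z.1, inord ((z.2 + 3) %% 4)).

Lemma grid_dartE i j k : i <= N -> j <= N -> k < 4 ->
  [/\ (grid_dart i j k).1.1 = i :> nat, (grid_dart i j k).1.2 = j :> nat & (grid_dart i j k).2 = k :> nat].
Proof. by move=> iN jN k4; split; rewrite /= inordK. Qed.

Lemma grid_dartP (z : Q) : z = grid_dart z.1.1 z.1.2 z.2.
Proof. by case: z => [[i j] k]; rewrite /grid_dart !inord_val. Qed.

Lemma grid_dart_ind (P : Q -> Prop) :
  (forall i j k, i <= N -> j <= N -> k < 4 -> P (grid_dart i j k)) -> forall z, P z.
Proof. by move=> H z; rewrite (grid_dartP z); apply: H; [exact: (ltn_ord z.1.1)|exact: (ltn_ord z.1.2)|exact: ltn_ord]. Qed.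

Lemma grid_validE i j k : i <= N -> j <= N -> k < 4 ->
  grid_valid (grid_dart i j k) =
  match k with 0 => i < N | 1 => j < N | 2 => 0 < i | _ => 0 < j end.
Proof. by move=> iN jN k4; have [a b c] := grid_dartE iN jN k4; rewrite /grid_valid [val _]c a b. Qed.

Lemma grid_flipE i j k : i <= N -> j <= N -> k < 4 -> grid_valid (grid_dart i j k) ->
  grid_flip (grid_dart i j k) =
    match k with
    | 0 => grid_dart i.+1 j 2 | 1 => grid_dart i j.+1 3 | 2 => grid_dart i.-1 j 0 | _ => grid_dart i j.-1 1 end.
Proof. by move=> iN jN k4; have [a b c] := grid_dartE iN jN k4; rewrite /grid_flip [val _]c a b => ->. Qed.

Lemma grid_turnE i j k : k < 4 -> grid_turn (grid_dart i j k) = grid_dart i j ((k + 3) %% 4).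
Proof. by move=> k4; rewrite /grid_turn /= inordK. Qed.

Lemma grid_flip_valid z : grid_valid (grid_flip z) = grid_valid z.
Proof.
elim/grid_dart_ind: z => i j k iN jN k4; case: (boolP (grid_valid (grid_dart i j k))) => [v|v]; last first.
  by rewrite /grid_flip (negbTE v) /= (negbTE v).
rewrite grid_flipE //; move: v; rewrite grid_validE //.
by case: k k4 => [|[|[|[|]]]] // _ v; rewrite grid_validE //; lia.
Qed.

Lemma grid_flipK : involutive grid_flip.
Proof.
elim/grid_dart_ind => i j k iN jN k4; case: (boolP (grid_valid (grid_dart i j k))) => [v|v]; last first.
  by rewrite /grid_flip !(negbTE v).
rewrite grid_flipE //; move: (v); rewrite -grid_flip_valid grid_flipE //; move: v; rewrite grid_validE //.
case: k k4 => [|[|[|[|]]]] // _ v v'; rewrite grid_flipE //; try lia; congr grid_dart; lia.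
Qed.

Lemma grid_turn_inj : injective grid_turn.
Proof.
move=> [w k] [w' k'] [-> /(congr1 val)] /=; rewrite !inordK ?ltn_mod // => e.
congr pair; apply/val_inj => /=; have := ltn_ord k; have := ltn_ord k'; lia.
Qed.

Lemma grid_turn_fconnect z z' : (z.1 == z'.1) = fconnect grid_turn z z'.
Proof.
apply/eqP/idP => [|/iter_findex <-]; last by elim: (findex _ _ _) => [|k ->].
case: z z' => [w k] [_ k'] /= <-.
have it m : iter m grid_turn (w, k) = (w, inord ((k + 3 * m) %% 4)).
  elim: m => [|m /= ->]; first by rewrite /= muln0 addn0 modn_small ?inord_val.
  rewrite /grid_turn /= inordK ?ltn_mod //; congr (_, inord _); lia.
have -> : (w, k') = iter (k + 3 * k') grid_turn (w, k).
  rewrite it; congr pair; apply/val_inj; rewrite /= inordK ?ltn_mod //.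
  have := ltn_ord k; have := ltn_ord k'; lia.
exact: fconnect_iter.
Qed.

(** A discrete Poincaré lemma. The face jump [g] of [p] is a function on edges that sums to zero
    around every unit square. Hence it is the difference of a potential [h], obtained by summing
    along the bottom row and then up a column, and [p] plus [h] is constant on faces. *)
Lemma grid_plane_map :
  plane_map (restrict_ed grid_flip_valid) (return_map (B := grid_valid) grid_turn)
    (fun x => (val x).1).
Proof.
set ed := restrict_ed _; set n := return_map _.
have n_inj : injective n by apply: return_map_inj; exact: grid_turn_inj.
have vtE x y : ((val x).1 == (val y).1) = fconnect n x y.
  by rewrite grid_turn_fconnect return_map_fconnect //; exact: grid_turn_inj.
split=> [x|//|//|p pP]; first by apply: val_inj; rewrite /= grid_flipK.
pose g d := p (face ed n d) (+) p d.
have edK x : ed (ed x) = x by apply: val_inj; rewrite /= grid_flipK.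
have g_ed d : g (ed d) = g d.
  rewrite /g /face edK; have := pP d.
  by move: (p (n d)) (p d) (p (n (ed d))) (p (ed d)) => [] [] [] [].
pose ext (f : {x | grid_valid x} -> bool) z := if insub z is Some d then f d else false.
have extE f d : ext f (val d) = f d by rewrite /ext valK.
have ext_flip z : ext g (grid_flip z) = ext g z.
  case: (boolP (grid_valid z)) => v; last by rewrite /grid_flip (negbTE v).
  by rewrite -[z]/(val (Sub z v : {x | grid_valid x})) extE -g_ed -extE.
have gE z : grid_valid z -> grid_valid (grid_turn (grid_flip z)) ->
    ext g z = ext p (grid_turn (grid_flip z)) (+) ext p z.
  move=> v v'; rewrite -[z in LHS]/(val (Sub z v : {x | grid_valid x})) extE /g.
  have -> : face ed n (Sub z v) = Sub _ v'.
    by apply: val_inj; rewrite return_map_live //; exact: grid_turn_inj.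
  by rewrite -!extE.
pose gx i j := ext g (grid_dart i j 0); pose gy i j := ext g (grid_dart i j 1).
have square i j : i < N -> j < N -> gx i j (+) gy i.+1 j (+) gx i j.+1 (+) gy i j = false.
  move=> iN jN.
  have v0 : grid_valid (grid_dart i j 0) by rewrite grid_validE //; lia.
  have v1 : grid_valid (grid_dart i.+1 j 1) by rewrite grid_validE //; lia.
  have v2 : grid_valid (grid_dart i.+1 j.+1 2) by rewrite grid_validE //; lia.
  have v3 : grid_valid (grid_dart i j.+1 3) by rewrite grid_validE //; lia.
  have e0 : grid_turn (grid_flip (grid_dart i j 0)) = grid_dart i.+1 j 1.
    by rewrite grid_flipE ?grid_turnE //; lia.
  have e1 : grid_turn (grid_flip (grid_dart i.+1 j 1)) = grid_dart i.+1 j.+1 2.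
    by rewrite grid_flipE ?grid_turnE //; lia.
  have e2 : grid_turn (grid_flip (grid_dart i.+1 j.+1 2)) = grid_dart i j.+1 3.
    by rewrite grid_flipE ?grid_turnE //; lia.
  have e3 : grid_turn (grid_flip (grid_dart i j.+1 3)) = grid_dart i j 0.
    by rewrite grid_flipE ?grid_turnE //; lia.
  have -> : gx i j.+1 = ext g (grid_dart i.+1 j.+1 2).
    by rewrite -ext_flip grid_flipE //; lia.
  have -> : gy i j = ext g (grid_dart i j.+1 3).
    by rewrite -ext_flip grid_flipE //; lia.
  rewrite /gx /gy !gE ?e0 ?e1 ?e2 ?e3 //.
  by do 4!move: (ext p _) => [].
pose hn i j := \big[addb/false]_(0 <= k < i) gx k 0 (+) \big[addb/false]_(0 <= k < j) gy i k.
have hy i j : hn i j.+1 (+) hn i j = gy i j.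
  rewrite /hn big_nat_recr //=.
  by case: (\big[addb/false]_(0 <= k < i) _) (\big[addb/false]_(0 <= k < j) _) (gy i j) => [] [] [].
have hx i j : i < N -> j <= N -> hn i.+1 j (+) hn i j = gx i j.
  move=> iN; elim: j => [_|j IH jN].
    by rewrite /hn !(@big_geq _ _ _ 0 0) // big_nat_recr //= !addbF addbC addbA addbb.
  have := IH (ltnW jN); have := hy i j; have := hy i.+1 j; have := square i j iN jN.
  move: (hn _ _) (hn i.+1 j) (hn i j.+1) (hn i j) (gx i j) (gx i j.+1) (gy i j) (gy i.+1 j).
  by do 8!case.
pose h (w : W) := hn w.1 w.2.
have exact d : g d = h (val d).1 (+) h (val (ed d)).1.
  (* East and north suffice: the other two directions are their reverses, and [g] does not
     distinguish the two darts of an edge. *)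
  have low z : grid_valid z -> z.2 < 2 -> ext g z = h z.1 (+) h (grid_flip z).1.
    elim/grid_dart_ind: z => i j k iN jN k4 v; have [a b c] := grid_dartE iN jN k4.
    rewrite c => k2; move: (v); rewrite grid_validE // grid_flipE //.
    case: k k2 k4 {a b c v} => [|[|//]] _ _ v; rewrite /h /= !inordK //; try lia.
      by rewrite -/(gx i j) -hx // addbC.
    by rewrite -/(gy i j) -hy addbC.
  case: (ltnP (val d).2 2) => d2; first by rewrite -extE low ?(valP d).
  rewrite -g_ed addbC -{3}(edK d) -extE low ?(valP (ed d)) //=.
  move: d2 (valP d) => /=; elim/grid_dart_ind: (val d) => i j k iN jN k4 + v.
  rewrite grid_flipE //; have [_ _ ->] := grid_dartE iN jN k4.
  by case: k k4 {v} => [|[|[|[|//]]]] // _ _; rewrite /= inordK.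
exists h, (fun d => p d (+) h (val d).1); split=> d; last by rewrite addbC -addbA addbb addbF.
have -> : (val (face ed n d)).1 = (val (ed d)).1.
  by apply/eqP; rewrite vtE fconnect_sym // fconnect1.
have := exact d; rewrite /g.
by move: (p _) (p d) (h _) (h _) => [] [] [] [].
Qed.

Lemma grid_has_plane_map : has_plane_map grid_adj.
Proof.
exists {x | grid_valid x}, (restrict_ed grid_flip_valid), (return_map grid_turn), (fun x => (val x).1).
split; first exact: grid_plane_map.
move=> [a b] [c d]; apply/idP/existsP => [|[x /andP[/eqP xa /eqP xc]]].
  have aN := ltn_ord a; have bN := ltn_ord b; have cN := ltn_ord c; have dN := ltn_ord d.
  have mk k : k < 4 -> grid_valid (grid_dart a b k) -> (grid_flip (grid_dart a b k)).1 = (c, d) ->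
      exists x : {x | grid_valid x}, ((val x).1 == (a, b)) &&
        ((val (restrict_ed grid_flip_valid x)).1 == (c, d)).
    by move=> k4 v e; exists (Sub _ v); rewrite /= e /grid_dart /= !inord_val !eqxx.
  rewrite /grid_adj /= => /orP[]/andP[/eqP e /orP[]/eqP f].
  - apply: (mk 1) => //; first by rewrite grid_validE //; lia.
    by rewrite grid_flipE ?grid_validE //= ?f ?e ?inord_val //; lia.
  - apply: (mk 3) => //; first by rewrite grid_validE //; lia.
    by rewrite grid_flipE ?grid_validE //= -?f -?e ?inord_val //; lia.
  - apply: (mk 0) => //; first by rewrite grid_validE //; lia.
    by rewrite grid_flipE ?grid_validE //= ?f ?e ?inord_val //; lia.
  - apply: (mk 2) => //; first by rewrite grid_validE //; lia.
    by rewrite grid_flipE ?grid_validE //= -?f -?e ?inord_val //; lia.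
suff key z : grid_valid z -> grid_adj z.1 (grid_flip z).1.
  by rewrite -xa -xc; exact: key (valP x).
elim/grid_dart_ind: z => i j k iN jN k4 v; have [ei ej ek] := grid_dartE iN jN k4.
move: (v); rewrite grid_validE // grid_flipE // /grid_adj /=.
by case: k k4 {v ei ej ek} => [|[|[|[|//]]]] // _ v /=; rewrite -!val_eqE /= !inordK //; lia.
Qed.

End Grid.

(** * Minors *)

Section Minor.
Variables (W T : finType) (g : rel W) (e : rel T).

Definition restr (P : pred W) : rel W := fun x y => [&& g x y, P x & P y].

Lemma first_exit (P Q : pred W) x y : P x -> ~~ P y -> Q x ->
  connect (restr Q) x y ->
  exists a b, [/\ connect (restr (fun z => P z && Q z)) x a, P a, ~~ P b, Q b & g a b].
Proof.
move=> Px nPy Qx /connectP[p pth ly]; elim: p x Px Qx pth ly => [|z p IH] x Px Qx /=.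
  by move=> _ ly; rewrite ly Px in nPy.
case/andP=> /and3P[gxz _ Qz] pz ly; case: (boolP (P z)) => Pz; last first.
  by exists x, z; split=> //; exact: connect0.
have [a [b [xa Pa nPb Qb gab]]] := IH z Pz Qz pz ly.
exists a, b; split=> //; apply: connect_trans (connect1 _) xa.
by rewrite /restr gxz /= Px Qx Pz Qz.
Qed.

(* [star u] stands for u and [link u v] for the middle of the edge uv.  They may
   overlap, so the branch set of u consists of what is reachable from [base u]
   inside the star of u and the parts of its links outside the other star. *)
Variables (star : T -> pred W) (link : T -> T -> pred W) (base : T -> W).
Hypotheses (g_sym : symmetric g) (g_irr : irreflexive g) (e_sym : symmetric e)
  (e_irr : irreflexive e).
Hypothesis star_base : forall u, star u (base u).
Hypothesis star_conn : forall u x, star u x -> connect (restr (star u)) (base u) x.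
Hypothesis star_disj : forall u v x, star u x -> star v x -> u = v.
Hypothesis link_star : forall u v w x, e u v -> link u v x -> star w x -> w = u \/ w = v.
Hypothesis link_disj : forall u v u' v' x, e u v -> e u' v' -> link u v x -> link u' v' x ->
  (u = u' /\ v = v') \/ (u = v' /\ v = u').
Hypothesis link_conn : forall u v, e u v -> exists a b,
  [/\ star u a, star v b, link u v a, link u v b & connect (restr (link u v)) a b].

Let rk (u : T) := enum_rank u.
(** Comparing ranks assigns each link to only one of its ends; without this the sets of adjacent
    vertices would overlap. *)
Let X u x := star u x || [exists v, [&& e u v, rk u < rk v, link u v x & ~~ star v x]].
Let fiber u x := connect (restr (X u)) (base u) x.

Let fiberX u x : fiber u x -> X u x.
Proof.
have X0 : X u (base u) by rewrite /X star_base.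
case/connectP => p; elim: p (base u) X0 => [|z p IH] b Xb /=; first by move=> _ ->.
by case/andP=> /and3P[_ _ Xz] pz /(IH z Xz pz).
Qed.

Let X_disj u v x : X u x -> X v x -> u = v.
Proof.
move=> /orP[su|/existsP[v1 /and4P[e1 r1 l1 n1]]] /orP[sv|/existsP[v2 /and4P[e2 r2 l2 n2]]].
- exact: star_disj su sv.
- by case: (link_star e2 l2 su) => // uv; move: n2; rewrite -uv su.
- by case: (link_star e1 l1 sv) => [->|vv] //; move: n1; rewrite -vv sv.
case: (link_disj e1 e2 l1 l2) => [[]//|[uv vu]]; move: r1 r2; rewrite uv vu; lia.
Qed.

Let connect_sub_restr (P Q : pred W) x y : (forall z, P z -> Q z) ->
  connect (restr P) x y -> connect (restr Q) x y.
Proof.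
move=> PQ; apply: connect_sub => a b /and3P[gab /PQ Qa /PQ Qb].
by apply: connect1; rewrite /restr gab Qa Qb.
Qed.

Let star_fiber u x : star u x -> fiber u x.
Proof. by move=> /star_conn; apply: connect_sub_restr => z sz; rewrite /X sz. Qed.

(** Along the link from the star of [u], the last point before the star of [v] is first entered
    still belongs to the branch set of [u]. *)
Let edge_fiber u v : e u v -> rk u < rk v -> exists a b, [/\ fiber u a, fiber v b & g a b].
Proof.
move=> euv ruv; have [a [b [sa sb la lb ab]]] := link_conn euv.
have uv : u != v by apply: contraTneq euv => ->; rewrite e_irr.
have nva : ~~ star v a by apply: contra uv => /(star_disj sa) ->.
have nvb : ~~ predC (star v) b by rewrite /= sb.
have [a' [b' [aa' na' nb' lb' gab]]] := @first_exit (predC (star v)) _ _ _ nva nvb la ab.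
exists a', b'; split=> //; last by apply: star_fiber; rewrite /= negbK in nb'.
apply: connect_trans (star_fiber sa) _; apply: connect_sub_restr aa' => z /= /andP[nz lz].
by rewrite /X; apply/orP; right; apply/existsP; exists v; rewrite euv ruv lz.
Qed.

Lemma has_plane_map_minor : has_plane_map g -> has_plane_map e.
Proof.
move=> PM; case: (pickP (xpredT : pred T)) => [u0 _|none]; last first.
  exists void, id, id, (of_void T); split; last by move=> u; have := none u.
  by split=> // p _; exists xpredT, xpredT; split=> - [].
pose f x := [pick u | fiber u x].
have fE u x : fiber u x -> f x = Some u.
  rewrite /f => ux; case: pickP => [v vx|/(_ u)]; last by rewrite ux.
  by rewrite (X_disj (fiberX ux) (fiberX vx)).
have fP u x : f x = Some u -> fiber u x.
  by rewrite /f; case: pickP => // v vx [<-].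
pose g' : rel W := fun x y => [&& g x y, isSome (f x) & isSome (f y)].
pose r x := odflt u0 (f x).
have g'_sym : symmetric g' by move=> x y; rewrite /g' g_sym; congr andb; rewrite andbC.
have PM' : has_plane_map (quot r g').
  apply: has_plane_map_contract => //.
  - by move=> x; rewrite /g' g_irr.
  - move=> x y /existsP[x' /and3P[_ + _]] /existsP[y' /and3P[_ + _]].
    rewrite /r; case fx: (f x) => [u|//] _; case fy: (f y) => [v|//] _ /= uv.
    have ux := fP _ _ fx; have := fP _ _ fy; rewrite -{}uv => uy.
    have w_sym : symmetric (restr (X u)).
      by move=> a b; rewrite /restr g_sym; congr andb; rewrite andbC.
    have xy : connect (restr (X u)) x y.
      by apply: connect_trans uy; rewrite sym_connect_sym.
    have /connectP[p pth ly] := xy.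
    elim: p x ux pth ly {fx xy} => [|z p IH] x ux /=; first by move=> _ ->; exact: connect0.
    case/andP=> xz pz ly.
    have uz : fiber u z by apply: connect_trans ux (connect1 xz).
    apply: connect_trans (IH z uz pz ly); apply: connect1.
    by have /and3P[gxz _ _] := xz; rewrite /= /g' /r (fE _ _ ux) (fE _ _ uz) gxz eqxx.
  - by apply: has_plane_map_sub PM => // x y /and3P[].
apply: has_plane_map_sub PM' => // u v euv.
have key a b : e a b -> rk a < rk b -> quot r g' a b.
  move=> eab rab; have [x [y [fx fy gxy]]] := edge_fiber eab rab.
  apply/andP; split; first by apply: contraTneq rab => ->; rewrite ltnn.
  apply/existsP; exists x; apply/existsP; exists y.
  by rewrite /r /g' (fE _ _ fx) (fE _ _ fy) gxy !eqxx.
case: (ltngtP (rk u) (rk v)) => [|ruv|ruv]; first exact: key.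
  by rewrite quot_sym //; apply: key; rewrite // e_sym.
by rewrite (enum_rank_inj (val_inj ruv)) e_irr in euv.
Qed.

End Minor.

(** * Discharging *)

Section Walk.
Variables (T : finType) (e : rel T).

Definition walk n a b : Prop := exists p, [/\ size p = n, path e a p & last a p = b].

Lemma walk0 a : walk 0 a a. Proof. by exists [::]. Qed.

Lemma walk1 a b : e a b -> walk 1 a b.
Proof. by move=> ab; exists [:: b]; rewrite /= ab. Qed.

Lemma walk_cat m n a b c : walk m a b -> walk n b c -> walk (m + n) a c.
Proof.
move=> [p [<- pp <-]] [q [<- pq <-]].
by exists (p ++ q); rewrite size_cat cat_path last_cat pp.
Qed.

Lemma walkS n a b c : e a b -> walk n b c -> walk n.+1 a c.
Proof. by move=> /walk1; apply: walk_cat. Qed.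

Lemma walkSP n a c : walk n.+1 a c -> exists2 b, e a b & walk n b c.
Proof. by move=> [[|b p]] [//= [sp] /andP[ab pp] lp]; exists b => //; exists p. Qed.

Lemma walk0P a b : walk 0 a b -> a = b.
Proof. by move=> [[|c p]] []. Qed.

Lemma walk_rev n a b : symmetric e -> walk n a b -> walk n b a.
Proof.
move=> sym; elim: n a b => [|n IH] a b; first by move=> /walk0P->; exact: walk0.
move=> /walkSP[c ac cb]; rewrite -addn1; apply: walk_cat (IH _ _ cb) _.
by apply: walk1; rewrite sym.
Qed.

(** Closed walks are easier to carry than cycles: they are preserved under inclusion of graphs, can
    be cut and concatenated, and lift piecewise from a quotient. *)
Definition odd_girth7 : Prop := forall n a, odd n -> n <= 5 -> ~ walk n a a.

End Walk.

Lemma walk_sub (T : finType) (e e' : rel T) n a b :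
  subrel e' e -> walk e' n a b -> walk e n a b.
Proof. by move=> sub [p [sp pp lp]]; exists p; split=> //; apply: sub_path pp. Qed.

Section MapFacts.
Variables (T D : finType) (e : rel T) (ed n : D -> D) (vt : D -> T).
Hypotheses (M : plane_map ed n vt) (C : carries ed vt e).
Local Notation phi := (face ed n).

Lemma vt_rot d : vt (n d) = vt d.
Proof. by have [_ n_inj vtE _] := M; apply/eqP; rewrite vtE fconnect_sym // fconnect1. Qed.

Lemma vt_face d : vt (phi d) = vt (ed d).
Proof. exact: vt_rot. Qed.

Lemma face_inj : injective phi.
Proof. by have [edK n_inj _ _] := M; move=> x y /n_inj/(can_inj edK). Qed.

Lemma dart_adj d : e (vt d) (vt (ed d)).
Proof. by rewrite C; apply/existsP; exists d; rewrite !eqxx. Qed.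

Lemma walk_face k d : walk e k (vt d) (vt (iter k phi d)).
Proof.
elim: k d => [|k IH] d; first exact: walk0.
by rewrite iterSr; apply: walkS (dart_adj d) _; rewrite -vt_face.
Qed.

Lemma degree_card d : order n d = #|[set z | vt z == vt d]|.
Proof. by have [_ _ vtE _] := M; apply: eq_card => z; rewrite !inE -vtE eq_sym. Qed.

End MapFacts.

Section Reducible.
Variables (T D : finType) (e : rel T) (ed n : D -> D) (vt : D -> T).
Local Notation phi := (face ed n).

(* [d0] is a dart at a vertex v of degree 3, on a 4-face v w1 x w2 with no walk
   of length 5 from v to x; x has degree 3, or the third neighbour of v has
   degree at most 4 *)
Definition reducible_at (S : {set T}) (d0 : D) : Prop :=
  [/\ vt d0 \notin S, order n d0 = 3, order phi d0 = 4,
      ~ walk e 5 (vt d0) (vt (phi (phi d0))) &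
      (vt (phi (phi d0)) \notin S /\ order n (phi (phi d0)) = 3) \/
      (vt (ed (n d0)) \notin S /\ order n (ed (n d0)) <= 4)].

End Reducible.

Section Discharging.
Variables (T D : finType) (e : rel T) (ed n : D -> D) (vt : D -> T) (O : {set D}).
Hypotheses (M : plane_map ed n vt) (C : carries ed vt e).
Hypothesis simple : forall d d', vt d = vt d' -> vt (ed d) = vt (ed d') -> d = d'.
Hypothesis og : odd_girth7 e.
Local Notation phi := (face ed n).
Local Notation S := (vt @: O).
Hypothesis O_closed : forall d, (phi d \in O) = (d \in O).
Hypothesis O_order : forall d, d \in O -> order phi d = 7.
Hypothesis O_orbit : {in O &, forall d d', fconnect phi d d'}.
Hypothesis O_card : O != set0 -> #|O| = 7.
Hypothesis O_inj : {in O &, injective vt}.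
Hypothesis O_exit : O != set0 -> exists d, [/\ vt d \in S, d \notin O & ed d \notin O].
Hypothesis deg3 : forall d, vt d \notin S -> 3 <= order n d.

Let edK : involutive ed. Proof. by case: M. Qed.
Let n_inj : injective n. Proof. by case: M. Qed.
Let vtE d d' : (vt d == vt d') = fconnect n d d'. Proof. by case: M. Qed.

Let vt_n := vt_rot M.
Let vt_phi := vt_face M.
Let phi_inj := face_inj M.
Let dart_edge := dart_adj C.
Let walk_phi := walk_face M C.

Let ed_neq d : ed d != d.
Proof.
apply/eqP => edd; have := @og 1 (vt d) erefl erefl; apply; apply: walk1.
by rewrite -{2}edd.
Qed.

Let deg d := order n d.
Let len d := order phi d.

Let deg_vt d d' : vt d = vt d' -> deg d = deg d'.
Proof.
move=> /eqP; rewrite vtE => dd; apply: eq_card => z.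
by rewrite !inE (same_connect (fconnect_sym n_inj) dd).
Qed.

Let deg_card := degree_card M.

Let len_phi d : len (phi d) = len d.
Proof.
by apply: eq_card => z; rewrite !inE -(same_fconnect1 phi_inj).
Qed.

Let O_ed d : d \in O -> ed d \notin O.
Proof.
move=> dO; apply/negP => edO.
have pO : phi d \in O by rewrite O_closed.
have e1 : phi d = ed d by apply: O_inj; rewrite ?vt_phi.
have e2 : phi (phi d) = d.
  by apply: O_inj; rewrite ?O_closed // vt_phi e1 edK.
have cyc : fcycle phi [:: d; phi d] by rewrite /= eqxx e2 eqxx.
by have := order_le_cycle cyc (mem_head _ _); rewrite (O_order dO).
Qed.

Let O_next d d' : d \in O -> d' \in O -> vt (ed d) = vt d' -> phi d = d'.
Proof. by move=> dO dO' dd; apply: O_inj; rewrite ?O_closed // vt_phi. Qed.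

Let S_ed d : d \in O -> vt (ed d) \in S.
Proof. by move=> dO; rewrite -vt_phi; apply: imset_f; rewrite O_closed. Qed.

Let n_neq d : n d != d.
Proof.
have [|dS] := boolP (vt d \in S); last first.
  apply/eqP => nd; have cyc : fcycle n [:: d] by rewrite /= nd eqxx.
  by have := leq_trans (deg3 dS) (order_le_cycle cyc (mem_head _ _)).
case/imsetP => o oO vo; apply/eqP => nd.
have all_d z : vt z = vt d -> z = d.
  move=> /eqP; rewrite eq_sym vtE => /iter_findex <-.
  by elim: (findex _ _ _) => [//|k /= ->].
have od : o = d by apply: all_d.
have p1 : phi (finv phi o) = o by rewrite f_finv.
have pO : finv phi o \in O by rewrite -O_closed p1.
have : ed (finv phi o) = d by apply: all_d; rewrite -vt_phi p1.
by rewrite -od => eo; have := O_ed pO; rewrite eo oO.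
Qed.

(** A face is a closed walk, so its length is not 1, 3 or 5. As there are no parallel edges, length
    2 would need a vertex of degree 1, which [n_neq] excludes. *)
Lemma face_length d : len d = 4 \/ 6 <= len d.
Proof.
have w : walk e (len d) (vt d) (vt d) by have := walk_phi (len d) d; rewrite iter_order.
have l0 : 0 < len d by exact: order_gt0.
have l2 : len d != 2.
  apply/eqP => l2; have := iter_order phi_inj d; rewrite -/(len d) l2 /= => dd.
  have pe : phi d = ed d.
    by apply: simple; rewrite ?vt_phi // -vt_phi dd edK.
  by have := n_neq (ed d); rewrite -/(phi d) pe eqxx.
have nodd : odd (len d) -> len d <= 5 -> False by move=> o5 l5; exact: og w.
case E: (len d) l0 l2 nodd => [|[|[|[|[|[|k]]]]]] //= _ _ H; try by case: (H erefl erefl).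
  by left.
by right.
Qed.

Let big d := 6 <= len d.

Let bigE d : big d = (len d != 4).
Proof. by rewrite /big; case: (face_length d) => [->|]; lia. Qed.

(* Charges 3 deg - 12 of vertices and 3 len - 12 of faces.  A face of length at
   least 6 gives 1 to each of its corners outside S; a vertex of degree 3 with a
   4-face opposite to a dart [d] ([tau d]) receives 1 along [d]. *)
Let inS d := vt d \in S.
Let tau d := [&& ~~ inS d, deg d == 3 & len (finv n d) == 4].
Let corner d := big d && ~~ inS d.

Hypothesis safe : forall d0, vt d0 \notin S -> deg d0 = 3 -> len d0 = 4 ->
  ~ walk e 5 (vt d0) (vt (phi (phi d0))).
Hypothesis irreducible : forall d0, ~ reducible_at e ed n vt S d0.

(** A giver of degree at most 4 would be the third neighbour of the receiver, seen from the
    receiver's opposite 4-face, and the receiver would be reducible. *)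
Let tau_deg d : tau (ed d) -> ~~ inS d -> 5 <= deg d.
Proof.
move=> /and3P[sS /eqP d3 /eqP l4] dS; rewrite leqNgt; apply/negP => d4.
have nf : n (finv n (ed d)) = ed d by rewrite f_finv.
have vf : vt (finv n (ed d)) = vt (ed d) by rewrite -vt_n nf.
apply: (irreducible (d0 := finv n (ed d))); split; rewrite ?vf //.
- by rewrite -/(deg _) (deg_vt vf).
- by rewrite -vf; apply: safe; rewrite ?vf // (deg_vt vf).
by right; rewrite nf edK; split.
Qed.

(** If the face between two consecutive receivers were a 4-face, they would be two opposite vertices
    of degree 3 on it: a reducible configuration. *)
Let tau_big d : tau (ed d) -> tau (ed (n d)) -> big (n d).
Proof.
move=> /and3P[s1 /eqP d1 _] /and3P[s2 /eqP d2 _]; rewrite bigE; apply/eqP => l4.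
have pE : phi (ed d) = n d by rewrite /face edK.
have l4' : len (ed d) = 4 by rewrite -len_phi pE.
have vpp : vt (phi (phi (ed d))) = vt (ed (n d)) by rewrite pE vt_phi.
apply: (irreducible (d0 := ed d)); split=> //; first exact: safe.
by left; rewrite vpp; split=> //; rewrite -/(deg _) (deg_vt vpp).
Qed.

(** In degree 3 every corner brings 1, from its face if that is big and otherwise along the edge
    opposite to it; this covers the deficit 3. In degree 4 nothing is given, by [tau_deg]. From
    degree 5 on, [tau_big] puts a big corner between consecutive receivers, so twice their number is
    at most the degree plus the number of big corners. *)
Let vertex_charge v : v \in vt @: D -> v \notin S ->
  12 + \sum_(d | vt d == v) tau (ed d) <= \sum_(d | vt d == v) (3 + corner d + tau d).
Proof.
case/imsetP=> z _ -> zS; pose N := [set d | vt d == vt z].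
have sumE F : \sum_(d | vt d == vt z) F d = \sum_(d in N) F d.
  by apply: eq_bigl => d; rewrite inE.
have inN d : d \in N -> ~~ inS d by rewrite inE /inS => /eqP->.
have cN : #|N| = deg z by rewrite -deg_card.
have degN d : d \in N -> deg d = deg z by rewrite inE => /eqP/deg_vt.
have cornerN d : d \in N -> corner d = big d by move=> /inN dS; rewrite /corner dS andbT.
have nN d : (n d \in N) = (d \in N) by rewrite !inE vt_n.
have z3 : 3 <= deg z := deg3 zS.
rewrite !sumE !big_split /= sum_nat_const cN.
have [z5|z5] := ltnP (deg z) 5.
  have -> : \sum_(d in N) tau (ed d) = 0.
    apply: big1 => d dN; case E: (tau _) => //.
    by have := tau_deg E (inN _ dN); rewrite degN // leqNgt z5.
  have [z4|z4] := leqP 4 (deg z); first lia.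
  have {z4}z3 : deg z = 3 by lia.
  suff tb : \sum_(d in N) tau d = \sum_(d in N) ~~ big d.
    have cb : \sum_(d in N) corner d + \sum_(d in N) ~~ big d = 3.
      rewrite -big_split /= -z3 -cN -sum1_card.
      by apply: eq_bigr => d /cornerN->; case: (big d).
    by rewrite tb; lia.
  rewrite (reindex_inj n_inj) /=.
  rewrite (eq_bigl (fun d => d \in N)); last exact: nN.
  apply: eq_bigr => d dN.
  by rewrite /tau /inS vt_n (inN _ dN) (deg_vt (vt_n d)) degN // z3 finv_f // bigE negbK.
pose A := [set d in N | tau (ed d)].
have tE : \sum_(d in N) tau (ed d) = #|A|.
  rewrite -sum1_card big_mkcond [RHS]big_mkcond /=.
  by apply: eq_bigr => d _; rewrite !inE; case: (vt d == _) => //=; case: (tau _).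
have AN : #|A| <= #|N| by apply/subset_leq_card/subsetP => d; rewrite inE => /andP[].
have cornE : \sum_(d in N) corner d = #|[set d in N | big d]|.
  rewrite -sum1_card big_mkcond [RHS]big_mkcond /=.
  apply: eq_bigr => d _; rewrite [in RHS]inE; case: (boolP (d \in N)) => // dN /=.
  by rewrite cornerN //; case: (big d).
pose B := n @^-1: A.
have cB : #|B| = #|A| by rewrite card_preimset.
have BN : B \subset N by apply/subsetP => d; rewrite !inE vt_n => /andP[].
have AsN : A \subset N by apply/subsetP => d; rewrite inE => /andP[].
have UN : #|A :|: B| <= #|N| by apply: subset_leq_card; rewrite subUset AsN.
have Ib : #|A :&: B| <= #|[set d in N | big d]|.
  rewrite -(card_imset (A :&: B) n_inj); apply/subset_leq_card/subsetP => _ /imsetP[d + ->].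
  rewrite !inE !vt_n => /andP[/andP[-> t1] /andP[_ t2]] /=; exact: tau_big.
have := cardsUI A B; rewrite tE cornE; move: AN UN Ib; rewrite cB cN.
by set t := #|A|; set bb := #|[set d in N | big d]|; lia.
Qed.

Let Mset := [set d | [&& inS d, d \notin O & ed d \notin O]].
Let edO := [set d | ed d \in O].

Let inS_split d : inS d = [|| d \in O, d \in edO | d \in Mset].
Proof.
rewrite !inE; apply/idP/or3P => [dS|[dO|dO|/and3P[//]]].
- by case: (boolP (d \in O)) => [|d1]; [constructor 1|case: (boolP (ed d \in O)) => d2; [constructor 2|constructor 3; rewrite dS]].
- exact: imset_f.
by rewrite /inS -(edK d); apply: S_ed.
Qed.

Let card_edO : #|edO| = #|O|.
Proof.
have -> : edO = ed @^-1: O by apply/setP => d; rewrite !inE.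
by rewrite card_preimset //; exact: can_inj edK.
Qed.

Let card_inS : #|[set d | inS d]| = 2 * #|O| + #|Mset|.
Proof.
have -> : [set d | inS d] = O :|: edO :|: Mset.
  by apply/setP => d; rewrite !in_setU inE inS_split orbA.
have d1 : [disjoint O & edO].
  rewrite -setI_eq0; apply/eqP/setP => d; rewrite !inE.
  by apply/negP => /andP[dO]; apply/negP/O_ed.
have d2 : [disjoint O :|: edO & Mset].
  rewrite -setI_eq0; apply/eqP/setP => d; rewrite !inE.
  by case: (d \in O) => //=; case: (ed d \in O); rewrite ?andbF.
move: (leq_card_setU O edO) (leq_card_setU (O :|: edO) Mset); rewrite d1 d2.
by move=> [_ /eqP] e1 [_ /eqP]; rewrite e1 card_edO; lia.
Qed.

(** A vertex of the cycle has two darts along it, so [S] carries [2 * #|O| + #|Mset|] darts, and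
    only those of [Mset] can lead to a receiver. The term [6 * #|O|] is the deficit 12 - 3 * 2 of
    each vertex of the cycle. *)
Let charge_S : 12 * #|S| + \sum_(d | inS d) tau (ed d) + 2 * #|Mset| <=
  \sum_(d | inS d) 3 + 6 * #|O|.
Proof.
have -> : #|S| = #|O| by rewrite card_in_imset.
have -> : \sum_(d | inS d) 3 = 3 * #|[set d | inS d]|.
  by rewrite sum_nat_const mulnC; congr muln; apply: eq_card => d; rewrite inE.
have : \sum_(d | inS d) tau (ed d) <= #|Mset|.
  rewrite -sum1_card big_mkcond [leqRHS]big_mkcond /=; apply: leq_sum => d _.
  case: (boolP (inS d)) => // dS; rewrite /Mset inE dS /=.
  case: (boolP (d \in O)) => [dO|dO] /=.
    by rewrite /tau /inS S_ed.
  case: (boolP (ed d \in O)) => [dO'|dO'] /=; last by case: (tau _).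
  by rewrite /tau /inS imset_f.
by rewrite card_inS; lia.
Qed.

Let vertex_total : 12 * #|vt @: D| + 2 * #|Mset| <= 3 * #|D| + \sum_d corner d + 6 * #|O|.
Proof.
have SV : S \subset vt @: D by apply: imsetS; apply/subsetP.
rewrite -(cardsID S (vt @: D)) (setIidPr SV).
have H1 : 12 * #|vt @: D :\: S| + \sum_(d | ~~ inS d) tau (ed d) <=
    \sum_(d | ~~ inS d) (3 + corner d + tau d).
  have part F : \sum_(d | ~~ inS d) F d =
      \sum_(v in vt @: D :\: S) \sum_(d | vt d == v) F d :> nat.
    rewrite (partition_big vt (mem (vt @: D :\: S))) /=; last first.
      by move=> d dS; rewrite inE dS imset_f.
    apply: eq_bigr => v; rewrite inE => /andP[vS _]; apply: eq_bigl => d.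
    by case: eqP => [e0|_]; rewrite ?andbF // andbT /inS e0.
  rewrite !part mulnC -sum_nat_const -big_split /=; apply: leq_sum => v.
  by rewrite inE => /andP[vS vV]; exact: vertex_charge.
have tE : \sum_(d | inS d) tau (ed d) + \sum_(d | ~~ inS d) tau (ed d) = \sum_(d | ~~ inS d) tau d.
  rewrite -(bigID inS xpredT) /= -(reindex_inj (can_inj edK) (P := xpredT) (F := fun d => tau d : nat)).
  rewrite (bigID inS) /= big1 // => d dS; by rewrite /tau dS.
have cE : \sum_d corner d = \sum_(d | ~~ inS d) corner d.
  by rewrite (bigID inS) /= big1 // => d dS; rewrite /corner dS andbF.
have kE : \sum_(d | inS d) 3 + \sum_(d | ~~ inS d) 3 = 3 * #|D|.
  by rewrite -(bigID inS xpredT) /= sum_nat_const mulnC.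
move: H1 charge_S; rewrite cE !big_split /= -kE.
by move: tE; lia.
Qed.

(** Corners in [S] receive nothing, so a big face other than [O] keeps one unit for each of
    these. *)
Let outer d := [&& d \notin O, big d & inS d].

Let face_sum F r : froots phi r -> \sum_(d | froot phi d == r) F d = \sum_(d in fconnect phi r) F d :> nat.
Proof.
move=> rr; apply: eq_bigl => d; rewrite unfold_in /=.
have := root_connect (fconnect_sym phi_inj) r d.
by rewrite (eqP rr : froot phi r = r) eq_sym.
Qed.

Let face_card r : froots phi r -> \sum_(d | froot phi d == r) 1 = len r.
Proof. by move=> rr; rewrite face_sum // sum1_card. Qed.

Let len_root d r : d \in fconnect phi r -> len d = len r.
Proof.
move=> rd; apply: eq_card => z; rewrite !inE.
by rewrite (same_connect (fconnect_sym phi_inj) rd).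
Qed.

Let O_root d r : d \in fconnect phi r -> (d \in O) = (r \in O).
Proof.
move=> /iter_findex <-; elim: (findex _ _ _) => [//|k IH].
by rewrite iterS O_closed.
Qed.

(** A big face of length l gives or keeps one unit per corner, and 2l - 12 remains, which is at
    least 2 for odd l. The exceptional face gives nothing and keeps 3 * 7 - 12 = 9. *)
Let face_charge r : froots phi r ->
  12 + \sum_(d | froot phi d == r) (corner d + outer d) +
    (if r \in O then 9 else 2 * odd (len r)) <= \sum_(d | froot phi d == r) 3.
Proof.
move=> rr; rewrite !face_sum //.
have -> : \sum_(d in fconnect phi r) 3 = len r * 3 by rewrite sum_nat_const.
have cr : #|fconnect phi r| = len r by [].
case: (boolP (r \in O)) => rO.
  rewrite (O_order rO : len r = 7) big1 // => d dr.
  have dO : d \in O by rewrite (O_root dr).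
  by rewrite /corner /outer /inS dO imset_f // andbF.
case: (face_length r) => [l4|l6].
  rewrite l4 big1 // => d /len_root ld.
  by rewrite /corner /outer bigE ld l4 /= andbF.
have -> : \sum_(d in fconnect phi r) (corner d + outer d) = len r.
  rewrite -[RHS]cr -sum1_card; apply: eq_bigr => d dr.
  by rewrite /corner /outer /big (len_root dr) l6 (O_root dr) rO /=; case: (inS d).
by lia.
Qed.

Let even_darts : ~~ odd #|D|.
Proof. by rewrite (card_darts M ed_neq) odd_double. Qed.

(** The 11 is the 9 of the exceptional face plus 2 from another face of odd length, which exists
    because the number of darts is even. *)
Let face_total : 12 * #|froots phi| + \sum_d corner d + \sum_d outer d +
  11 * (O != set0) <= 3 * #|D|.
Proof.
have part F : \sum_d F d = \sum_(r | froots phi r) \sum_(d | froot phi d == r) F d :> nat.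
  by rewrite (partition_big (froot phi) (froots phi)) //= => d _; apply: roots_root; exact: fconnect_sym.
have extra : 11 * (O != set0) <= \sum_(r | froots phi r) (if r \in O then 9 else 2 * odd (len r)).
  case: (set0Pn O) => [[o oO]|] //; rewrite muln1.
  pose ro := froot phi o.
  have rro : froots phi ro by apply: roots_root; exact: fconnect_sym.
  have cro : fconnect phi ro o by rewrite fconnect_sym //; exact: connect_root.
  have roO : ro \in O by rewrite -(O_root cro).
  have [r' rr' [r'o r'odd]] : exists2 r', froots phi r' & r' != ro /\ odd (len r').
    case: (pickP [pred r' | [&& froots phi r', r' != ro & odd (len r')]]) => [r' /and3P[]|no].
      by exists r'.
    exfalso; move/negP: even_darts; apply.
    rewrite -sum1_card part (bigD1 ro) //= oddD face_card // (O_order roO : len ro = 7) /=.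
    rewrite (_ : odd _ = false) //; apply/negbTE.
    elim/big_ind: _ => // [x y xo yo|r /andP[rr rro']].
      by rewrite oddD (negbTE xo) (negbTE yo).
    rewrite face_card //.
    by have := no r; rewrite /= (rr : froots phi r) rro' /= => ->.
  have r'O : r' \notin O.
    apply: contra r'o => r'O; have := O_orbit r'O roO.
    by move/(rootP (fconnect_sym phi_inj)); rewrite (eqP rr' : froot phi r' = r') (eqP rro : froot phi ro = ro) => ->.
  rewrite (bigD1 ro) //= (bigD1 r') /=; last by rewrite rr'.
  by rewrite roO (negbTE r'O) r'odd addnA; exact: leq_addr.
have H : \sum_(r | froots phi r) (12 + \sum_(d | froot phi d == r) (corner d + outer d) +
    (if r \in O then 9 else 2 * odd (len r))) <=
    \sum_(r | froots phi r) \sum_(d | froot phi d == r) 3.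
  by apply: leq_sum => r; exact: face_charge.
move: H; rewrite !big_split /= -!part big_split /= !sum_nat_const.
rewrite (_ : #|D| * 3 = 3 * #|D|); last exact: mulnC.
have -> : #|(fun i : D => froot phi i == i)| = #|froots phi| by apply: eq_card.
move: extra; move: (11 * _) (\sum_(r | froots phi r) _) (\sum_d corner d) (\sum_d outer d).
by move: #|froots phi| #|D|; lia.
Qed.

(** Look at the faces across the seven edges of the cycle. A 4-face there leads in at most two steps
    to a dart of [Mset], so [#|E4| <= 2 * #|M4|]; this settles the cases where [Mb] is nonempty or
    [Eb] is empty. Otherwise a big face met across one edge borders all seven, and [O_exit] gives a
    dart of [Mset]: 7 + 2 is enough. *)
Let outer_bound : O != set0 -> 8 <= 2 * #|Mset| + \sum_d outer d.
Proof.
move=> O0; have cO := O_card O0.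
pose E4 := [set d in edO | ~~ big d]; pose Eb := [set d in edO | big d].
pose M4 := [set d in Mset | ~~ big d]; pose Mb := [set d in Mset | big d].
have big_phi d : big (phi d) = big d by rewrite /big len_phi.
have splitE : #|Eb| + #|E4| = 7.
  rewrite -cO -card_edO -(cardsID [set d | big d] edO); congr addn; apply: eq_card => d; rewrite !inE //.
  by rewrite andbC.
have splitM : #|Mb| + #|M4| = #|Mset|.
  rewrite -(cardsID [set d | big d] Mset); congr addn; apply: eq_card => d; rewrite !inE //.
  by rewrite andbC.
have outE : \sum_d outer d = #|Eb| + #|Mb|.
  have dj : [disjoint Eb & Mb].
    rewrite -setI_eq0; apply/eqP/setP => d; rewrite !inE.
    by case: (ed d \in O); rewrite /= ?andbF.
  have [_ ] := leq_card_setU Eb Mb; rewrite dj => /eqP <-.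
  rewrite -sum1_card big_mkcond [RHS]big_mkcond /=; apply: eq_bigr => d _.
  rewrite /outer !inE inS_split !inE.
  case: (boolP (d \in O)) => [dO|] /=; first by rewrite (negbTE (O_ed dO)) ?andbF.
  by case: (big d); case: (ed d \in O); case: (inS d).
have bigO d : d \in O -> big d by move=> dO; rewrite /big (O_order dO : len d = 7).
have stepS d : d \in edO -> ~~ big d -> phi d \in edO \/ phi d \in Mset.
  rewrite inE => dO nb.
  have dS : inS (phi d) by rewrite /inS vt_phi; apply: imset_f.
  have nO : phi d \notin O by apply: contra nb => /bigO; rewrite big_phi.
  by rewrite !inE dS nO; case: (ed (phi d) \in O); [left|right].
have E4le : #|E4| <= 2 * #|M4|.
  have sub : E4 \subset (phi @^-1: M4) :|: ((phi \o phi) @^-1: M4).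
    apply/subsetP => d; rewrite inE => /andP[dE db].
    have db1 : ~~ big (phi d) by rewrite big_phi.
    have db2 : ~~ big (phi (phi d)) by rewrite big_phi.
    rewrite in_setU; case: (stepS d dE db) => [d1|d1]; last by rewrite !inE; rewrite inE in d1; rewrite d1 db1.
    case: (stepS _ d1 db1) => [d2|d2]; last by rewrite orbC !inE; rewrite inE in d2; rewrite /= d2 db2.
    exfalso; rewrite !inE in dE d1 d2.
    have e1 : phi (ed (phi d)) = ed d by apply: O_next; rewrite // edK vt_phi.
    have e2 : phi (ed (phi (phi d))) = ed (phi d) by apply: O_next; rewrite // edK vt_phi.
    have w4 := walk_phi 4 (phi (ed d)).
    (* Here three edges of the 4-face lie on the 7-cycle; the remaining four edges of the cycle and
       the fourth edge of the face form a closed walk of length 5. *)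
    have i7 : iter 4 phi (phi (ed d)) = ed (phi (phi d)).
      by rewrite -[RHS](iter_order phi_inj) (O_order d2) -e1 -e2.
    have l4 : len d = 4 by apply/eqP; rewrite -[_ == _]negbK -bigE.
    have i4 : phi (phi (phi (phi d))) = d by have := iter_order phi_inj d; rewrite -/(len d) l4.
    rewrite i7 vt_phi edK in w4.
    apply: (@og 5 (vt d)) => //; apply: (walk_cat (m := 4)) w4 (walk1 _).
    by rewrite -[in X in e _ X]i4 !vt_phi -vt_phi; exact: dart_edge.
  apply: leq_trans (subset_leq_card sub) _.
  have [+ _] := leq_card_setU (phi @^-1: M4) ((phi \o phi) @^-1: M4).
  by rewrite !card_preimset //; [lia | exact: inj_comp].
have M1 : 0 < #|Mset|.
  by have [d [d1 d2 d3]] := O_exit O0; apply/card_gt0P; exists d; rewrite inE /inS d1 d2.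
rewrite outE; case: (posnP #|Mb|) => [Mb0|]; last lia.
case: (posnP #|Eb|) => [|Eb1]; first lia.
suff : #|Eb| = 7 by lia.
have /card_gt0P[d0] := Eb1; rewrite !inE => /andP[d0O d0b].
rewrite -cO -card_edO; apply: eq_card => d; rewrite !inE; case: (boolP (ed d \in O)) => //= dO.
(* As [Mb] is empty, a big face leaving one edge of the cycle has to continue along the neighbouring
   edge. *)
have back o : o \in O -> big (ed (phi o)) -> big (ed o).
  move=> oO bo; have pO : phi o \in O by rewrite O_closed.
  have S1 : inS (phi (ed (phi o))) by rewrite /inS vt_phi edK imset_f.
  have nO : phi (ed (phi o)) \notin O by rewrite O_closed O_ed.
  have eO : ed (phi (ed (phi o))) \in O.
    apply: contraT => nE; have : phi (ed (phi o)) \in Mb by rewrite !inE S1 nO nE big_phi bo.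
    by move/eqP: Mb0; rewrite cards_eq0 => /eqP->; rewrite inE.
  have e1 : phi (ed (phi (ed (phi o)))) = phi o.
    by apply: O_next; rewrite // edK vt_phi edK.
  by rewrite -(phi_inj e1) edK big_phi.
have /iter_findex := O_orbit dO d0O; move: (findex _ _ _) => k kE.
have : big (ed (iter k phi (ed d))) by rewrite kE edK.
elim: k {kE} => [|k IH]; first by rewrite /= edK.
rewrite iterS => /back bb; apply: IH; apply: bb.
by elim: (k) => [//|j IHj]; rewrite iterS O_closed.
Qed.

(** By Euler's inequality the charges sum to at most -24, a contradiction at once if [O] is empty.
    Otherwise [2 * #|Mset|] plus the number of [outer] corners is at most 42 - 11 - 24 = 7, against
    the 8 of [outer_bound]. *)
Lemma discharging : D -> False.
Proof.
move=> d0; have eul := euler_inequality d0 M ed_neq.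
have := vertex_total; have := face_total; have := outer_bound.
case: (boolP (O == set0)) => [/eqP O0 _|O0 /(_ isT)].
  have cO0 : #|O| = 0 by rewrite O0 cards0.
  rewrite cO0 !muln0; move: eul; move: (\sum_d corner d) (\sum_d outer d) => a b.
  by move: #|froots phi| #|D| #|vt @: D|; lia.
rewrite O_card //; move: eul; move: (\sum_d corner d) (\sum_d outer d) => a b.
by move: #|froots phi| #|D| #|vt @: D| #|Mset|; lia.
Qed.

End Discharging.

(** * Cutting along a 7-cycle *)

Section Primitive.
Variables (D : finType) (n : D -> D) (j : D -> bool).
Hypothesis n_inj : injective n.
Hypothesis even : forall x, \big[addb/false]_(y | fconnect n x y) j y = false.

Lemma orbit_primitive : exists p : D -> bool, forall x, p (n x) (+) p x = j x.
Proof.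
pose r x := froot n x; pose k x := findex n (r x) x.
pose p x := \big[addb/false]_(0 <= i < k x) j (iter i n (r x)).
exists p => x.
have sym := fconnect_sym n_inj.
have rx : fconnect n (r x) x by rewrite sym; exact: connect_root.
have rnx : r (n x) = r x by apply/esym/(rootP sym); exact: fconnect1.
have kx : iter (k x) n (r x) = x by exact: iter_findex.
have kmax : k x < order n (r x) by exact: findex_max.
rewrite /p rnx; case: (ltngtP (k x).+1 (order n (r x))) => kk; last 1 first.
- have nx : n x = r x by rewrite -[in LHS]kx -iterS kk iter_order.
  have -> : k (n x) = 0 by rewrite /k rnx nx findex0.
  rewrite big_geq // addFb.
  have := even (r x); have -> : \big[addb/false]_(y | fconnect n (r x) y) j y =
      \big[addb/false]_(0 <= i < order n (r x)) j (iter i n (r x)).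
    have -> : \big[addb/false]_(y | fconnect n (r x) y) j y =
        \big[addb/false]_(y <- orbit n (r x)) j y.
      rewrite big_uniq ?orbit_uniq //; apply: eq_bigl => y; by rewrite -fconnect_orbit.
    rewrite (big_nth (r x)) size_orbit !big_mkord; apply: eq_bigr => i _.
    by rewrite /orbit nth_traject.
  rewrite -kk big_nat_recr //= kx.
  by case: (\big[addb/false]_(_ <= _ < _) _) (j x) => [] [].
- have -> : k (n x) = (k x).+1 by rewrite /k rnx -{2}kx -iterS findex_iter.
  rewrite big_nat_recr //= kx.
  by case: (\big[addb/false]_(_ <= _ < _) _) (j x) => [] [].
by move: kk; rewrite ltnS leqNgt kmax.
Qed.

End Primitive.

(** * The two sides of a closed walk *)

Section Cobound.
Variables (T D : finType) (ed n : D -> D) (vt : D -> T).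
Hypothesis M : plane_map ed n vt.
Local Notation phi := (face ed n).

Definition consecutive : rel D := fun d d' => vt (ed d) == vt d'.

Lemma consecutive_targets s d d0 : path consecutive d (rcons s d0) ->
  map (vt \o ed) (d :: s) = rcons (map vt s) (vt d0).
Proof.
elim: s d => [|d' s IH] d /=; first by rewrite andbT => /eqP->.
by case/andP => /eqP-> /IH /= ->.
Qed.

(** Counts modulo 2 how often the walk uses the edge of [x], in either direction. *)
Definition trace (c : seq D) (x : D) := \big[addb/false]_(d <- c) ((x == d) (+) (ed x == d)).

(** A Jordan curve theorem modulo 2. A closed walk enters each vertex as often as it leaves it, so
    [trace c] sums to zero around every vertex and is the jump of some [p]. This [p] is closed, and
    the face function [q] in its decomposition changes exactly across the edges used an odd number
    of times. *)
Lemma closed_walk_cobound c : cycle consecutive c ->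
  exists q : D -> bool, (forall x, q (phi x) = q x) /\ (forall x, q (ed x) (+) q x = trace c x).
Proof.
have [edK n_inj vtE plan] := M.
move=> cyc.
have rotE : map (vt \o ed) c = rot 1 (map vt c).
  by case: c cyc => [//|d s] /consecutive_targets; rewrite [map vt _]/= rot1_cons.
have even x : \big[addb/false]_(y | fconnect n x y) trace c y = false.
  rewrite exchange_big /=.
  have -> : \big[addb/false]_(d <- c) \big[addb/false]_(y | fconnect n x y) ((y == d) (+) (ed y == d)) =
      \big[addb/false]_(d <- c) ((vt x == vt d) (+) (vt x == vt (ed d))).
    apply: eq_bigr => d _; rewrite big_split /=; congr addb.
      rewrite big_mkcond (bigD1 d) //= eqxx -vtE big1 ?addbF; first by case: ifP.
      by move=> y /negbTE->; case: ifP.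
    rewrite big_mkcond (bigD1 (ed d)) //= edK eqxx -vtE big1 ?addbF; first by case: ifP.
    move=> y yd; have -> : (ed y == d) = false by apply: contraNF yd => /eqP<-; rewrite edK.
    by case: ifP.
  rewrite big_split /=.
  have -> : \big[addb/false]_(d <- c) (vt x == vt (ed d)) = \big[addb/false]_(u <- map (vt \o ed) c) (vt x == u).
    by rewrite big_map.
  rewrite rotE; have -> : \big[addb/false]_(d <- c) (vt x == vt d) = \big[addb/false]_(u <- map vt c) (vt x == u).
    by rewrite big_map.
  rewrite [X in _ (+) X](perm_big (map vt c)) ?addbb //=.
  by apply/permPl; exact: perm_rot.
have [p pE] := orbit_primitive n_inj even.
have trace_ed x : trace c (ed x) = trace c x.
  by rewrite /trace; apply: eq_bigr => d _; rewrite edK addbC.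
have [|h [q [qf pq]]] := plan p; first by move=> d; rewrite !pE trace_ed.
exists q; split=> // x; rewrite -pE !pq.
have -> : vt (n x) = vt x by apply/eqP; rewrite vtE fconnect_sym // fconnect1.
have -> : q (n x) = q (ed x) by rewrite -(qf (ed x)) /face edK.
by move: (h _) (q _) (q _) => [] [] [].
Qed.

Lemma traceE c x : uniq c -> trace c x = (x \in c) (+) (ed x \in c).
Proof.
have [edK _ _ _] := M.
elim: c => [|d c IH] /=; first by rewrite /trace big_nil.
case/andP=> dc uc; rewrite /trace big_cons -/(trace c x) IH // !inE.
have [xd|xd] := eqVneq x d; have [ed_d|ed_d] := eqVneq (ed x) d.
- by rewrite xd in ed_d *; rewrite ed_d (negbTE dc).
- by rewrite xd (negbTE dc) /=; case: (ed d \in c).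
- by rewrite ed_d (negbTE dc) /=; case: (x \in c).
by [].
Qed.

Lemma trace_cat c1 c2 x : trace (c1 ++ c2) x = trace c1 x (+) trace c2 x.
Proof. by rewrite /trace big_cat. Qed.

Lemma trace_rev_ed c x : trace (rev (map ed c)) x = trace c x.
Proof.
have [edK _ _ _] := M.
rewrite /trace (perm_big (map ed c)) ?perm_rev // big_map; apply: eq_bigr => d _.
rewrite addbC; congr addb; first by rewrite (can_eq edK).
by rewrite -{1}(edK x) (can_eq edK).
Qed.

End Cobound.

Section SevenCycle.
Variables (T D : finType) (e : rel T) (ed : D -> D) (vt : D -> T).
Hypotheses (C : carries ed vt e) (og : odd_girth7 e).

(** A repeated vertex would split the walk into two closed walks with lengths adding up to 7, and
    the odd one has length at most 5. *)
Lemma closed7_uniq (c : seq D) : size c = 7 -> cycle (consecutive ed vt) c -> uniq (map vt c).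
Proof.
move=> sc; case: c sc => [//|x0 c'] sc cyc; set c := x0 :: c' in sc cyc *.
pose f i := vt (nth x0 c (i %% 7)).
have step i : e (f i) (f i.+1).
  have il : i %% 7 < 7 by rewrite ltn_mod.
  rewrite C; apply/existsP; exists (nth x0 c (i %% 7)); rewrite eqxx /=.
  rewrite /f -[i.+1]addn1 -modnDml addn1; move: (i %% 7) il => k k7.
  have /pathP pth : path (consecutive ed vt) x0 (rcons c' x0) by exact: cyc.
  have := pth x0 k; rewrite size_rcons; have -> : size c' = 6 by case: sc.
  move=> /(_ k7); rewrite /consecutive nth_rcons.
  have -> : size c' = 6 by case: sc.
  have -> : nth x0 (x0 :: rcons c' x0) k = nth x0 c k.
    rewrite /c -rcons_cons nth_rcons; rewrite [size _]sc k7; by [].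
  case: ltnP => k6; first by rewrite modn_small //; lia.
  have -> : k = 6 by lia.
  by rewrite eqxx.
have wk m i : walk e m (f i) (f (i + m)).
  elim: m i => [|m IH] i; first by rewrite addn0; exact: walk0.
  by apply: walkS (step i) _; rewrite addnS -addSn.
have per i : f (i + 7) = f i by rewrite /f modnDr.
apply/(uniqP (vt x0)) => i i'; rewrite !inE size_map sc => i7 i'7.
have nE k : k < 7 -> nth (vt x0) (map vt c) k = f k.
  by move=> k7; rewrite (nth_map x0) ?sc // /f modn_small.
rewrite !nE //.
wlog ii : i i' i7 i'7 / i <= i'.
  by move=> H fe; case: (leqP i i') => [/H->//|/ltnW/H->].
move=> fe; apply/eqP; rewrite eqn_leq ii /= leqNgt; apply/negP => lt.
have w1 := wk (i' - i) i; have w2 := wk (7 - (i' - i)) i'.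
have e1 : i + (i' - i) = i' by lia.
have e2 : i' + (7 - (i' - i)) = i + 7 by lia.
rewrite e1 -fe in w1; rewrite e2 per -fe in w2.
by case: (boolP (odd (i' - i))) => o; [apply: og w1; lia | apply: og w2; lia].
Qed.


Variable c : seq D.
Hypotheses (c_size : size c = 7) (c_cyc : cycle (consecutive ed vt) c).

Lemma closed7_inj : {in c &, injective vt}.
Proof.
have uc := closed7_uniq c_size c_cyc.
move=> x y xc yc xy; have xi := xc; have yi := yc; rewrite -index_mem in xi; rewrite -index_mem in yi.
rewrite -(nth_index x xc) -(nth_index x yc); congr nth.
apply: (uniqP (vt x) uc); rewrite ?inE ?size_map //.
by rewrite !(nth_map x) // !nth_index.
Qed.

Lemma closed7_next a d : a \in c -> d \in c -> vt (ed a) = vt d -> next c a = d.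
Proof.
move=> ac dc ad; apply: closed7_inj; rewrite ?mem_next // -ad.
by have /eqP -> := next_cycle c_cyc ac.
Qed.

Lemma closed7_reverse d : involutive ed -> d \in c -> ed d \notin c.
Proof.
move=> edK dc; apply/negP => ec.
have uc := map_uniq (closed7_uniq c_size c_cyc).
have cyc2 : fcycle (next c) [:: d; ed d].
  by rewrite /= (closed7_next dc ec) // (closed7_next ec dc) ?edK // !eqxx.
have := order_le_cycle cyc2 (mem_head _ _).
by rewrite (order_cycle (cycle_next uc) uc dc) c_size.
Qed.

End SevenCycle.

(* O is empty, or the set of darts of a face bounded by a 7-cycle some vertex of
   which has a neighbour off the cycle *)
Definition facial_cycle (T D : finType) (ed n : D -> D) (vt : D -> T) (O : {set D}) : Prop :=
  [/\ forall d, (face ed n d \in O) = (d \in O),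
      {in O &, forall d d', fconnect (face ed n) d d'},
      O != set0 -> #|O| = 7, {in O &, injective vt} &
      O != set0 -> exists d, [/\ vt d \in vt @: O, d \notin O & ed d \notin O]].

(** The two arcs have lengths [l] and [l'], the excursion [i.+1]. Since [l' + i.+1] is odd and
    exceeds 5, it is at least 7 = [l + l'], so [l] is at most the length of the excursion. *)
Lemma reroute_length l l' i k k2 : l + l' = 7 -> 5 < l' + i.+1 -> odd (l' + i.+1) ->
  i <= k -> k2 <= k - i -> odd k2 = odd (k - i) ->
  l + k2 <= k.+1 /\ odd (l + k2) = odd k.+1.
Proof.
move=> l7 l5 lo ik k2k ko; split.
  have l6 : l' + i.+1 <> 6 by move=> h; rewrite h in lo.
  lia.
have -> : l = 7 - l' by lia.
have l'7 : l' <= 7 by lia.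
rewrite oddD ko oddB // oddB //= addbC; move: lo; rewrite oddD /=.
by case: (odd k); case: (odd i); case: (odd l').
Qed.

(** * One side of a 7-cycle as a smaller plane map *)

Section Cut.
Variables (T D : finType) (e : rel T) (ed n : D -> D) (vt : D -> T) (O : {set D}).
Hypotheses (M : plane_map ed n vt) (C : carries ed vt e) (e_sym : symmetric e).
Hypothesis simple : forall d d', vt d = vt d' -> vt (ed d) = vt (ed d') -> d = d'.
Hypothesis og : odd_girth7 e.
Local Notation phi := (face ed n).
Hypothesis deg3 : forall d, vt d \notin vt @: O -> 3 <= order n d.
Variables (c : seq D) (q : D -> bool) (d1 z : D).
Hypotheses (c_size : size c = 7) (c_cyc : cycle (consecutive ed vt) c).
Hypothesis q_face : forall x, q (phi x) = q x.
Hypothesis q_trace : forall x, q (ed x) (+) q x = trace ed c x.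
Hypotheses (d1c : d1 \in c) (qd1 : q d1 = false).
Hypothesis qO : forall o, o \in O -> q o = false.
Hypotheses (z_vt : vt z \in map vt c) (qz : q z) (qez : q (ed z)).

Let edK : involutive ed. Proof. by case: M. Qed.
Let n_inj : injective n. Proof. by case: M. Qed.
Let vtE d d' : (vt d == vt d') = fconnect n d d'. Proof. by case: M. Qed.
Let phi_inj := face_inj M.

Let uc : uniq (map vt c).
Proof. exact: (closed7_uniq C og c_size c_cyc). Qed.
Let uc' : uniq c. Proof. exact: (map_uniq uc). Qed.
Let c_inj : {in c &, injective vt}.
Proof. exact: (closed7_inj C og c_size c_cyc). Qed.

(** [q] marks the faces of the kept side. An edge stays if it has such a face on at least one side;
    the darts of [c], whose own side is discarded, become the new exceptional face. *)
Let B d := q d || q (ed d).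
Let B_ed d : B (ed d) = B d. Proof. by rewrite /B edK orbC. Qed.
Let D1 : finType := {d : D | B d}.
Let ed1 : D1 -> D1 := restrict_ed B_ed.
Let n1 : D1 -> D1 := return_map (B := B) n.
Let vt1 (x : D1) := vt (val x).
Let phi1 := face ed1 n1.
Let M1 : plane_map ed1 n1 vt1. Proof. exact: delete_plane_map. Qed.
Let phi1_inj := face_inj M1.
Let e1 : rel T := fun u w => [exists x : D1, (vt1 x == u) && (vt1 (ed1 x) == w)].
Let C1 : carries ed1 vt1 e1. Proof. by []. Qed.
Let sub1 : subrel e1 e.
Proof. by move=> u w /existsP[x /andP[/eqP<- /eqP<-]]; exact: (dart_adj C _). Qed.

Let traceE' x : trace ed c x = (x \in c) (+) (ed x \in c).
Proof. exact: (traceE M x uc'). Qed.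

Let q_n x : q (n x) = q (ed x).
Proof. by rewrite -(q_face (ed x)) /face edK. Qed.

Let phi1_inside (x : D1) : q (val x) -> val (phi1 x) = phi (val x).
Proof.
move=> qx; rewrite /phi1 /face return_map_live //=.
by rewrite /B -/(face ed n (val x)) q_face qx.
Qed.

Let q_phi1 (x : D1) : q (val (phi1 x)) = q (val x).
Proof.
have fwd (y : D1) : q (val y) -> q (val (phi1 y)).
  by move=> qy; rewrite phi1_inside // q_face.
apply/idP/idP => [qx|]; last exact: fwd.
have : fconnect phi1 (phi1 x) x by rewrite fconnect_sym // fconnect1.
by move/iter_findex <-; elim: (findex _ _ _) => [//|k IH]; rewrite iterS fwd.
Qed.

(** The side is carried along the cycle from [d1]. The successor of [d0] on its face in the kept map
    has the discarded side on its own side and the kept one across, so its edge lies on the cycle.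
    It is the next dart of [c], since the only alternative, the reverse of [d0], faces the kept
    side. *)
Let c_q d : d \in c -> q d = false /\ q (ed d).
Proof.
have base d' : d' \in c -> q d' = false -> q (ed d').
  move=> dc qd; have := q_trace d'; rewrite qd addbF traceE' dc => ->.
  exact: (closed7_reverse C og c_size c_cyc edK dc).
suff key d' : d' \in c -> q d' = false by move=> dc; split; [exact: key | apply: base => //; exact: key].
have step d0 : d0 \in c -> q d0 = false -> q (next c d0) = false.
  move=> dc qd; have Bd : B d0 by rewrite /B base // orbT.
  pose x : D1 := Sub d0 Bd.
  have qx : q (val (phi1 x)) = false by rewrite q_phi1.
  have vx : vt (val (phi1 x)) = vt (ed d0) by rewrite -[LHS]/(vt1 (phi1 x)) (vt_face M1).
  have vn : vt (next c d0) = vt (ed d0).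
    by have := next_cycle c_cyc dc; rewrite /consecutive => /eqP->.
  have qe : q (ed (val (phi1 x))) by have := valP (phi1 x); rewrite /= /B qx.
  have := q_trace (val (phi1 x)); rewrite qe qx traceE'.
  case: (boolP (val (phi1 x) \in c)) => [xc _|xc /=].
    by rewrite -qx; congr q; apply: c_inj; rewrite ?mem_next // vn vx.
  move=> /esym ec; exfalso.
  have /eqP := next_cycle c_cyc ec; rewrite edK vx => v2.
  have n2 : next c (ed (val (phi1 x))) = next c d0 by apply: c_inj; rewrite ?mem_next // vn v2.
  have e2 : ed (val (phi1 x)) = d0 by apply: (can_inj (prev_next uc')).
  by rewrite e2 qd in qe.
move=> d'c; have : fconnect (next c) d1 d' by rewrite (fconnect_cycle (cycle_next uc') d1c).
move/iter_findex <-; elim: (findex _ _ _) => [//|k IH].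
rewrite iterS; apply: step IH; elim: (k) => [//|j IHj]; by rewrite iterS mem_next.
Qed.

Let c_B d : d \in c -> B d. Proof. by case/c_q => _; rewrite /B => ->; rewrite orbT. Qed.

Let outside x : B x -> q x = false -> x \in c.
Proof.
rewrite /B => /[swap] qx; rewrite qx /= => qe.
have := q_trace x; rewrite qe qx traceE'; case: (boolP (x \in c)) => // xc /esym ec.
by have [] := c_q ec; rewrite qe.
Qed.

Let O1 : {set D1} := [set x | val x \in c].

Let O1E x : (x \in O1) = ~~ q (val x).
Proof.
rewrite inE; apply/idP/idP => [/c_q[->]//|/negbTE]; exact: (outside (valP x)).
Qed.

Let S1E u : (u \in vt1 @: O1) = (u \in map vt c).
Proof.
apply/imsetP/mapP => [[x]|[d dc ->]]; first by rewrite inE => xc ->; exists (val x).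
by exists (Sub d (c_B dc)); rewrite ?inE.
Qed.

Let O1_next x : x \in O1 -> val (phi1 x) = next c (val x).
Proof.
move=> xO; have pO : phi1 x \in O1 by rewrite O1E q_phi1 -O1E.
rewrite !inE in xO pO; apply: c_inj; rewrite ?mem_next //.
have /eqP <- := next_cycle c_cyc xO.
by rewrite -[LHS]/(vt1 (phi1 x)) (vt_face M1).
Qed.

Let O1_connect : {in O1 &, forall x y, fconnect phi1 x y}.
Proof.
move=> x y xO yO; have xc := xO; have yc := yO; rewrite !inE in xc yc.
have := fconnect_cycle (cycle_next uc') xc (val y); rewrite yc => /iter_findex.
move: (findex _ _ _) => k kE.
suff -> : y = iter k phi1 x by exact: fconnect_iter.
apply: val_inj; rewrite -kE; elim: {kE}k => [//|k IH]; rewrite !iterS IH O1_next //.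
by elim: (k) => [//|j IHj]; rewrite iterS O1E q_phi1 -O1E.
Qed.

Let O1_card : #|O1| = 7.
Proof.
rewrite -c_size -(card_uniqP uc') -(card_imset O1 val_inj); apply: eq_card => d.
apply/imsetP/idP => [[x]|dc]; first by rewrite inE => xc ->.
by exists (Sub d (c_B dc)); rewrite ?inE.
Qed.

Lemma cut_facial : facial_cycle ed1 n1 vt1 O1.
Proof.
split.
- by move=> x; rewrite !O1E q_phi1.
- exact: O1_connect.
- by rewrite O1_card.
- by move=> x y; rewrite !inE => xc yc /(c_inj xc yc) /val_inj.
move=> _; have Bz : B z by rewrite /B qz.
by exists (Sub z Bz); rewrite S1E !O1E /= qz qez.
Qed.

Let interior_q d : vt d \notin map vt c -> B d -> q d.
Proof.
move=> dS; apply: contraLR => /negbTE qd; apply/negP => Bd.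
by rewrite (map_f vt (outside Bd qd)) in dS.
Qed.

Let interior_all d d' : vt d \notin map vt c -> B d -> vt d' = vt d -> q d'.
Proof.
move=> dS Bd /eqP; rewrite eq_sym vtE => /iter_findex <-.
elim: (findex _ _ _) => [|k IH]; first exact: interior_q.
rewrite iterS q_n; set y := iter k n d in IH *.
have vy : vt y = vt d by rewrite /y; elim: (k) => [//|i IHi]; rewrite iterS (vt_rot M).
have := q_trace y; rewrite traceE' IH.
have -> : y \in c = false by apply: contraNF dS => yc; rewrite -vy map_f.
have -> : ed y \in c = false.
  apply: contraNF dS => yc; rewrite -vy -{1}(edK y).
  by have /eqP -> := next_cycle c_cyc yc; rewrite map_f // mem_next.
by case: (q (ed y)).
Qed.

Let interior_at (x : D1) u d : vt1 x = u -> u \notin map vt c -> vt d = u -> q d.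
Proof. by move=> xu uS du; apply: (@interior_all (val x) d); rewrite -?[vt (val x)]/(vt1 x) ?xu ?(valP x). Qed.

Let interior (x : D1) : vt1 x \notin vt1 @: O1 ->
  [/\ vt (val x) \notin vt @: O, order n (val x) = order n1 x & val (n1 x) = n (val x)].
Proof.
rewrite S1E => xS; have all d := @interior_all _ d xS (valP x).
split.
- apply/imsetP => -[o oO vo]; have := qO oO.
  by rewrite (all o) // vo.
- rewrite (degree_card M) (degree_card M1) -(card_imset _ val_inj); apply: eq_card => d.
  rewrite inE; apply/eqP/imsetP => [vd|[y]]; last by rewrite inE => /eqP yx ->.
  have Bd : B d by rewrite /B (all d vd).
  by exists (Sub d Bd); rewrite ?inE //; apply/eqP.
by rewrite return_map_live // /B all // (vt_rot M).
Qed.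

Lemma cut_deg3 (x : D1) : vt1 x \notin vt1 @: O1 -> 3 <= order n1 x.
Proof. by case/interior=> xS <- _; exact: deg3. Qed.

Let arcs a s : a \in map vt c -> s \in map vt c ->
  exists2 m, m <= 7 & walk e1 m a s /\ walk e1 (7 - m) a s.
Proof.
have e1_sym : symmetric e1.
  by move=> u w; apply/existsP/existsP => -[x /andP[xu xw]]; exists (ed1 x);
    rewrite (_ : ed1 (ed1 x) = x) ?xw //; case: M1.
rewrite -!S1E => /imsetP[x xO ->] /imsetP[y yO ->].
have xy := O1_connect xO yO; have := findex_max xy; have := iter_findex xy.
have o7 : order phi1 x = 7.
  rewrite -O1_card; apply: eq_card => w; apply/idP/idP => [/iter_findex <-|wO]; last exact: O1_connect.
  by elim: (findex _ _ _) => [//|k IH]; rewrite iterS O1E q_phi1 -O1E.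
rewrite o7; move: (findex _ _ _) => m mE m7; exists m; first exact: ltnW.
have := walk_face M1 C1 m x; rewrite mE; split=> //.
apply: walk_rev => //; have := walk_face M1 C1 (7 - m) y.
rewrite -{2}mE -iterD subnK ?(ltnW m7) //.
by rewrite -o7 iter_order.
Qed.

Let K u := exists x : D1, vt1 x = u.

(** A vertex of the kept map off the cycle keeps all its darts, so a walk from outside can enter the
    kept map only at the cycle. *)
Let first_hit k u b : (u \in map vt c) \/ ~ K u -> K b -> walk e k u b ->
  exists i s, [/\ i <= k, s \in map vt c, walk e i u s & walk e (k - i) s b].
Proof.
elim: k u => [|k IH] u hu Kb.
  move=> w; case: hu => [uc0|nK]; last by case: nK; rewrite (walk0P w).
  by exists 0, u; split=> //; exact: walk0.
move=> w; case: hu => [uc0|nK]; first by exists 0, u; split=> //; rewrite ?subn0 //; exact: walk0.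
have [u' uu' w'] := walkSP w.
have hu' : (u' \in map vt c) \/ ~ K u'.
  have [|nc] := boolP (u' \in map vt c); [by left|right=> -[x xu]].
  move: (uu'); rewrite e_sym C => /existsP[d /andP[/eqP du /eqP du']].
  have qd : q d := interior_at xu nc du.
  have Bd : B d by rewrite /B qd.
  by apply: nK; exists (ed1 (Sub d Bd)).
have [i [s [ik sc w1 w2]]] := IH u' hu' Kb w'.
by exists i.+1, s; split=> //; apply: walkS uu' w1.
Qed.

(* An excursion from the 7-cycle back to it is replaced by the arc of the same
   parity; the other arc closes it up to an odd walk, which has length at least 7,
   so the arc is not longer than the excursion. *)
Let reroute k a b : K a -> K b -> walk e k a b ->
  exists k', [/\ k' <= k, odd k' = odd k & walk e1 k' a b].
Proof.
elim/ltn_ind: k a => -[|k] IH a Ka Kb w.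
  by exists 0; split=> //; rewrite (walk0P w); exact: walk0.
have [u au w'] := walkSP w.
move: (au); rewrite C => /existsP[d /andP[/eqP da /eqP du]].
have [Bd|nBd] := boolP (B d).
  have Ku : K u by exists (ed1 (Sub d Bd)).
  have [k' [k'k ok w1]] := IH k (ltnSn k) u Ku Kb w'.
  exists k'.+1; split=> //=; first by rewrite ok.
  by apply: walkS w1; apply/existsP; exists (Sub d Bd); rewrite /vt1 /= da du !eqxx.
have ac : a \in map vt c.
  apply: contraT => nc; case: Ka => x xa; have qd : q d := interior_at xa nc da.
  by rewrite /B qd in nBd.
have hu : (u \in map vt c) \/ ~ K u.
  have [|nc] := boolP (u \in map vt c); [by left|right=> -[x xu]].
  have qd : q (ed d) := interior_at xu nc du.
  by rewrite /B qd orbT in nBd.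
have [i [s [ik sc w1 w2]]] := first_hit hu Kb w'.
have Ks : K s by move: sc; rewrite -S1E => /imsetP[y _ ->]; exists y.
have [k2 [k2k ok2 v2]] := IH (k - i) (leq_ltn_trans (leq_subr i k) (ltnSn k)) s Ks Kb w2.
have [m m7 [a1 a2]] := arcs ac sc.
have bad l : walk e1 l a s -> odd (l + i.+1) -> l + i.+1 <= 5 -> False.
  move=> wl o5 l5; apply: (og o5 l5); apply: walk_cat (walk_sub sub1 wl) _.
  by apply: walk_rev; first exact: e_sym; apply: walkS au w1.
have [mi|mi] := boolP (odd (m + i.+1)).
  have m5 : 5 < m + i.+1 by rewrite ltnNge; apply/negP; exact: (bad _ a1 mi).
  have [l1 l2] := reroute_length (subnK m7) m5 mi ik k2k ok2.
  by exists (7 - m + k2); split=> //; exact: (walk_cat a2 v2).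
have mi' : odd (7 - m + i.+1).
  by move: mi; rewrite !oddD oddB //; case: (odd m); case: (odd i.+1).
have m5 : 5 < 7 - m + i.+1 by rewrite ltnNge; apply/negP; exact: (bad _ a2 mi').
have [l1 l2] := reroute_length (subnKC m7) m5 mi' ik k2k ok2.
by exists (m + k2); split=> //; exact: (walk_cat a1 v2).
Qed.

(** Vertices off the cycle keep their degree and the 4-face is kept whole. A walk of length 5 from v
    to x reroutes to one of length 1, 3 or 5 on the kept side; lengths 1 and 3 would close up with
    two sides of the 4-face to a short odd closed walk, and length 5 is excluded there by
    assumption. *)
Lemma cut_reducible (x : D1) : reducible_at e1 ed1 n1 vt1 (vt1 @: O1) x ->
  reducible_at e ed n vt (vt @: O) (val x).
Proof.
move=> [xS d3 f4 nw alt]; have [xO dE nE] := interior xS.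
have xS' := xS; rewrite S1E in xS'.
have qx : q (val x) by apply: interior_q xS' (valP x).
have qit k : q (val (iter k phi1 x)) by elim: k => [//|k IH]; rewrite iterS q_phi1.
have itE k : val (iter k phi1 x) = iter k phi (val x).
  by elim: k => [//|k IH]; rewrite !iterS phi1_inside // IH.
have f4' : order phi (val x) = 4.
  rewrite -f4 /order -(card_imset (fconnect phi1 x) val_inj); apply: eq_card => d.
  apply/idP/imsetP => [/iter_findex|[y /iter_findex <- ->]].
    by move=> <-; exists (iter (findex phi (val x) d) phi1 x); rewrite ?itE //; exact: fconnect_iter.
  by rewrite itE; exact: fconnect_iter.
split=> //; first by rewrite dE.
  move=> w5; apply: nw.
  have [|||k [k5 ok w]] := reroute (k := 5) (a := vt (val x)) (b := vt1 (phi1 (phi1 x))).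
  - by exists x.
  - by exists (phi1 (phi1 x)).
  - by rewrite /vt1 (itE 2).
  have w2 := walk_face M C 2 (val x); rewrite -itE in w2.
  have bad : odd (k + 2) -> k + 2 <= 5 -> False.
    move=> o5 l5; apply: (og o5 l5); apply: walk_cat (walk_sub sub1 w) _.
    exact: (walk_rev e_sym w2).
  by case: k k5 ok w bad => [|[|[|[|[|[|//]]]]]] //= _ _ w bad; case: bad.
case: alt => -[aS ad].
  have i2 : phi (phi (val x)) = val (phi1 (phi1 x)) := esym (itE 2).
  by left; have [yO yd _] := interior aS; rewrite i2 yd.
by right; have [yO yd _] := interior aS; rewrite -nE -[ed _]/(val (ed1 (n1 x))) yd.
Qed.

Lemma cut_simple x y : vt1 x = vt1 y -> vt1 (ed1 x) = vt1 (ed1 y) -> x = y.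
Proof. by move=> a b; apply: val_inj; apply: simple. Qed.

Lemma cut_girth : odd_girth7 e1.
Proof. by move=> k a o5 k5 /(walk_sub sub1); exact: og. Qed.

Lemma cut_sym : symmetric e1.
Proof.
by move=> u w; apply/existsP/existsP => -[x /andP[xu xw]]; exists (ed1 x);
  rewrite (_ : ed1 (ed1 x) = x) ?xw //; case: M1.
Qed.

Lemma cut_conclusion : (exists y, q y = false /\ q (ed y) = false) ->
  exists (D' : finType) (ed' n' : D' -> D') (vt' : D' -> T) (O' : {set D'}) (e' : rel T),
    [/\ #|D'| < #|D|, 0 < #|D'|, plane_map ed' n' vt' & carries ed' vt' e'] /\
    [/\ symmetric e', forall d d', vt' d = vt' d' -> vt' (ed' d) = vt' (ed' d') -> d = d',
      odd_girth7 e', facial_cycle ed' n' vt' O' &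
      forall d, vt' d \notin vt' @: O' -> 3 <= order n' d] /\
    ((exists d, reducible_at e' ed' n' vt' (vt' @: O') d) ->
       exists d, reducible_at e ed n vt (vt @: O) d).
Proof.
move=> [y [qy qey]]; exists D1, ed1, n1, vt1, O1, e1; split; [|split].
- have Bz : B z by rewrite /B qz.
  split=> //; last by apply/card_gt0P; exists (Sub z Bz).
  rewrite card_sig; apply: proper_card; rewrite properE subset_predT /=.
  by apply/subsetPn; exists y => //; rewrite inE /B qy qey.
- split; [exact: cut_sym|exact: cut_simple|exact: cut_girth|exact: cut_facial|exact: cut_deg3].
by move=> [x /cut_reducible]; exists (val x).
Qed.

End Cut.

Section WalkDarts.
Variables (T D : finType) (e : rel T) (ed : D -> D) (vt : D -> T).
Hypothesis C : carries ed vt e.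

Lemma walk_darts k a b : walk e k.+1 a b -> exists d s,
  [/\ path (consecutive ed vt) d s, size s = k, vt d = a & vt (ed (last d s)) = b].
Proof.
elim: k a => [|k IH] a /walkSP[u au w].
  move: au; rewrite (walk0P w) C => /existsP[d /andP[/eqP da /eqP db]].
  by exists d, [::].
move: au; rewrite C => /existsP[d /andP[/eqP da /eqP du]].
have [d' [s [ps ss d'u lb]]] := IH u w.
by exists d, (d' :: s); rewrite /= ss /consecutive du d'u eqxx.
Qed.

Lemma reverse_darts d s : involutive ed -> path (consecutive ed vt) d s ->
  path (consecutive ed vt) (ed (last d s)) (rev (map ed (belast d s))).
Proof.
move=> edK ps; rewrite -last_map.
have -> : map ed (belast d s) = belast (ed d) (map ed s).
  by elim: s d {ps} => [//|x s IH] d /=; rewrite IH.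
rewrite rev_path path_map; apply: sub_path ps => a b.
by rewrite /consecutive /= edK eq_sym.
Qed.

End WalkDarts.

Section Facial.
Variables (T D : finType) (ed n : D -> D) (vt : D -> T) (O : {set D}).
Hypotheses (M : plane_map ed n vt) (F : facial_cycle ed n vt O).
Local Notation phi := (face ed n).

Lemma facial_order o : o \in O -> order phi o = 7.
Proof.
have [cl cn card _ _] := F; move=> oO.
have O0 : O != set0 by apply/set0Pn; exists o.
rewrite -(card O0); apply: eq_card => d; apply/idP/idP => [/iter_findex <-|dO]; last exact: cn.
by elim: (findex _ _ _) => [//|k IH]; rewrite iterS cl.
Qed.

(** A vertex of the exceptional cycle has two darts on it, and [t], leading off the cycle, is a
    third. *)
Lemma degree_beside_facial t : (forall d, vt d \notin vt @: O -> 3 <= order n d) ->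
  vt (ed t) \notin vt @: O -> 3 <= order n t.
Proof.
have [edK n_inj vtE _] := M; have [cl cn card inj _] := F; move=> deg3 etS.
have [/imsetP[o oO to]|] := boolP (vt t \in vt @: O); last exact: deg3.
pose o' := finv phi o.
have o'o : phi o' = o by rewrite f_finv //; exact: face_inj M.
have o'O : o' \in O by rewrite -cl o'o.
have e_o' : ed o' != o.
  apply/eqP => eo; have vo : vt (phi o) = vt o' by rewrite (vt_face M) -eo edK.
  have po : phi o = o' by apply: inj; rewrite ?cl.
  have cyc : fcycle phi [:: o'; o] by rewrite /= o'o po !eqxx.
  by have := order_le_cycle cyc (mem_head _ _); rewrite facial_order.
have SO d : d \in O -> vt d \in vt @: O by move=> dO; exact: imset_f.
have ot : o != t by apply: contraNneq etS => <-; rewrite -(vt_face M) SO // cl.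
have e_o't : ed o' != t by apply: contraNneq etS => <-; rewrite edK SO.
rewrite (degree_card M).
have -> : 3 = #|[set o; ed o'; t]|.
  rewrite -setUA cardsU1 !inE eq_sym (negbTE e_o') (negbTE ot) /=.
  by rewrite cards2 e_o't.
apply/subset_leq_card/subsetP => d; rewrite !inE => /orP[/orP[]|]/eqP-> //.
  by rewrite to.
by rewrite -(vt_face M) o'o to.
Qed.

End Facial.

Section Unsafe.
Variables (T D : finType) (e : rel T) (ed n : D -> D) (vt : D -> T) (O : {set D}).
Hypotheses (M : plane_map ed n vt) (C : carries ed vt e) (e_sym : symmetric e).
Hypothesis simple : forall d d', vt d = vt d' -> vt (ed d) = vt (ed d') -> d = d'.
Hypothesis og : odd_girth7 e.
Local Notation phi := (face ed n).
Hypothesis F : facial_cycle ed n vt O.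
Hypothesis deg3 : forall d, vt d \notin vt @: O -> 3 <= order n d.
Variable d0 : D.
Hypotheses (d0S : vt d0 \notin vt @: O) (d0_deg : order n d0 = 3) (d0_face : order phi d0 = 4).
Hypothesis unsafe : walk e 5 (vt d0) (vt (phi (phi d0))).

Let edK : involutive ed. Proof. by case: M. Qed.
Let n_inj : injective n. Proof. by case: M. Qed.

(** The cycle uses only [b] and [ed a] at the vertex of [b]. In degree at least 3, [n b] is neither
    of these; its edge is therefore off the cycle, and it starts on the kept side. *)
Lemma inward_dart c q a : size c = 7 -> cycle (consecutive ed vt) c ->
    (forall x, q (phi x) = q x) -> (forall x, q (ed x) (+) q x = trace ed c x) ->
    a \in c -> phi a \in c -> q (phi a) = false -> 3 <= order n (phi a) ->
  exists z, [/\ vt z \in map vt c, q z & q (ed z)].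
Proof.
move=> sc cyc qf qt ac bc qb b3; set b := phi a in bc qb b3 *.
have uc := map_uniq (closed7_uniq C og sc cyc).
have q_n x : q (n x) = q (ed x) by rewrite -(qf (ed x)) /face edK.
exists (n b); have qz : q (n b).
  rewrite q_n; have := qt b; rewrite qb (traceE M) // bc (negbTE (closed7_reverse C og sc cyc edK bc)) addbF.
  by move=> ->.
have vz : vt (n b) = vt b := vt_rot M b.
have nz : n b \notin c.
  apply/negP => zc; have zb := closed7_inj C og sc cyc zc bc vz.
  have cy : fcycle n [:: b] by rewrite /= zb eqxx.
  by have := leq_trans b3 (order_le_cycle cy (mem_head _ _)).
have nez : ed (n b) \notin c.
  apply/negP => ec; have nb1 : next c (ed (n b)) = b.
    by apply: (closed7_next C og sc cyc ec bc); rewrite edK.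
  have nb2 : next c a = b by apply: (closed7_next C og sc cyc ac bc); rewrite /b (vt_face M).
  have ea : ed (n b) = a by apply: (can_inj (prev_next uc)); rewrite nb1 nb2.
  have cy : fcycle n [:: b; n b] by rewrite /= eqxx -{1}[n b]edK ea -/(face ed n a) eqxx.
  by have := leq_trans b3 (order_le_cycle cy (mem_head _ _)).
split=> //; first by rewrite vz map_f.
by have := qt (n b); rewrite qz (traceE M) // (negbTE nz) (negbTE nez); case: (q _).
Qed.

(** The 4-face and the walk of length 5 give two 7-cycles: [c1] through w1 and [c2] through w2,
    differing by the boundary of the 4-face. So the faces fall into a far side of [c1], a far side
    of [c2] and the 4-face itself. The exceptional face misses one of the far sides, which is kept.
    The map shrinks because w2 is off [c1] and w1 is off [c2]. *)
Lemma unsafe_cut :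
  exists (D' : finType) (ed' n' : D' -> D') (vt' : D' -> T) (O' : {set D'}) (e' : rel T),
    [/\ #|D'| < #|D|, 0 < #|D'|, plane_map ed' n' vt' & carries ed' vt' e'] /\
    [/\ symmetric e', forall d d', vt' d = vt' d' -> vt' (ed' d) = vt' (ed' d') -> d = d',
      odd_girth7 e', facial_cycle ed' n' vt' O' &
      forall d, vt' d \notin vt' @: O' -> 3 <= order n' d] /\
    ((exists d, reducible_at e' ed' n' vt' (vt' @: O') d) ->
       exists d, reducible_at e ed n vt (vt @: O) d).
Proof.
have phi_inj := face_inj M.
pose b0 := phi d0; pose b1 := phi b0; pose b2 := phi b1.
have b3 : phi b2 = d0 by have := iter_order phi_inj d0; rewrite d0_face.
have vphi := vt_face M.
have [d [s [ps ss dx lv]]] := walk_darts C (walk_rev e_sym unsafe).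
rewrite -/b0 -/b1 in dx.
pose fs := [:: d0; b0; b1; b2].
have fsE : orbit phi d0 = fs by rewrite /orbit d0_face.
have ufs : uniq fs by rewrite -fsE orbit_uniq.
pose c1 := [:: d0; b0] ++ d :: s.
pose c2 := [:: b1; b2] ++ rev (map ed (d :: s)).
have cyc1 : cycle (consecutive ed vt) c1.
  by rewrite /c1 /= rcons_path ps /= /consecutive lv dx -(vphi d0) -(vphi b0) !eqxx.
have revE : rev (map ed (d :: s)) = ed (last d s) :: rev (map ed (belast d s)).
  by rewrite lastI map_rcons rev_rcons.
have cyc2 : cycle (consecutive ed vt) c2.
  rewrite /c2 revE /= rcons_path reverse_darts //= /consecutive -(vphi b1) -(vphi b2) b3.
  have -> : last (ed (last d s)) (rev (map ed (belast d s))) = ed d.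
    by rewrite -[LHS]/(last d0 (_ :: _)) -revE [map _ _]/= rev_cons last_rcons.
  by rewrite lv edK dx !eqxx.
have s1 : size c1 = 7 by rewrite /c1 /= ss.
have s2 : size c2 = 7 by rewrite /c2 /= size_rev /= size_map ss.
have u1 := closed7_uniq C og s1 cyc1; have u2 := closed7_uniq C og s2 cyc2.
have targets : map (vt \o ed) (d :: s) = rcons (map vt s) (vt d0).
  by apply: consecutive_targets; rewrite rcons_path ps /consecutive lv eqxx.
have vts1 : map vt c1 = [:: vt d0, vt b0, vt b1 & map vt s] by rewrite /c1 /= dx.
have vts2 : map vt c2 = [:: vt b1, vt b2 & rev (rcons (map vt s) (vt d0))].
  by rewrite -targets /c2 map_cat map_rev -map_comp.
have b02 : vt b0 != vt b2.
  apply/eqP => e02; have vb2 : vt (ed b2) = vt d0 by rewrite -vphi b3.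
  have db : d0 = ed b2 by apply: simple; rewrite ?vb2 // edK -e02 -vphi.
  have nd : n d0 = d0 by rewrite [X in n X]db -[RHS]b3.
  have cy : fcycle n [:: d0] by rewrite /= nd eqxx.
  by have := order_le_cycle cy (mem_head _ _); rewrite d0_deg.
move: (u1) (u2); rewrite vts1 vts2 rev_rcons /= !inE !negb_or !mem_rev rev_uniq.
move=> /and4P[/and3P[v01 v02 vs] /andP[w1x w1s] xs us].
move=> /and4P[/and3P[xw2 xv xs'] /andP[w2v w2s] _ _].
have w2c : vt b2 \notin map vt c1.
  by rewrite vts1 !inE !negb_or w2v eq_sym b02 eq_sym xw2 w2s.
have w1c : vt b0 \notin map vt c2.
  by rewrite vts2 rev_rcons !inE mem_rev !negb_or w1x b02 (eq_sym (vt b0)) v01 w1s.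
have [q0 [q0f q0t]] := closed_walk_cobound M cyc1.
pose q x := q0 x (+) q0 d0.
have qf x : q (phi x) = q x by rewrite /q q0f.
have qt x : q (ed x) (+) q x = trace ed c1 x.
  by rewrite -q0t /q; case: (q0 _) (q0 x) (q0 d0) => [] [] [].
have qd0 : q d0 = false by rewrite /q addbb.
have fs_phi x : (phi x \in fs) = (x \in fs).
  by rewrite -fsE -!fconnect_orbit -(same_fconnect1_r phi_inj).
have qfs x : x \in fs -> q x = false.
  rewrite -fsE -fconnect_orbit => /iter_findex <-.
  by elim: (findex _ _ _) => [//|k IH]; rewrite iterS qf.
have trace_out c qq y : uniq c -> cycle (consecutive ed vt) c ->
    (forall x, qq (ed x) (+) qq x = trace ed c x) ->
    vt (ed y) \notin map vt c -> qq y = false -> qq (ed y) = false.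
  move=> uc cyc qqt yc qy; have := qqt y; rewrite qy addbF (traceE M) // => ->.
  have -> : y \in c = false.
    apply: contraNF yc => yc; have /eqP -> := next_cycle cyc yc.
    by rewrite map_f // mem_next.
  by apply: contraNF yc => yc; rewrite map_f.
have [/forallP O0|] := boolP [forall o, (o \in O) ==> ~~ q o].
  have [||||z [z1 z2 z3]] := @inward_dart c1 q d0 s1 cyc1 qf qt.
  - by rewrite mem_head.
  - by rewrite !inE eqxx orbT.
  - by rewrite qf.
  - have -> : order n (phi d0) = order n (ed d0).
      by rewrite !(degree_card M) vphi.
    by apply: (degree_beside_facial M F deg3); rewrite edK.
  apply: (@cut_conclusion T D e ed n vt O M C e_sym simple og deg3 c1 q d0 z s1 cyc1 qf qt) => //.
  - exact: mem_head.
  - by move=> o oO; apply/negbTE; have := O0 o; rewrite oO.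
  exists b1; split; first by rewrite qfs // !inE eqxx !orbT.
  apply: (trace_out c1) => //; first exact: map_uniq u1.
    by rewrite -vphi.
  by rewrite qfs // !inE eqxx !orbT.
rewrite negb_forall => /existsP[o1]; rewrite negb_imply negbK => /andP[o1O qo1].
have [_ Ocn _ _ _] := F.
have qO o : o \in O -> q o.
  move=> oO; have /iter_findex <- := Ocn _ _ o1O oO.
  by elim: (findex _ _ _) => [//|k IH]; rewrite iterS qf.
(* The exceptional face lies beyond [c1]; what is kept is everything on the other side of [c1]
   except the 4-face, and its boundary is [c2]. *)
pose q' x := ~~ q x && (x \notin fs).
have q'E x : q' x = ~~ (q x (+) (x \in fs)).
  by rewrite /q'; case: (boolP (x \in fs)) => [/qfs->|] //=; rewrite ?andbT ?addbF.
have q'f x : q' (phi x) = q' x by rewrite /q' qf fs_phi.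
have q't x : q' (ed x) (+) q' x = trace ed c2 x.
  have tfs : trace ed fs x = (x \in fs) (+) (ed x \in fs) by rewrite (traceE M).
  rewrite !q'E; have -> : trace ed c2 x = trace ed c1 x (+) trace ed fs x.
    rewrite /c2 /c1 -[fs]/([:: d0; b0] ++ [:: b1; b2]) !trace_cat (trace_rev_ed M).
    by case: (trace _ _ _) (trace _ _ _) (trace _ _ _) => [] [] [].
  by rewrite -qt tfs; case: (q _) (q x) (x \in fs) (ed x \in fs) => [] [] [] [].
have q'fs x : x \in fs -> q' x = false by rewrite /q' => ->; rewrite andbF.
have [||||z [z1 z2 z3]] := @inward_dart c2 q' b1 s2 cyc2 q'f q't.
- by rewrite mem_head.
- by rewrite !inE eqxx orbT.
- by rewrite q'fs // !inE eqxx !orbT.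
- apply: (degree_beside_facial M F deg3); by rewrite -vphi -/b2 b3.
apply: (@cut_conclusion T D e ed n vt O M C e_sym simple og deg3 c2 q' b1 z s2 cyc2 q'f q't) => //.
- exact: mem_head.
- by rewrite q'fs // !inE eqxx !orbT.
- by move=> o /qO qo; rewrite /q' qo.
exists d0; split; first by rewrite q'fs // !inE eqxx.
apply: (trace_out c2) => //; first exact: map_uniq u2.
  by rewrite -vphi.
by rewrite q'fs // !inE eqxx.
Qed.

End Unsafe.

(** Induction on the number of darts: discharging applies when no candidate vertex has a walk of
    length 5 to its opposite vertex, and such a walk yields a smaller map whose reducible vertex is
    one of the given map. *)
Lemma facial_reducible k : forall (T D : finType) (e : rel T) (ed n : D -> D) (vt : D -> T) (O : {set D}),
  #|D| < k -> 0 < #|D| -> plane_map ed n vt -> carries ed vt e -> symmetric e ->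
  (forall d d', vt d = vt d' -> vt (ed d) = vt (ed d') -> d = d') ->
  odd_girth7 e -> facial_cycle ed n vt O ->
  (forall d, vt d \notin vt @: O -> 3 <= order n d) ->
  ~ forall d, ~ reducible_at e ed n vt (vt @: O) d.
Proof.
elim: k => [//|k IH] T D e ed n vt O Dk D0 M C e_sym simple og F deg3 irr.
have /card_gt0P[d _] := D0.
have [cl cn card inj ex] := F.
apply: (discharging M C simple og cl (facial_order F) cn card inj ex deg3) => //.
move=> d0 d0S d03 d04 w.
have [D' [ed' [n' [vt' [O' [e' [[D'D D'0 M' C'] [[sym' simple' og' F' deg'] red]]]]]]]] :=
  unsafe_cut M C e_sym simple og F deg3 d0S d03 d04 w.
apply: (IH T D' e' ed' n' vt' O' (leq_trans D'D Dk) D'0 M' C' sym' simple' og' F' deg').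
by move=> d' r'; have [d1 r1] := red (ex_intro _ d' r'); exact: irr r1.
Qed.

Lemma plane_map_reducible (T D : finType) (e : rel T) (ed n : D -> D) (vt : D -> T) :
  0 < #|D| -> plane_map ed n vt -> carries ed vt e -> symmetric e ->
  (forall d d', vt d = vt d' -> vt (ed d) = vt (ed d') -> d = d') ->
  odd_girth7 e -> (forall d, 3 <= order n d) ->
  ~ forall d, ~ reducible_at e ed n vt set0 d.
Proof.
move=> D0 M C e_sym simple og deg3.
rewrite -(imset0 vt); apply: facial_reducible (ltnSn #|D|) D0 M C e_sym simple og _ _ => //.
split=> [d|d d'| |d d'|].
- by rewrite !inE.
- by rewrite inE.
- by rewrite eqxx.
- by rewrite inE.
by rewrite eqxx.
Qed.

(** * Recolouring *)

Section Moves.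
Variables (T C : finType).
Implicit Types (e : rel T) (f g : {ffun T -> C}) (m : T * C) (s : seq (T * C)).

Definition proper_fun e f := forall u v, e u v -> f u != f v.

Definition recolor f m : {ffun T -> C} := [ffun u => if u == m.1 then m.2 else f u].

Fixpoint valid e f s : Prop :=
  if s is m :: s' then proper_fun e (recolor f m) /\ valid e (recolor f m) s' else True.

Definition run f s := foldl recolor f s.

Definition times (u : T) s := count (fun m => m.1 == u) s.

Lemma valid_cat e f s1 s2 : valid e f s1 -> valid e (run f s1) s2 -> valid e f (s1 ++ s2).
Proof. by elim: s1 f => [//|m s1 IH] f /= [pf v1] v2; split=> //; exact: IH. Qed.

Lemma run_cat f s1 s2 : run f (s1 ++ s2) = run (run f s1) s2.
Proof. exact: foldl_cat. Qed.

Lemma valid_proper e f s : proper_fun e f -> valid e f s -> proper_fun e (run f s).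
Proof. by elim: s f => [//|m s IH] f _ /= [pf /IH]; exact. Qed.

Lemma recolorE f u c v : recolor f (u, c) v = if v == u then c else f v.
Proof. by rewrite ffunE. Qed.

Lemma proper_recolor e f u c : symmetric e -> irreflexive e -> proper_fun e f ->
  (forall v, e u v -> f v != c) -> proper_fun e (recolor f (u, c)).
Proof.
move=> sym irr pf H a b ab; rewrite !recolorE.
case: (a =P u) => [au|_]; case: (b =P u) => [bu|_] //.
- by rewrite au bu irr in ab.
- by rewrite eq_sym H // -au.
- by rewrite H // -bu sym.
exact: pf.
Qed.

(** The colour of the isolated vertex [v] has no influence on validity. *)
Lemma valid_agree e v s f g : (forall a b, e a b -> (a != v) && (b != v)) ->
  (forall w, w != v -> f w = g w) -> valid e g s ->
  valid e f s /\ forall w, w != v -> run f s w = run g s w.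
Proof.
move=> nv; elim: s f g => [|m s IH] f g fg //= [pg vg].
have fg' w : w != v -> recolor f m w = recolor g m w by move=> wv; rewrite !ffunE fg.
have [vf rf] := IH _ _ fg' vg; split=> //; split=> // a b ab.
by have /andP[av bv] := nv _ _ ab; rewrite !fg' //; exact: pg.
Qed.

Lemma free_color (X : {set C}) : #|X| < #|C| -> exists c, c \notin X.
Proof.
move=> XC; have /card_gt0P[c cX] : 0 < #|~: X| by rewrite cardsCs setCK subn_gt0.
by exists c; rewrite inE in cX.
Qed.

End Moves.

(** * Identifying two vertices of equal colour *)

Section Identify.
Variables (T C : finType) (e : rel T) (v x : T).
Hypotheses (e_sym : symmetric e) (e_irr : irreflexive e) (vx : v != x) (nvx : ~~ e v x).
Let r (u : T) := if u == v then x else u.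

Let rv : r v = x. Proof. by rewrite /r eqxx. Qed.
Let r_id u : u != v -> r u = u. Proof. by rewrite /r => /negbTE->. Qed.

Let e_quot a b : e a b -> quot r e (r a) (r b).
Proof.
move=> ab; apply/andP; split.
  rewrite /r; case: (a =P v) => [av|_]; case: (b =P v) => [bv|_].
  - by rewrite av bv e_irr in ab.
  - by apply: contraNneq nvx => xb; rewrite xb -av.
  - by apply: contraNneq nvx => ax; rewrite -ax -bv e_sym.
  by apply: contraTneq ab => ->; rewrite e_irr.
by apply/existsP; exists a; apply/existsP; exists b; rewrite ab !eqxx.
Qed.

Lemma proper_quot (f : {ffun T -> C}) : f v = f x -> proper_fun e f -> proper_fun (quot r e) f.
Proof.
move=> fvx pf a b /andP[_ /existsP[a' /existsP[b' /and3P[/eqP<- /eqP<- ab]]]].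
have fr u : f (r u) = f u by rewrite /r; case: eqP => // ->.
by rewrite !fr; exact: pf.
Qed.

(** A move of [x] lifts to a move of [x] followed by the same move of [v]. Both are proper because
    the new colour is free at all neighbours of the merged vertex and [v] and [x] are not adjacent.
    In the quotient [v] is isolated, so its colour there may be out of date; [valid_agree] allows
    for this. *)
Lemma identify_lift (f : {ffun T -> C}) (s : seq (T * C)) :
  f v = f x -> proper_fun e f -> valid (quot r e) f s -> all (fun m => m.1 != v) s ->
  exists s', [/\ valid e f s', forall u, run f s' u = run f s (r u),
     forall u, times u s' = times (r u) s & forall m, m \in s' -> m.1 = v \/ exists2 m', m' \in s & m.1 = m'.1].
Proof.
elim: s f => [|[u c] s IH] f fvx pf /=.
  by move=> _ _; exists [::]; split=> // u /=; rewrite /r; case: eqP => // ->.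
move=> [pf1 vs] /andP[uv av]; set f1 := recolor f (u, c) in pf1 vs *.
have f1E w : f1 w = if w == u then c else f w by rewrite recolorE.
have vu : (v == u) = false by rewrite eq_sym (negbTE uv).
have [ux|ux] := eqVneq u x; last first.
  have fvx1 : f1 v = f1 x by rewrite !f1E vu eq_sym (negbTE ux).
  have pe1 : proper_fun e f1.
    have fr w : f1 (r w) = f1 w by rewrite /r; case: eqP => // ->.
    by move=> a b /e_quot/pf1; rewrite !fr.
  have [s' [v' rs' ts' ms']] := IH f1 fvx1 pe1 vs av.
  exists ((u, c) :: s'); split=> //=.
    move=> w; rewrite ts'; congr addn; rewrite /r; case: (w =P v) => [->|//].
    by rewrite (negbTE uv) (negbTE ux).
  move=> m; rewrite inE => /predU1P[->|/ms'[->|[m' ms mE]]]; [|by left|].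
    by right; exists (u, c); rewrite ?mem_head.
  by right; exists m' => //; rewrite inE ms orbT.
subst u; pose f2 := recolor f1 (v, c).
have f2E w : f2 w = if w == v then c else f1 w by rewrite recolorE.
have f12 w : f2 w = f1 (r w) by rewrite f2E /r; case: eqP => // _; rewrite f1E eqxx.
have pe2 : proper_fun e f2 by move=> a b /e_quot/pf1; rewrite !f12.
have pe1 : proper_fun e f1.
  apply: proper_recolor => // w xw; have wv : w != v by apply: contraNneq nvx => <-; rewrite e_sym.
  have wx : w != x by apply: contraTneq xw => ->; rewrite e_irr.
  have xv : x != v by rewrite eq_sym.
  have := pf1 _ _ (e_quot xw); rewrite (r_id wv) (r_id xv).
  by rewrite !f1E eqxx (negbTE wx) eq_sym.
have off w : w != v -> f2 w = f1 w by move=> wv; rewrite f2E (negbTE wv).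
have fvx2 : f2 v = f2 x by rewrite !f12 rv r_id // eq_sym.
have nv a b : quot r e a b -> (a != v) && (b != v).
  move=> /andP[_ /existsP[y /existsP[z /and3P[/eqP<- /eqP<- _]]]].
  by rewrite /r; apply/andP; split; case: ifP => [_|->]; rewrite // eq_sym.
have [vs2 rs2] := valid_agree nv off vs.
have [s' [v' rs' ts' ms']] := IH f2 fvx2 pe2 vs2 av.
exists ((x, c) :: (v, c) :: s'); split=> //=.
- by move=> w; rewrite rs' rs2 // /r; case: ifP => [_|->]; rewrite // eq_sym.
- move=> w; rewrite ts' /r; case: (w =P v) => [->|/eqP wv].
    by rewrite !eqxx [x == v]eq_sym (negbTE vx).
  by rewrite [v == w]eq_sym (negbTE wv).
move=> m; rewrite !inE => /predU1P[->|/predU1P[->|/ms'[->|[m' ms mE]]]]; [|by left|by left|].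
  by right; exists (x, c); rewrite ?mem_head.
by right; exists m' => //; rewrite inE ms orbT.
Qed.

(* a closed walk in the quotient splits into walks of e joining v or x to v or x *)
Lemma quot_odd_girth w : odd_girth7 e -> e v w -> e w x -> ~ walk e 5 v x ->
  odd_girth7 (quot r e).
Proof.
move=> og vw wx n5.
pose Z := [set v; x].
(* A walk of length 1 or 3 between [v] and [x] closes up through [w] to length 3 or 5; length 5 is
   excluded by hypothesis. *)
have Zbad k z z' : z \in Z -> z' \in Z -> odd k -> k <= 5 -> ~ walk e k z z'.
  have vxbad : odd k -> k <= 5 -> ~ walk e k v x.
    have w2 : walk e 2 x v.
      by apply: walkS (_ : e x w) _; rewrite 1?e_sym //; apply: walk1; rewrite e_sym.
    move=> ok k5 wk; have wk2 := walk_cat wk w2.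
    by case: k ok k5 wk wk2 => [|[|[|[|[|[|//]]]]]] //= _ _ wk wk2;
      [exact: (og 3 v) | exact: (og 5 v)].
  rewrite !inE => /orP[]/eqP-> /orP[]/eqP-> ok k5 wk; first exact: (og k v).
  - exact: vxbad wk.
  - by apply: vxbad (walk_rev e_sym wk).
  exact: (og k x).
have vZ : v \in Z by rewrite !inE eqxx.
have xZ : x \in Z by rewrite !inE eqxx orbT.
(* Only the first and the last piece are recorded: the pieces between two passages through the
   merged vertex join points of [Z], so they are even by [Zbad] and dropping them preserves parity.
   For a closed walk, the last and the first piece combine into one odd walk from [Z] to [Z]. *)
have claim n : forall a b, n <= 5 -> walk (quot r e) n a b -> walk e n a b \/
    exists i j z z', [/\ z \in Z, z' \in Z, walk e i a z & walk e j z' b] /\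
      (i + j <= n /\ odd (i + j) = odd n).
  elim: n => [|n IH] a b n5'; first by move=> /walk0P->; left; exact: walk0.
  move=> /walkSP[c /andP[_ /existsP[a' /existsP[c' /and3P[/eqP ra /eqP rc ac]]]]] /(IH _ _ (ltnW n5')) H.
  have [av|av] := eqVneq a' v.
    have ax : a = x by rewrite -ra av rv.
    have cv : c' != v by apply: contraTneq ac => ->; rewrite av e_irr.
    have cc : c' = c by rewrite -rc r_id.
    right; exists 0; case: H => [wn|[i [j [z [z' [[zZ z'Z wi wj] [ij oij]]]]]]].
      exists n.+1, x, v; rewrite ax; split=> //; split=> //; first exact: walk0.
      by apply: walkS wn; rewrite -av -cc.
    have oi : odd i.
      apply: contraT => oi; exfalso; apply: (Zbad i.+1 v z vZ zZ oi).
        by apply: leq_trans n5'; rewrite ltnS; apply: leq_trans ij; exact: leq_addr.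
      by apply: walkS wi; rewrite -av -cc.
    exists j, x, z'; rewrite ax; split; first by split=> //; exact: walk0.
    split; first by rewrite add0n; apply: leq_trans (leqW ij); exact: leq_addl.
    by move: oij; rewrite oddD oi /= add0n => <-; rewrite negbK.
  have aa : a' = a by rewrite -ra r_id.
  have [cv|cv] := eqVneq c' v.
    have cx : c = x by rewrite -rc cv rv.
    right; exists 1; case: H => [wn|[i [j [z [z' [[zZ z'Z wi wj] [ij oij]]]]]]].
      exists n, v, x; split=> //; split=> //; last by rewrite -cx.
      by apply: walk1; rewrite -aa -cv.
    have oi : odd i = false.
      apply/negP => oi; rewrite cx in wi; apply: (Zbad i x z xZ zZ oi _ wi).
      by apply: leq_trans (ltnW n5'); apply: leq_trans ij; exact: leq_addr.
    exists j, v, z'; split; first by split=> //; apply: walk1; rewrite -aa -cv.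
    split; first by rewrite add1n ltnS; apply: leq_trans ij; exact: leq_addl.
    by move: oij; rewrite !oddD oi /= => ->.
  have cc : c' = c by rewrite -rc r_id.
  rewrite aa cc in ac.
  case: H => [wn|[i [j [z [z' [[zZ z'Z wi wj] [ij oij]]]]]]]; first by left; exact: walkS ac wn.
  by right; exists i.+1, j, z, z'; rewrite !addSn /= oij; split=> //; split=> //; exact: walkS ac wi.
move=> k a ok k5 /(claim _ _ _ k5)[|[i [j [z [z' [[zZ z'Z wi wj] [ij oij]]]]]]]; first exact: og.
have wz := walk_cat wj wi.
by apply: (Zbad _ _ _ z'Z zZ _ _ wz); rewrite addnC ?oij //; exact: leq_trans ij k5.
Qed.

End Identify.

(** * Restoring a vertex of degree at most 2 *)

Section ExtendLowDegree.
Variables (T : finType) (e : rel T) (v : T).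
Hypotheses (e_sym : symmetric e) (e_irr : irreflexive e).
Hypothesis deg2 : #|[set w | e v w]| <= 2.
Local Notation C := 'I_5.

Definition remove : rel T := fun a b => [&& e a b, a != v & b != v].

Let conflicts (s : seq (T * C)) := count (fun m => e v m.1) s.
Let next_color (s : seq (T * C)) := ohead [seq m.2 | m <- s & e v m.1].

Let extends (f : {ffun T -> C}) (s s' : seq (T * C)) :=
  [/\ valid e f s', forall u, u != v -> run f s' u = run f s u,
      forall u, u != v -> times u s' = times u s &
      forall m, m \in s' -> m.1 = v \/ exists2 m', m' \in s & m.1 = m'.1].

Let extends_cons f m s s' : m.1 != v -> proper_fun e (recolor f m) ->
  extends (recolor f m) s s' -> extends f (m :: s) (m :: s').
Proof.
move=> mv pm [v1 r1 t1 m1]; split=> //=.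
  by move=> u uv; rewrite t1.
move=> m0; rewrite inE => /predU1P[->|/m1[->|[m' ms mE]]]; [|by left|].
  by right; exists m; rewrite ?mem_head.
by right; exists m' => //; rewrite inE ms orbT.
Qed.

(* A neighbour about to take the colour of v forces v to move.  As there are
   five colours and at most two neighbours, the new colour of v can also avoid
   the next conflict, so v moves at most once every two moves of neighbours. *)
Let extend_moves s : forall f : {ffun T -> C}, proper_fun e f -> valid remove f s ->
    all (fun m => m.1 != v) s ->
  (exists2 s', extends f s s' & times v s' <= uphalf (conflicts s)) /\
  (next_color s != Some (f v) ->
    exists2 s', extends f s s' & times v s' <= half (conflicts s)).
Proof.
elim: s => [|[u c] s IH] f pf /=.
  by move=> _ _; split; [|move=> _]; exists [::].
move=> [p1 vs] /andP[/= uv av]; set f1 := recolor f (u, c) in p1 vs *.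
have f1E w : f1 w = if w == u then c else f w by rewrite recolorE.
have f1v : f1 v = f v by rewrite f1E eq_sym (negbTE uv).
have vu : v != u by rewrite eq_sym.
have p1_pe : (e v u -> c != f v) -> proper_fun e f1.
  move=> H; apply: proper_recolor => // w uw; rewrite eq_sym.
  case: (eqVneq w v) => [wv|wv]; first by rewrite wv H // e_sym -wv.
  have wu : w != u by apply: contraTneq uw => ->; rewrite e_irr.
  have := p1 u w; rewrite !f1E eqxx (negbTE wu); apply.
  by rewrite /remove uw uv.
have evuE : next_color ((u, c) :: s) = if e v u then Some c else next_color s.
  by rewrite /next_color /=; case: ifP.
have cnt (s' : seq (T * C)) : times v ((u, c) :: s') = times v s'.
  by rewrite /times /= (negbTE uv).
rewrite evuE; have [evu|evu] := boolP (e v u); last first.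
  have pe1 : proper_fun e f1 by apply: p1_pe; rewrite (negbTE evu).
  have [[s1 x1 t1] H2] := IH f1 pe1 vs av.
  split; first by exists ((u, c) :: s1); rewrite ?cnt ?add0n //; exact: extends_cons.
  rewrite -f1v => /H2[s2 x2 t2].
  by exists ((u, c) :: s2); rewrite ?cnt ?add0n //; exact: extends_cons.
have [cf|cf] := eqVneq c (f v); last first.
  have pe1 : proper_fun e f1 by exact: p1_pe.
  have [[s1 x1 t1] _] := IH f1 pe1 vs av.
  split; [|move=> _]; exists ((u, c) :: s1); rewrite ?cnt ?add1n //; try exact: extends_cons.
  by apply: leq_trans t1 _; rewrite ?uphalf_half; lia.
split; last by rewrite cf eqxx.
(* At most four forbidden colours: two of neighbours, the colour about to be taken, and the next
   one. Without a later move of a neighbour the default [c] forbids nothing new. *)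
pose X := [set f w | w in [set w | e v w]] :|: [set c; odflt c (next_color s)].
have [|c' c'X] := @free_color _ X.
  rewrite card_ord; apply: leq_ltn_trans (leq_card_setU _ _) _.
  have X1 : #|[set f w | w in [set w | e v w]]| <= 2 := leq_trans (leq_imset_card _ _) deg2.
  have X2 : #|[set c; odflt c (next_color s)]| <= 2 by rewrite cards2; case: (_ != _).
  exact: (leq_ltn_trans (leq_add X1 X2)).
move: c'X; rewrite !inE !negb_or => /and3P[c'N c'c c'n].
have c'f w : e v w -> f w != c'.
  by move=> vw; apply: contraNneq c'N => <-; apply: imset_f; rewrite inE.
pose f0 := recolor f (v, c').
have pe0 : proper_fun e f0 by exact: proper_recolor.
pose f01 := recolor f0 (u, c).
have f01E w : f01 w = if w == u then c else if w == v then c' else f w by rewrite !recolorE.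
have off w : w != v -> f01 w = f1 w by move=> wv; rewrite f01E f1E (negbTE wv).
have pe01 : proper_fun e f01.
  apply: proper_recolor => // w uw; rewrite recolorE eq_sym.
  case: (eqVneq w v) => [_|wv]; first by rewrite eq_sym.
  have wu : w != u by apply: contraTneq uw => ->; rewrite e_irr.
  have := p1 u w; rewrite !f1E eqxx (negbTE wu); apply.
  by rewrite /remove uw uv.
have nv a b : remove a b -> (a != v) && (b != v) by case/and3P=> _ -> ->.
have [vs01 rs01] := valid_agree nv off vs.
have [_ H2] := IH f01 pe01 vs01 av.
have [|s2 [v2 r2 t2 m2] c2] := H2.
  rewrite f01E (negbTE vu) eqxx; apply: contraNneq c'n => ->; exact: eqxx.
exists ((v, c') :: (u, c) :: s2); last first.
  by rewrite /times /= eqxx (negbTE uv) add0n add1n /= -/(times v s2).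
split=> //=.
- by move=> w wv; rewrite r2 // rs01.
- by move=> w wv; rewrite eq_sym (negbTE wv) add0n t2.
move=> m0; rewrite !inE => /predU1P[->|/predU1P[->|/m2[->|[m' ms mE]]]]; [by left| |by left|].
  by right; exists (u, c); rewrite ?mem_head.
by right; exists m' => //; rewrite inE ms orbT.
Qed.

Let conflictsE s : conflicts s = \sum_(w | e v w) times w s.
Proof.
elim: s => [|m s IH]; first by rewrite big1.
rewrite /conflicts /= -/(conflicts s) IH /times /=.
under [RHS]eq_bigr => w _ do rewrite /=.
rewrite big_split /=; congr addn.
rewrite big_mkcond /= (bigD1 m.1) //= eqxx big1 ?addn0; first by case: (e v m.1).
by move=> w wm; rewrite eq_sym (negbTE wm); case: ifP.
Qed.

(** Two neighbours make at most [2 * k] moves, which force at most [k] moves of [v]; one last move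
    brings [v] into [L], where two neighbours leave a colour free. *)
Lemma extend_low_degree (f : {ffun T -> C}) (s : seq (T * C)) (L : {set C}) k :
    proper_fun e f -> valid remove f s -> all (fun m => m.1 != v) s ->
    (forall w, times w s <= k) -> (forall w, e v w -> run f s w \in L) -> 2 < #|L| ->
  exists s', [/\ valid e f s', forall u, u != v -> run f s' u = run f s u /\ times u s' = times u s,
     run f s' v \in L, times v s' <= k.+1 &
     forall m, m \in s' -> m.1 = v \/ exists2 m', m' \in s & m.1 = m'.1].
Proof.
move=> pf vs av tk wL L3.
have [[s1 [v1 r1 t1 m1] c1] _] := extend_moves pf vs av.
pose g := run f s1; have pg : proper_fun e g by exact: valid_proper v1.
pose X := [set g w | w in [set w | e v w]].
have X2 : #|X| <= 2 by apply: leq_trans (leq_imset_card _ _) deg2.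
have /card_gt0P[c] : 0 < #|L :\: X|.
  rewrite cardsD subn_gt0; apply: leq_ltn_trans (subset_leq_card (subsetIr L X)) _.
  exact: leq_ltn_trans X2 L3.
rewrite inE => /andP[cX cL].
exists (s1 ++ [:: (v, c)]); split.
- apply: valid_cat v1 _; split=> //; apply: proper_recolor => // w vw.
  by apply: contraNneq cX => <-; apply: imset_f; rewrite inE.
- move=> u uv; rewrite run_cat /= recolorE (negbTE uv) r1 //; split=> //.
  by rewrite /times count_cat /= [v == u]eq_sym (negbTE uv) !addn0 -/(times u s1) t1.
- by rewrite run_cat /= recolorE eqxx.
- rewrite /times count_cat /= eqxx addn0 addn1 ltnS; apply: leq_trans c1 _.
  have : conflicts s <= 2 * k.
    rewrite conflictsE; apply: leq_trans (_ : \sum_(w | e v w) k <= _).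
      by apply: leq_sum.
    rewrite sum_nat_const leq_mul2r; apply/orP; right.
    by apply: leq_trans deg2; apply: subset_leq_card; apply/subsetP => w; rewrite inE.
  by move: (conflicts s) => q; rewrite uphalf_half; lia.
move=> m; rewrite mem_cat inE => /orP[/m1//|/eqP->]; by left.
Qed.

End ExtendLowDegree.

Section Align.
Variables (T : finType) (e : rel T) (v x w1 w2 w3 : T).
Local Notation C := 'I_5.
Local Notation nbr u := [set w | e u w].
Hypotheses (e_sym : symmetric e) (e_irr : irreflexive e).
Hypotheses (vx : v != x) (nvx : ~~ e v x) (w12 : w1 != w2).
Hypothesis vN : forall u, e v u = (u \in [:: w1; w2; w3]).
Hypotheses (xw1 : e x w1) (xw2 : e x w2).
Hypothesis small : #|nbr x| <= 3 \/ #|nbr w3| <= 4.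

(** If [x] has degree at most 3, then [v] and [x] have at most four neighbours together, as [w1] and
    [w2] are common, and a fifth colour suits both. Otherwise [v] takes the colour of [x], which can
    be blocked only by [w3]. In that case [v] first steps aside to [c'], so that [w3] can move to a
    colour [c] avoiding its at most three other neighbours. *)
Lemma align (f : {ffun T -> C}) : proper_fun e f -> exists s : seq (T * C),
  [/\ valid e f s, run f s v = run f s x, forall u, times u s <= 2 &
      forall m, m \in s -> m.1 \in [:: v; x; w3]].
Proof.
move=> pf.
have vw1 : e v w1 by rewrite vN inE eqxx.
have vw2 : e v w2 by rewrite vN !inE eqxx orbT.
have vw3 : e v w3 by rewrite vN !inE eqxx !orbT.
case: small => [x3|w4].
  pose X := f @: (nbr v :|: nbr x).
  have [|c cX] := @free_color _ X.
    rewrite card_ord; apply: leq_ltn_trans (leq_imset_card _ _) _.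
    have : #|nbr v| <= 3.
      apply: leq_trans (_ : #|[:: w1; w2; w3]| <= _); last exact: card_size.
      by apply: subset_leq_card; apply/subsetP => w; rewrite inE vN.
    have : 2 <= #|nbr v :&: nbr x|.
      have -> : 2 = #|[set w1; w2]| by rewrite cards2 w12.
      by apply: subset_leq_card; apply/subsetP => w; rewrite !inE => /orP[]/eqP->; apply/andP.
    have := cardsUI (nbr v) (nbr x); move: x3.
    by move: #|_ :|: _| #|_ :&: _| #|nbr v| #|nbr x| => a b c d; lia.
  have cN w : e v w || e x w -> f w != c.
    by move=> h; apply: contraNneq cX => <-; apply: imset_f; rewrite !inE.
  have p1 : proper_fun e (recolor f (v, c)).
    by apply: proper_recolor => // w vw; apply: cN; rewrite vw.
  exists [:: (v, c); (x, c)]; split=> /=.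
  - split=> //; split=> //; apply: proper_recolor => // w xw.
    have wv : w != v by apply: contraNneq nvx => <-; rewrite e_sym.
    by rewrite recolorE (negbTE wv) cN // xw orbT.
  - by rewrite !recolorE eqxx (negbTE vx) eqxx.
  - by move=> u; rewrite /times /=; case: (v == u); case: (x == u).
  by move=> m; rewrite !inE => /orP[]/eqP-> /=; rewrite eqxx ?orbT.
have [fx3|fx3] := eqVneq (f x) (f w3); last first.
  exists [:: (v, f x)]; split=> /=.
  - split=> //; apply: proper_recolor => // w.
    rewrite vN !inE => /or3P[]/eqP->; rewrite eq_sym //; exact: pf.
  - by rewrite !recolorE eqxx eq_sym (negbTE vx).
  - by move=> u; rewrite /times /=; case: (v == u).
  by move=> m; rewrite !inE => /eqP-> /=; rewrite eqxx.
have w3x : w3 != x by apply: contraTneq vw3 => ->.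
have w3v : w3 != v by apply: contraTneq vw3 => ->; rewrite e_irr.
have w1v : w1 != v by apply: contraTneq vw1 => ->; rewrite e_irr.
have w2v : w2 != v by apply: contraTneq vw2 => ->; rewrite e_irr.
have w13 : w1 != w3 by apply: contraTneq (pf _ _ xw1) => ->; rewrite fx3 eqxx.
have w23 : w2 != w3 by apply: contraTneq (pf _ _ xw2) => ->; rewrite fx3 eqxx.
have [|c cX] := @free_color _ (f w3 |: (f @: (nbr w3 :\ v))).
  rewrite card_ord; apply: leq_ltn_trans (leq_card_setU _ _) _; rewrite cards1 add1n ltnS.
  apply: leq_ltn_trans (leq_imset_card _ _) _.
  by have := cardsD1 v (nbr w3); rewrite inE e_sym vw3 => h; rewrite h in w4.
have [|c' c'X] := @free_color _ [set f w1; f w2; f w3; c].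
  rewrite card_ord; apply: leq_ltn_trans (leq_card_setU _ _) _; rewrite cards1 addn1 ltnS.
  apply: leq_ltn_trans (leq_card_setU _ _) _; rewrite cards1 addn1 ltnS.
  by rewrite cards2; case: (_ != _).
move: c'X cX; rewrite !inE !negb_or => /andP[/andP[/andP[c1 c2] c3] cc] /andP[c3' cN].
have p1 : proper_fun e (recolor f (v, c')).
  apply: proper_recolor => // w; rewrite vN !inE => /or3P[]/eqP->; by rewrite eq_sym.
have p2 : proper_fun e (recolor (recolor f (v, c')) (w3, c)).
  apply: proper_recolor => // w w3w; rewrite recolorE; case: (eqVneq w v) => // wv.
  apply: contraNneq cN => <-; apply: imset_f; by rewrite !inE wv.
exists [:: (v, c'); (w3, c); (v, f x)]; split=> /=.
- split=> //; split=> //; split=> //; apply: proper_recolor => // w.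
  rewrite vN !inE !recolorE => /or3P[]/eqP->.
  + by rewrite (negbTE w13) (negbTE w1v) eq_sym pf.
  + by rewrite (negbTE w23) (negbTE w2v) eq_sym pf.
  by rewrite eqxx fx3.
- by rewrite !recolorE eqxx ![x == _]eq_sym (negbTE vx) (negbTE w3x).
- move=> u; rewrite /times /=; case: (eqVneq v u) => [<-|_]; first by rewrite (negbTE w3v).
  by case: (w3 == u).
by move=> m; rewrite !inE => /or3P[]/eqP-> /=; rewrite eqxx ?orbT.
Qed.

End Align.

Lemma times_bound a b c : 0 < a -> b <= 2 -> c <= 2 * a - 1 -> b + c <= 2 * a.+1 - 1.
Proof. lia. Qed.

Section Reach.
Variable T : finType.
Local Notation C := 'I_5.
Local Notation nbr e u := [set w | e u w].

Lemma degree_nbr (e : rel T) (D : finType) (ed n : D -> D) (vt : D -> T) d :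
  plane_map ed n vt -> carries ed vt e ->
  (forall d d', vt d = vt d' -> vt (ed d) = vt (ed d') -> d = d') ->
  order n d = #|nbr e (vt d)|.
Proof.
move=> M Ca simple; rewrite (degree_card M).
rewrite -(card_in_imset (f := fun z => vt (ed z))); last first.
  by move=> y z; rewrite !inE => /eqP vy /eqP vz; apply: simple; rewrite vy vz.
apply: eq_card => w; rewrite inE; apply/imsetP/idP => [[z]|].
  by rewrite inE => /eqP <- ->; exact: dart_adj Ca z.
by rewrite Ca => /existsP[z /andP[zd /eqP <-]]; exists z; rewrite ?inE.
Qed.

(** The vertex type stays fixed and the set [A] shrinks, so that deletion and identification need no
    change of type. By truncated subtraction the bound is 0 for empty [A], which gives a single
    vertex its one move. *)
Lemma reach_palette k : forall (A : {set T}) (e : rel T) (f : {ffun T -> C}) (L : {set C}),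
  #|A| < k -> symmetric e -> irreflexive e -> (forall u w, e u w -> u \in A) ->
  has_plane_map e -> odd_girth7 e -> proper_fun e f -> #|L| = 3 ->
  exists s : seq (T * C), [/\ valid e f s, forall u, u \in A -> run f s u \in L,
    forall u, times u s <= 2 * #|A| - 1 & forall m, m \in s -> m.1 \in A].
Proof.
elim: k => [//|k IH] A e f L Ak e_sym e_irr eA PM og pf L3.
have [A0|/card_gt0P[u0 u0A]] := posnP #|A|.
  exists [::]; split=> // u; by rewrite (cards0_eq A0) inE.
have eA2 u w : e u w -> w \in A by rewrite e_sym => /eA.
case: (pickP [pred v | (v \in A) && (#|nbr e v| <= 2)]) => [v /= /andP[vA v2]|big].
  pose A' := A :\ v; pose e' := remove e v.
  have cA : #|A| = #|A'|.+1 by rewrite (cardsD1 v) vA.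
  have sub : subrel e' e by move=> a b /and3P[].
  have sym' : symmetric e'.
    by move=> a b; rewrite /e' /remove e_sym; congr andb; rewrite andbC.
  have [||||||||s [vs ls ts ms]] := IH A' e' f L.
  - by rewrite -ltnS -cA.
  - exact: sym'.
  - by move=> a; rewrite /e' /remove e_irr.
  - by move=> a b /and3P[ab av _]; rewrite !inE av (eA _ _ ab).
  - exact: has_plane_map_sub sub PM.
  - by move=> l a ol l5 /(walk_sub sub); exact: og.
  - by move=> a b /sub; exact: pf.
  - exact: L3.
  have av : all (fun m => m.1 != v) s.
    by apply/allP => m /ms; rewrite !inE => /andP[].
  have wL w : e v w -> run f s w \in L.
    move=> vw; apply: ls; rewrite !inE (eA2 _ _ vw) andbT.
    by apply: contraTneq vw => ->; rewrite e_irr.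
  have [|s' [v' r' lv tv ms']] := extend_low_degree e_sym e_irr v2 pf vs av ts wL; first by rewrite L3.
  exists s'; split=> //.
  - move=> u uA; case: (eqVneq u v) => [->//|uv].
    by have [-> _] := r' u uv; apply: ls; rewrite !inE uv.
  - move=> u; case: (eqVneq u v) => [->|uv].
      by apply: leq_trans tv _; rewrite cA; lia.
    by have [_ ->] := r' u uv; apply: leq_trans (ts u) _; rewrite cA; lia.
  by move=> m /ms'[->//|[m' /ms + ->]]; rewrite inE => /andP[].
have deg3 u : u \in A -> 3 <= #|nbr e u|.
  by move=> uA; have := big u; rewrite /= uA /= => /negbT; rewrite -ltnNge.
have [D [ed [n [vt [M Ca simple]]]]] := has_plane_map_simple e_irr PM.
have [edK n_inj vtE _] := M.
have degE d : order n d = #|nbr e (vt d)| by exact: degree_nbr M Ca simple.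
have adj d : e (vt d) (vt (ed d)) := dart_adj Ca d.
have D0 : 0 < #|D|.
  have /card_gt0P[w] : 0 < #|nbr e u0| by apply: leq_trans (deg3 _ u0A).
  by rewrite inE Ca => /existsP[d _]; apply/card_gt0P; exists d.
have [d0 [_ d3 f4 n5 alt]] : exists d, reducible_at e ed n vt set0 d.
  apply: boolp.contrapT => no; apply: (plane_map_reducible D0 M Ca e_sym simple og).
    by move=> d; rewrite degE; apply: deg3; exact: eA (adj d).
  by move=> d rd; apply: no; exists d.
pose phi := face ed n; have phi_inj : injective phi := face_inj M.
have vphi d : vt (phi d) = vt (ed d) := vt_face M d.
have vn d : vt (n d) = vt d := vt_rot M d.
pose v := vt d0; pose x := vt (phi (phi d0)).
pose w1 := vt (ed d0); pose w3 := vt (ed (n d0)); pose w2 := vt (ed (n (n d0))).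
have n3 : n (n (n d0)) = d0 by have := iter_order n_inj d0; rewrite d3.
have phi4 : phi (phi (phi (phi d0))) = d0 by have := iter_order phi_inj d0; rewrite f4.
have e3 : ed (phi (phi (phi d0))) = n (n d0) by apply: n_inj; rewrite n3 -[RHS]phi4.
have vw1 : e v w1 := adj d0.
have vw2 : e v w2 by have := adj (n (n d0)); rewrite !vn.
have vw3 : e v w3 by have := adj (n d0); rewrite !vn.
have xw1 : e x w1 by rewrite e_sym /w1 -vphi /x [vt (phi (phi d0))]vphi; exact: adj.
have xw2 : e x w2 by rewrite /w2 -e3 edK [vt (phi (phi (phi d0)))]vphi; exact: adj.
have vN u : e v u = (u \in [:: w1; w2; w3]).
  apply/idP/idP => [|]; last by rewrite !inE => /or3P[]/eqP->.
  rewrite Ca => /existsP[d /andP[/eqP dv /eqP <-]].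
  have : fconnect n d0 d by rewrite -vtE dv.
  rewrite fconnect_orbit /orbit d3 /= !inE => /or3P[]/eqP->.
  - by rewrite eqxx.
  - by rewrite -/w3 eqxx !orbT.
  by rewrite -/w2 eqxx !orbT.
have neq_vt d d' : vt d = vt d' -> d != d' -> vt (ed d) != vt (ed d').
  by move=> dd; apply: contra_neq; exact: simple.
have uo : uniq [:: d0; n d0; n (n d0)].
  by have := orbit_uniq n d0; rewrite /orbit d3.
have w12 : w1 != w2.
  by apply: neq_vt; [rewrite !vn | move: uo; rewrite /= !inE !negb_or => /andP[/andP[_ ->]]].
have nvx : ~~ e v x.
  apply/negP => xv; have h : odd 3 by []; apply: (og 3 v h) => //.
  by apply: walkS xv (walkS xw1 (walk1 _)); rewrite e_sym.
have vx : v != x.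
  apply/eqP => vx; have pe : phi d0 = ed d0.
    by apply: simple; rewrite ?vphi // edK -vphi.
  have cyc : fcycle n [:: ed d0] by rewrite /= -/(face ed n d0) -/phi pe eqxx.
  have := order_le_cycle cyc (mem_head _ _); rewrite degE leqNgt; move/negP; apply.
  by apply: leq_trans (deg3 _ _) => //; exact: eA2 vw1.
have small : #|nbr e x| <= 3 \/ #|nbr e w3| <= 4.
  by case: alt => -[_ d]; [left|right]; rewrite -degE ?d.
have [s0 [vs0 al0 ts0 ms0]] := align e_sym e_irr vx nvx w12 vN xw1 xw2 small pf.
have xA : x \in A := eA _ _ xw1.
have vA : v \in A := eA _ _ vw1.
have w3A : w3 \in A := eA2 _ _ vw3.
pose r u := if u == v then x else u.
pose A' := A :\ v; have cA : #|A| = #|A'|.+1 by rewrite (cardsD1 v) vA.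
have xA' : x \in A' by rewrite !inE eq_sym vx.
have A'0 : 0 < #|A'| by apply/card_gt0P; exists x.
have rA' u : u \in A -> r u \in A'.
  by move=> uA; rewrite /r; case: (eqVneq u v) => // uv; rewrite !inE uv.
pose f1 := run f s0; have pf1 : proper_fun e f1 := valid_proper pf vs0.
(* The merged corners are those of the 4-face at x and at v: they begin with [phi (phi d0)] and with
   [d0]. *)
have PM' : has_plane_map (quot r e).
  have := @has_plane_map_merge T e D ed n vt (ed (phi d0)) (ed (phi (phi (phi d0)))) M Ca.
  have -> : vt (ed (phi d0)) = x by rewrite -vphi.
  have -> : vt (ed (phi (phi (phi d0)))) = v by rewrite -vphi phi4.
  apply; first by rewrite eq_sym.
  rewrite -[n (ed (phi (phi (phi d0))))]/(phi (phi (phi (phi d0)))) phi4.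
  by rewrite fconnect_sym //; exact: (fconnect_iter phi 2 d0).
have og' : odd_girth7 (quot r e).
  by apply: (quot_odd_girth e_sym e_irr (w := w1)) => //; rewrite e_sym.
have [||||||||s [vs ls ts ms]] := IH A' (quot r e) f1 L.
- by rewrite -ltnS -cA.
- exact: quot_sym.
- exact: quot_irr.
- move=> a b /andP[_ /existsP[a' /existsP[b' /and3P[/eqP<- _ ab]]]].
  by apply: rA'; exact: eA ab.
- exact: PM'.
- exact: og'.
- exact: proper_quot.
- exact: L3.
have av : all (fun m => m.1 != v) s by apply/allP => m /ms; rewrite !inE => /andP[].
have [s' [vs' rs' ts' ms']] := identify_lift e_sym e_irr vx nvx al0 pf1 vs av.
exists (s0 ++ s'); split.
- exact: valid_cat.
- by move=> u /rA' uA; rewrite run_cat rs'; exact: ls.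
- move=> u; rewrite /times count_cat -/(times u s0) -/(times u s') ts'.
  by rewrite cA; apply: times_bound A'0 (ts0 u) (ts (r u)).
move=> m; rewrite mem_cat => /orP[/ms0|/ms'[->//|[m' /ms + ->]]].
  by rewrite !inE => /or3P[]/eqP->.
by rewrite inE => /andP[].
Qed.

End Reach.

(** * Plane drawings *)

From mathcomp Require Import all_order all_algebra.
From mathcomp Require Import all_classical all_reals all_analysis.
From mathcomp Require Import lra zify.
Import Order.TTheory GRing.Theory Num.Theory.
Import numFieldNormedType.Exports.

(** * Distances between compact sets *)

Section Separation.
Local Open Scope classical_set_scope.
Local Open Scope ring_scope.
Variable R : realType.
Local Notation P := (R * R)%type.

Lemma compact_separated (A B : set P) : compact A -> compact B -> A `&` B = set0 ->
  exists2 eps : R, 0 < eps & forall x y, A x -> B y -> eps <= `|x - y|.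
Proof.
move=> cA cB AB0.
have [[z0 [Az0 Bz0]]|none] := pselect ((A `*` B) !=set0); last first.
  by exists 1 => // x y Ax By; case: none; exists (x, y).
pose f (z : P * P) : R := `|z.1 - z.2|.
have fcont : {within A `*` B, continuous f}.
  apply: continuous_subspaceT => z; apply: cvg_norm.
  by apply: cvgB; [exact: cvg_fst | exact: cvg_snd].
have [] := compact_EVT_min _ (compact_setX cA cB) fcont; first by exists z0.
move=> c /set_mem [cA1 cB1] cmin; exists (f c).
  rewrite normr_gt0 subr_eq0; apply/eqP => c12.
  have : (A `&` B) c.1 by split => //; rewrite c12.
  by rewrite AB0.
by move=> x y Ax By; apply: (cmin (x, y)); apply/mem_set.
Qed.

Lemma finite_separated (I : finType) (K : I -> set P) : (forall i, compact (K i)) ->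
  exists2 eps : R, 0 < eps &
    forall i j, K i `&` K j = set0 -> forall x y, K i x -> K j y -> eps <= `|x - y|.
Proof.
move=> cK.
have sep (ij : I * I) : exists eps : R, 0 < eps /\ (K ij.1 `&` K ij.2 = set0 ->
    forall x y, K ij.1 x -> K ij.2 y -> eps <= `|x - y|).
  have [d0|nd] := pselect (K ij.1 `&` K ij.2 = set0); last by exists 1.
  by have [eps e0 H] := compact_separated (cK _) (cK _) d0; exists eps.
have [eps epsP] := choice sep.
exists (\big[Num.min/1]_ij eps ij).
  by elim/big_ind: _ => // [x y x0 y0|ij _]; [rewrite lt_min x0 | case: (epsP ij)].
move=> i j d x y Kx Ky; apply: le_trans ((epsP (i, j)).2 d x y Kx Ky).
exact: bigmin_le_cond.
Qed.

Lemma finite_bounded (I : finType) (K : I -> set P) : (forall i, compact (K i)) ->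
  exists2 L : R, 0 < L & forall i x, K i x -> `|x| <= L.
Proof.
move=> cK.
have bnd i : exists L : R, forall x, K i x -> `|x| <= L.
  have [M [_ HM]] := compact_bounded (cK i); exists (M + 1) => x Kx.
  by apply: HM => //; rewrite ltrDl.
have [L LP] := choice bnd.
exists (\big[Num.max/1]_i L i); first by apply: lt_le_trans ltr01 _; exact: bigmax_ge_id.
move=> i x Kx; apply: le_trans (LP i x Kx) _; exact: le_bigmax.
Qed.

End Separation.

(** * Sampling plane sets on a square lattice *)

Section Lattice.
Local Open Scope classical_set_scope.
Local Open Scope ring_scope.
Variables (R : realType) (N : nat) (delta L : R).
Local Notation P := (R * R)%type.
Local Notation W := ('I_N.+1 * 'I_N.+1)%type.
Hypothesis delta_gt0 : 0 < delta.
Hypothesis N_large : 2 * L / delta + 1 <= N%:R.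

Definition coord (i : nat) : R := delta * i%:R - L.
Definition near_pt (z : P) (w : W) : bool :=
  (`|coord w.1 - z.1| <= delta) && (`|coord w.2 - z.2| <= delta).
Definition nearby (A : set P) (w : W) : bool := `[< exists2 z, A z & near_pt z w >].

Lemma coord_near (x : R) : `|x| <= L -> exists i : 'I_N.+1, `|coord i - x| <= delta / 2.
Proof.
move=> xL; have /andP[x1 x2] : - L <= x <= L by rewrite -ler_norml.
(* The summand 1/2 makes truncation round to the nearest lattice coordinate. *)
pose t := (x + L) / delta + 1 / 2.
have t0 : 0 <= t by rewrite addr_ge0 // divr_ge0 ?(ltW delta_gt0) //; lra.
have /andP[i1 i2] := truncn_itv t0.
have iN : (Num.truncn t < N.+1)%N.
  rewrite -(ltr_nat R) -natr1; apply: le_lt_trans i1 _.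
  apply: (@le_lt_trans _ _ (2 * L / delta + 1 / 2)); last by move: N_large; lra.
  by rewrite lerD2r ler_pM2r ?invr_gt0 //; lra.
exists (Ordinal iN); rewrite /coord /= ler_norml.
have -> : x = (t - 1 / 2) * delta - L.
  by rewrite /t addrK divfK ?gt_eqF // addrK.
move: i1 i2; rewrite -natr1; set k := (_%:R : R) => i1 i2.
have : k * delta <= t * delta by rewrite ler_pM2r.
have : t * delta < (k + 1) * delta by rewrite ltr_pM2r.
by move: delta_gt0; lra.
Qed.

Lemma near_pt_common (x y : P) : `|x| <= L -> `|x - y| <= delta / 2 ->
  exists w, near_pt x w && near_pt y w.
Proof.
rewrite !prod_normE !ge_max /= => /andP[x1 x2] /andP[d1 d2].
have [i iP] := coord_near x1; have [j jP] := coord_near x2.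
exists (i, j); rewrite /near_pt /=; move: delta_gt0.
by move: iP jP d1 d2; rewrite !ler_norml; lra.
Qed.

Lemma near_pt_dist (x y : P) w : near_pt x w -> near_pt y w -> `|x - y| <= 2 * delta.
Proof.
move=> /andP[a b] /andP[c d]; rewrite prod_normE ge_max /=.
by move: a b c d; rewrite !ler_norml; lra.
Qed.

Lemma grid_adj_sym : symmetric (@grid_adj N).
Proof.
move=> [a b] [c d]; rewrite /grid_adj /= (eq_sym a c) (eq_sym b d).
by congr orb; congr andb; exact: orbC.
Qed.

Lemma grid_adj_irr : irreflexive (@grid_adj N).
Proof.
move=> [a b]; rewrite /grid_adj /= !eqxx /= !orbb.
by rewrite !(gtn_eqF (ltnSn _)).
Qed.

Lemma restr_sym (A : pred W) : symmetric (restr (@grid_adj N) A).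
Proof.
by move=> x y; rewrite /restr grid_adj_sym; congr andb; rewrite andbC.
Qed.

Lemma restr_connect_sym (A : pred W) x y :
  connect (restr (@grid_adj N) A) x y = connect (restr (@grid_adj N) A) y x.
Proof. exact: sym_connect_sym (restr_sym A) x y. Qed.

Lemma row_connect (A : pred W) (a b : 'I_N.+1) (j : 'I_N.+1) : (a <= b)%N ->
  (forall c : 'I_N.+1, (a <= c <= b)%N -> A (c, j)) ->
  connect (restr (@grid_adj N) A) (a, j) (b, j).
Proof.
move=> ab; rewrite -(subnK ab); move: (b - a)%N (subnK ab) => m.
elim: m b {ab} => [|m IH] b mb H.
  by have -> : a = b by apply/val_inj; exact: mb.
have bN := ltn_ord b.
have cN : (m + a < N.+1)%N by rewrite addSn in mb; rewrite ltnW // mb.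
pose c := Ordinal cN; have mbS : (m + a).+1 = b by rewrite -mb.
have Hc (k : 'I_N.+1) : (a <= k <= m + a)%N -> A (k, j).
  by move=> /andP[ak kc]; apply: H; rewrite ak addSn leqW.
apply: connect_trans (IH c _ _) _ => //; apply: connect1.
rewrite /restr /grid_adj /= eqxx mbS eqxx orbT /=; apply/andP; split; apply: H => /=.
  by rewrite leq_addl addSn leqnSn.
by rewrite addSn mbS leqnn andbT -mbS leqW // leq_addl.
Qed.

Lemma col_connect (A : pred W) (a b : 'I_N.+1) (j : 'I_N.+1) : (a <= b)%N ->
  (forall c : 'I_N.+1, (a <= c <= b)%N -> A (j, c)) ->
  connect (restr (@grid_adj N) A) (j, a) (j, b).
Proof.
move=> ab; rewrite -(subnK ab); move: (b - a)%N (subnK ab) => m.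
elim: m b {ab} => [|m IH] b mb H.
  by have -> : a = b by apply/val_inj; exact: mb.
have bN := ltn_ord b.
have cN : (m + a < N.+1)%N by rewrite addSn in mb; rewrite ltnW // mb.
pose c := Ordinal cN; have mbS : (m + a).+1 = b by rewrite -mb.
have Hc (k : 'I_N.+1) : (a <= k <= m + a)%N -> A (j, k).
  by move=> /andP[ak kc]; apply: H; rewrite ak addSn leqW.
apply: connect_trans (IH c _ _) _ => //; apply: connect1.
rewrite /restr /grid_adj /= eqxx mbS eqxx /=; apply/andP; split; apply: H => /=.
  by rewrite leq_addl addSn leqnSn.
by rewrite addSn mbS leqnn andbT -mbS leqW // leq_addl.
Qed.

Lemma coord_le i j : (i <= j)%N -> coord i <= coord j.
Proof. by move=> ij; rewrite lerD2r ler_wpM2l ?(ltW delta_gt0) // ler_nat. Qed.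

Lemma near_pt_connected (A : set P) z w w' : A z -> near_pt z w -> near_pt z w' ->
  connect (restr (@grid_adj N) (nearby A)) w w'.
Proof.
move=> Az; case: w w' => [a b] [c d] /andP[/= za zb] /andP[/= zc zd].
have betw (x y k : 'I_N.+1) t : (x <= k <= y)%N -> `|coord x - t| <= delta ->
    `|coord y - t| <= delta -> `|coord k - t| <= delta.
  move=> /andP[/coord_le xk /coord_le ky].
  by rewrite !ler_norml; lra.
have near (k l : 'I_N.+1) : `|coord k - z.1| <= delta -> `|coord l - z.2| <= delta -> nearby A (k, l).
  by move=> kz lz; apply/asboolP; exists z => //; rewrite /near_pt /= kz lz.
apply: (@connect_trans _ _ (c, b)).
  case/orP: (leq_total a c) => ac; [|rewrite restr_connect_sym]; apply: row_connect => // k kk;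
  apply: near => //; [exact: betw kk za zc | exact: betw kk zc za].
case/orP: (leq_total b d) => bd; [|rewrite restr_connect_sym]; apply: col_connect => // k kk;
apply: near => //; [exact: betw kk zb zd | exact: betw kk zd zb].
Qed.

(** The points of [A] having a lattice point near them that is reachable from [w0] form a set that
    is open and closed in [A]: points of [A] closer than [delta / 2] share a near lattice point, and
    the lattice points near a single point are connected among themselves. *)
Lemma nearby_connected (A : set P) z0 z1 w0 w1 : connected A ->
  (forall z, A z -> `|z| <= L) -> A z0 -> A z1 -> near_pt z0 w0 -> near_pt z1 w1 ->
  connect (restr (@grid_adj N) (nearby A)) w0 w1.
Proof.
move=> cA bA A0 A1 n0 n1.
pose C := [set z | A z /\ exists2 w, near_pt z w &
  connect (restr (@grid_adj N) (nearby A)) w0 w].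
have step x y : C x -> A y -> `|x - y| < delta / 2 -> C y.
  move=> [Ax [w xw cw]] Ay /ltW xy; split=> //.
  have [w' /andP[xw' yw']] := near_pt_common (bA x Ax) xy.
  by exists w' => //; apply: connect_trans cw (near_pt_connected Ax xw xw').
have d2 : 0 < delta / 2 by rewrite divr_gt0.
have ballE (x y : P) : ball x (delta / 2) y = (`|x - y| < delta / 2) :> Prop.
  by rewrite -ball_normE.
suff CA : C = A.
  have : C z1 by rewrite CA.
  by move=> [_ [w zw cw]]; apply: connect_trans cw (near_pt_connected A1 zw n1).
apply: cA.
- by exists z0; split=> //; exists w0 => //; exact: connect0.
- exists (\bigcup_(z in C) ball z (delta / 2)).
    by apply: bigcup_open => z _; apply: ball_open.
  apply/seteqP; split=> [z Cz|z [Az [y Cy]]].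
    by split; [case: Cz | exists z => //; exact: ballxx].
  by rewrite ballE => yz; apply: step Cy Az yz.
exists (~` (\bigcup_(z in A `\` C) ball z (delta / 2))).
  by apply: open_closedC; apply: bigcup_open => z _; apply: ball_open.
apply/seteqP; split=> [z Cz|z [Az nz]].
  split; first by case: Cz.
  by move=> [y [Ay nCy]]; rewrite ballE distrC => yz; apply: nCy; apply: step Cz Ay yz.
apply: contrapT => nCz; apply: nz; exists z; first by split.
exact: ballxx.
Qed.

End Lattice.

Section Drawing.
Local Open Scope classical_set_scope.
Local Open Scope ring_scope.
Variables (R : realType) (T : finType) (e : rel T).
Local Notation P := (R * R)%type.
Hypotheses (e_sym : symmetric e) (e_irr : irreflexive e).
Variables (pt : T -> P) (arc : T -> T -> R -> P).
Hypothesis dr : plane_drawing e pt arc.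

(* The outer thirds of the arcs belong to the stars: half arcs would meet at the
   midpoints, and the stars must be at positive distance from each other. *)
Let ray u v : set P := if e u v then arc u v @` `[0, 3^-1] else [set pt u].
Let star u : set P := \bigcup_(v in [set` enum T]) ray u v.
Let mid u v : set P := if e u v then arc u v @` `[3^-1, 2 / 3] else set0.

Let sub_third : [set` `[0, 3^-1]] `<=` [set` `[(0 : R), 1]].
Proof. by move=> t /=; rewrite !in_itv /=; lra. Qed.
Let sub_mid : [set` `[3^-1, 2 / 3]] `<=` [set` `[(0 : R), 1]].
Proof. by move=> t /=; rewrite !in_itv /=; lra. Qed.

Let arc_cont u v (A : set R) : e u v -> A `<=` [set` `[0, 1]] -> {within A, continuous (arc u v)}.
Proof.
by case: dr => _ /(_ u v) + _ _ _ => /[apply] -[c _ _ _] sA; apply: continuous_subspaceW sA c.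
Qed.

Let ray_compact u v : compact (ray u v).
Proof.
rewrite /ray; case: ifP => euv; last exact: compact_set1.
by apply: continuous_compact; [exact: arc_cont | exact: segment_compact].
Qed.

Let star_compact u : compact (star u).
Proof. by rewrite /star bigcup_seq; apply: bigsetU_compact => v _; exact: ray_compact. Qed.

Let mid_compact u v : compact (mid u v).
Proof.
rewrite /mid; case: ifP => euv; last exact: compact0.
by apply: continuous_compact; [exact: arc_cont | exact: segment_compact].
Qed.

Let ray_pt u v : ray u v (pt u).
Proof.
rewrite /ray; case: ifP => // euv; case: dr => _ /(_ u v euv) [_ _ a0 _] _ _ _.
by exists 0; rewrite ?a0 //= in_itv /=; lra.
Qed.

Let star_connected u : connected (star u).
Proof.
apply: bigcup_connected; first by exists (pt u) => v _; exact: ray_pt.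
move=> v _; rewrite /ray; case: ifP => euv; last exact: connected1.
by apply: connected_continuous_connected; [exact: segment_connected | exact: arc_cont].
Qed.

Let mid_connected u v : e u v -> connected (mid u v).
Proof.
move=> euv; rewrite /mid euv.
by apply: connected_continuous_connected; [exact: segment_connected | exact: arc_cont].
Qed.

Let starP u z : star u z ->
  z = pt u \/ exists v t, [/\ e u v, 0 < t, t <= 3^-1 & z = arc u v t].
Proof.
move=> [v _]; rewrite /ray; case: ifP => euv; last by move=> ->; left.
move=> [t]; rewrite /= in_itv /= => /andP[t0 t1] <-.
move: t0; rewrite le_eqVlt => /predU1P[t0|t0]; last by right; exists v, t.
by left; rewrite -t0; case: dr => _ /(_ u v euv) [_ _ -> _].
Qed.

Let star_ptE u : star u (pt u).
Proof. by exists u; [rewrite /= mem_enum | exact: ray_pt]. Qed.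

Let star_arc u v : e u v -> star u (arc u v 3^-1).
Proof.
move=> euv; exists v; first by rewrite /= mem_enum.
by rewrite /ray euv; exists 3^-1 => //=; rewrite in_itv /=; lra.
Qed.

Let arc_pt u v w (t : R) : e u v -> 0 < t -> t < 1 -> arc u v t = pt w -> False.
Proof.
move=> euv t0 t1; case: dr => _ _ _ H _; apply: H => //.
by rewrite in_itv /= t0.
Qed.

Let arc_cross u v x y (s t : R) : e u v -> e x y -> 0 < s -> s < 1 -> 0 < t -> t < 1 ->
  arc u v s = arc x y t -> (u = x /\ v = y) \/ (u = y /\ v = x).
Proof.
move=> euv exy s0 s1 t0 t1; case: dr => _ _ _ _ H; apply: H => //.
  by rewrite in_itv /= s0.
by rewrite in_itv /= t0.
Qed.

Let arc_rev u v (t : R) : e u v -> 0 <= t -> t <= 1 -> arc v u t = arc u v (1 - t).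
Proof. by move=> euv t0 t1; case: dr => _ _ H _ _; apply: H; rewrite // in_itv /= t0. Qed.

Let star_disjoint u v : u != v -> star u `&` star v = set0.
Proof.
move=> uv; apply/seteqP; split=> // z [/starP Hu /starP Hv].
have third1 (t : R) : t <= 3^-1 -> t < 1 by lra.
case: Hu Hv => [->|[u' [s [eu s0 /[dup] s3 /third1 s1 ->]]]] Hv.
  case: Hv => [|[v' [t [ev t0 /third1 t1]]]].
    by case: dr => pt_inj _ _ _ _ /pt_inj e1; rewrite e1 eqxx in uv.
  by move/esym/(arc_pt ev t0 t1).
case: Hv => [/(arc_pt eu s0 s1)//|[v' [t [ev t0 /[dup] t3 /third1 t1 E]]]].
case: (arc_cross eu ev s0 s1 t0 t1 E) => [[e1 _]|[uv' u'v]]; first by rewrite e1 eqxx in uv.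
move: E; rewrite -uv' -u'v (arc_rev eu (ltW t0) (ltW t1)).
case: dr => _ /(_ _ _ eu) [_ inj _ _] _ _ _ E.
have : s = 1 - t by apply: inj E; rewrite in_itv /=; lra.
by lra.
Qed.

Let mid_star u v w : e u v -> w != u -> w != v -> mid u v `&` star w = set0.
Proof.
move=> euv wu wv; apply/seteqP; split=> // z [].
rewrite /mid euv => -[s]; rewrite /= in_itv /= => /andP[s0 s1] <-.
have {}s0 : 0 < s by lra.
have {}s1 : s < 1 by lra.
move=> /starP[/(arc_pt euv s0 s1)//|[w' [t [ew t0 t1]]]].
have {}t1 : t < 1 by lra.
move=> /(arc_cross euv ew s0 s1 t0 t1) [[uw _]|[_ vw]].
  by rewrite uw eqxx in wu.
by rewrite vw eqxx in wv.
Qed.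

Let mid_mid u v x y : e u v -> e x y -> mid u v `&` mid x y !=set0 ->
  (u = x /\ v = y) \/ (u = y /\ v = x).
Proof.
move=> euv exy [z []]; rewrite /mid euv exy => -[s]; rewrite /= in_itv /= => s01 <-.
move=> [t]; rewrite /= in_itv /= => t01 /esym E.
by apply: (arc_cross euv exy _ _ _ _ E); lra.
Qed.

Lemma drawing_has_plane_map : has_plane_map e.
Proof.
pose K (i : T + T * T) := match i with inl u => star u | inr uv => mid uv.1 uv.2 end.
have cK i : compact (K i) by case: i => [u|[u v]] /=.
have [eps eps0 epsP] := finite_separated cK.
have [L L0 LP] := finite_bounded cK.
(* Two points near the same lattice point are at distance at most [2 * delta < eps], so two of the
   sets whose samples meet must themselves meet. *)
pose delta := eps / 4; have delta0 : 0 < delta by rewrite divr_gt0.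
pose N := (Num.truncn (2 * L / delta + 1)).+1.
have NP : 2 * L / delta + 1 <= N%:R by apply: ltW; exact: truncnS_gt.
pose near (A : set P) := @nearby R N delta L A.
have near_disj i j w : near (K i) w -> near (K j) w -> K i `&` K j !=set0.
  move=> /asboolP[x Kx xw] /asboolP[y Ky yw]; apply: contrapT => /set0P/negP.
  rewrite negbK => /eqP d; have := epsP i j d x y Kx Ky.
  by have := near_pt_dist xw yw; rewrite /delta; move: eps0; lra.
have ex_near i z : K i z -> exists w, @near_pt R N delta L z w.
  move=> Kz; have zz : `|z - z| <= delta / 2 by rewrite subrr normr0 divr_ge0 // ltW.
  have [w /andP[zw _]] := near_pt_common delta0 NP (LP i z Kz) zz.
  by exists w.
have near_conn i z z' w w' : connected (K i) -> K i z -> K i z' ->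
    @near_pt R N delta L z w -> @near_pt R N delta L z' w' ->
    connect (restr (@grid_adj N) (near (K i))) w w'.
  by move=> cn Kz Kz' zw zw'; apply: nearby_connected Kz Kz' zw zw' => //; exact: LP.
have [base baseP] := choice (fun u => ex_near (inl u) (pt u) (star_ptE u)).
apply: (@has_plane_map_minor _ _ (@grid_adj N) e (fun u => near (star u))
   (fun u v => near (mid u v)) base) => //.
- exact: grid_adj_sym.
- exact: grid_adj_irr.
- by move=> u; apply/asboolP; exists (pt u).
- move=> u x /asboolP[z sz zx].
  exact: (near_conn (inl u) _ _ _ _ (@star_connected u) (star_ptE u) sz (baseP u) zx).
- move=> u v x su sv; apply/eqP; apply: contraT => /star_disjoint d.
  by have := near_disj (inl u) (inl v) x su sv; rewrite /= d => -[].
- move=> u v w x euv lx sx; case: (eqVneq w u) => [->|wu]; [by left|right].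
  apply/eqP; apply: contraT => wv; have d := mid_star euv wu wv.
  by have := near_disj (inr (u, v)) (inl w) x lx sx; rewrite /= d => -[].
- move=> u v u' v' x euv euv' lx lx'.
  exact: mid_mid euv euv' (near_disj (inr (u, v)) (inr (u', v')) x lx lx').
- move=> u v euv.
  have Ka : mid u v (arc u v 3^-1).
    by rewrite /mid euv; exists 3^-1 => //=; rewrite in_itv /=; lra.
  have Kb : mid u v (arc v u 3^-1).
    rewrite /mid euv (arc_rev euv); [|lra|lra].
    by exists (1 - 3^-1) => //=; rewrite in_itv /=; lra.
  have [a na] := ex_near (inr (u, v)) _ Ka; have [b nb] := ex_near (inr (u, v)) _ Kb.
  exists a, b; split.
  + by apply/asboolP; exists (arc u v 3^-1) => //; exact: star_arc.
  + by apply/asboolP; exists (arc v u 3^-1) => //; apply: star_arc; rewrite e_sym.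
  + by apply/asboolP; exists (arc u v 3^-1).
  + by apply/asboolP; exists (arc v u 3^-1).
  exact: (near_conn (inr (u, v)) _ _ _ _ (mid_connected euv) Ka Kb na nb).
exact: grid_has_plane_map.
Qed.

End Drawing.

Lemma planar_has_plane_map (R : realType) (T : finType) (e : rel T) :
  symmetric e -> irreflexive e -> planar R e -> has_plane_map e.
Proof. by move=> sym irr [pt [arc dr]]; exact: drawing_has_plane_map dr. Qed.

(** * Reconfiguration *)

(** A closed walk of length 5 that repeats a vertex contains a closed walk of length 3, which is a
    triangle. *)
Lemma odd_girth7_no_cycle (T : finType) (e : rel T) : symmetric e -> irreflexive e ->
  ~ has_cycle e 3 -> ~ has_cycle e 5 -> odd_girth7 e.
Proof.
move=> sym irr n3 n5.
have neq a b : e a b -> (a == b) = false.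
  by move=> ab; apply/negbTE; apply: contraTneq ab => ->; rewrite irr.
have tri a b c : e a b -> e b c -> e c a -> False.
  move=> ab bc ca; apply: n3; split=> //; exists [:: a; b; c] => //.
  by rewrite /ucycle /= ab bc ca !inE (neq _ _ ab) (neq _ _ bc) [a == c]eq_sym (neq _ _ ca).
case=> [|[|[|[|[|[|//]]]]]] a // _ _ [p [sp pp lp]].
- by case: p sp pp lp => [|b [|//]] //= _ + ba; rewrite ba irr.
- case: p sp pp lp => [|b [|c [|d [|//]]]] //= _ + da; rewrite da => /and4P[ab bc ca _].
  exact: tri ab bc ca.
case: p sp pp lp => [|b [|c [|d [|f [|g [|//]]]]]] //= _ + ga; rewrite ga.
move=> /and5P[ab bc cd df /andP[fa _]].
have ne a1 a2 a3 a4 : e a1 a2 -> e a3 a4 -> e a4 a1 -> (a2 == a3) = false.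
  by move=> e12 e34 e41; apply/negP => /eqP e23; rewrite -e23 in e34; exact: tri e12 e34 e41.
apply: n5; split=> //; exists [:: a; b; c; d; f] => //.
have ac : (a == c) = false by apply: ne fa cd df.
have ad : (a == d) = false by apply/negP => /eqP x; rewrite -x in cd; exact: tri ab bc cd.
have bd : (b == d) = false by apply: ne ab df fa.
have bf : (b == f) = false by apply: ne (_ : e c b) _ _; rewrite 1?sym //; [exact: df|exact: cd].
have cf : (c == f) = false by apply: ne bc fa ab.
rewrite /ucycle /= ab bc cd df fa !inE (neq _ _ ab) (neq _ _ bc) (neq _ _ cd) (neq _ _ df).
by rewrite ac ad [a == f]eq_sym (neq _ _ fa) bd bf cf.
Qed.

Section Reconfigure.
Variables (T : finType) (e : rel T).
Hypotheses (e_sym : symmetric e) (e_irr : irreflexive e).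
Local Notation col := (coloring e 5).
Local Notation within_steps k x y := (exists2 l, l <= k & walk (reconf e 5) l x y).

Lemma proper_coloringP (f : {ffun T -> 'I_5}) : reflect (proper_fun e f) (proper_coloring e f).
Proof.
apply: (iffP forallP) => [H u w uw|H u].
  by have /forallP/(_ w)/implyP := H u; exact.
by apply/forallP => w; apply/implyP; exact: H.
Qed.

(** A move may repeat the present colour, and then no step is made. *)
Lemma steps_recolor (x y : col) m : val y = recolor (val x) m -> within_steps 1 x y.
Proof.
case: m => u c yE; case: (eqVneq (val x u) c) => [xc|xc].
  exists 0 => //; suff -> : y = x by exact: walk0.
  apply: val_inj; rewrite yE; apply/ffunP => w; rewrite recolorE.
  by case: eqP => // ->.
exists 1 => //; apply: walk1; apply/eqP; transitivity #|pred1 u|; last exact: card1.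
apply: eq_card => w.
rewrite !inE yE recolorE; case: (eqVneq w u) => [->|_]; first by rewrite xc.
by rewrite eqxx.
Qed.

Lemma steps_cat k1 k2 (x y z : col) :
  within_steps k1 x y -> within_steps k2 y z -> within_steps (k1 + k2) x z.
Proof.
by move=> [l1 k1l w1] [l2 k2l w2]; exists (l1 + l2); [exact: leq_add | exact: walk_cat w1 w2].
Qed.

Lemma steps_sym k (x y : col) : within_steps k x y -> within_steps k y x.
Proof.
move=> [l lk w]; exists l => //; apply: walk_rev w => f g.
by rewrite /reconf; congr (_ == _); apply: eq_card => u; rewrite !inE eq_sym.
Qed.

Lemma steps_moves s : forall x : col, valid e (val x) s ->
  exists2 y : col, val y = run (val x) s & within_steps (size s) x y.
Proof.
elim: s => [|m s IH] x; first by exists x => //; exists 0 => //; exact: walk0.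
move=> /= [/proper_coloringP p1 vs].
have [y yE xy] := IH (Sub _ p1 : col) vs.
exists y => //; rewrite -add1n; apply: steps_cat xy.
exact: (steps_recolor (m := m)).
Qed.

Lemma size_times (C : finType) (s : seq (T * C)) : size s = \sum_u times u s.
Proof.
elim: s => [|m s IH]; first by rewrite big1.
have -> : \sum_u times u (m :: s) = \sum_u ((m.1 == u) + times u s) by [].
rewrite big_split /= -IH (_ : \sum_u (m.1 == u) = 1) //.
rewrite (bigD1 m.1) //= eqxx big1 // => u um; by rewrite eq_sym (negbTE um).
Qed.

Definition mix (f g : {ffun T -> 'I_5}) (X : {set T}) : {ffun T -> 'I_5} :=
  [ffun u => if u \in X then g u else f u].

Lemma steps_mix f g s : forall (X : {set T}) (x : col),
  (forall Y : {set T}, X \subset Y -> Y \subset X :|: [set u in s] -> proper_fun e (mix f g Y)) ->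
  val x = mix f g X ->
  exists2 y : col, val y = mix f g (X :|: [set u in s]) & within_steps (size s) x y.
Proof.
elim: s => [|u s IH] X x H xE.
  exists x; last by exists 0 => //; exact: walk0.
  by rewrite xE; congr mix; apply/setP => w; rewrite !inE orbF.
have subX : (u |: X) :|: [set w in s] = X :|: [set w in u :: s].
  by apply/setP => w; rewrite !inE; case: (w == u); case: (w \in X); case: (w \in s).
have /proper_coloringP p1 : proper_fun e (mix f g (u |: X)).
  apply: H; first exact: finset.subsetUr.
  by rewrite -subX; exact: finset.subsetUl.
have [||y yE xy] := IH (u |: X) (Sub _ p1 : col).
- move=> Y XY YX; apply: H; last by rewrite -subX.
  by apply: fintype.subset_trans XY; exact: finset.subsetUr.
- by [].
exists y; first by rewrite yE subX.
rewrite [size _]/= -add1n; apply: steps_cat xy.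
apply: (steps_recolor (m := (u, g u))); rewrite xE; apply/ffunP => w.
rewrite recolorE !ffunE !inE; by case: eqP => [->|_].
Qed.

(* the palettes meet in the single colour 2, so first give every vertex that
   ends in {3, 4} its final colour, and then the others *)
Lemma steps_palettes (x y : col) :
  (forall u, val x u <= 2) -> (forall u, 2 <= val y u) -> within_steps (2 * #|T|) x y.
Proof.
move=> x2 y2; pose P := [set u | val y u != 2 :> nat].
have px : proper_fun e (val x) by apply/proper_coloringP; exact: (valP x).
have py : proper_fun e (val y) by apply/proper_coloringP; exact: (valP y).
have good (X : {set T}) : (X \subset P) || (P \subset X) -> proper_fun e (mix (val x) (val y) X).
  move=> XP.
  (* A clash could only be in colour 2. Then [u] is not in [P], so [X] contains [P], hence [w] is
     not in [P] either, and [y] would give both ends colour 2. *)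
  have cross u w : e u w -> u \in X -> w \notin X -> val y u != val x w.
    move=> uw uX wX; suff : u \in P.
      rewrite inE; apply: contraNneq => yx; have := y2 u; have := x2 w; rewrite -yx.
      by move=> a b; rewrite eqn_leq a b.
    case/orP: XP => [/fintype.subsetP/(_ u uX)//|/fintype.subsetP PX].
    have : w \notin P by apply: contra wX; exact: PX.
    rewrite !inE negbK => /eqP w2; apply: contraNneq (py _ _ uw) => u2.
    by apply/eqP/val_inj; rewrite /= u2 w2.
  move=> u w uw; rewrite !ffunE; case: (boolP (u \in X)) => uX; case: (boolP (w \in X)) => wX.
  - exact: py.
  - exact: cross.
  - by rewrite eq_sym; apply: cross; rewrite // e_sym.
  exact: px.
have [||z zE xz] := @steps_mix (val x) (val y) (enum P) (@finset.set0 T) x.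
- move=> Y _ YP; apply: good; apply/orP; left; apply: fintype.subset_trans YP _.
  by apply/fintype.subsetP => u; rewrite !inE mem_enum inE.
- by apply/ffunP => u; rewrite ffunE inE.
have [||y' y'E zy] := @steps_mix (val x) (val y) (enum T) P z.
- by move=> Y PY _; apply: good; rewrite PY orbT.
- by rewrite zE; congr mix; apply/setP => u; rewrite !inE mem_enum inE.
have yy : y' = y.
  by apply: val_inj; rewrite y'E; apply/ffunP => u; rewrite ffunE !inE mem_enum orbT.
rewrite -yy; have [l lk w] := steps_cat xz zy; exists l => //; apply: leq_trans lk _.
by rewrite -!cardE mul2n -addnn leq_add2r max_card.
Qed.

Lemma steps_diameter (x y : col) : has_plane_map e -> odd_girth7 e ->
  within_steps (4 * #|T| ^ 2) x y.
Proof.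
move=> PM og.
have pal (z : col) (L : {set 'I_5}) : #|L| = 3 ->
    exists2 z' : col, (forall u, val z' u \in L) & within_steps (#|T| * (2 * #|T| - 1)) z z'.
  move=> L3; have pz : proper_fun e (val z) by apply/proper_coloringP; exact: (valP z).
  have [|s [vs Ls ts _]] := @reach_palette T #|[set: T]|.+1 [set: T] e (val z) L
    (ltnSn _) e_sym e_irr _ PM og pz L3; first by move=> u w _; rewrite inE.
  have [z' zE [l lk w]] := steps_moves vs; exists z'; first by move=> u; rewrite zE; apply: Ls; rewrite inE.
  exists l => //; apply: leq_trans lk _; rewrite size_times -sum_nat_const.
  by apply: leq_sum => u _; have := ts u; rewrite cardsT.
have [|x' x'L xx'] := pal x [set c : 'I_5 | c <= 2].
  by rewrite -sum1_card big_mkcond /= !big_ord_recl big_ord0 !inE.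
have [|y' y'L yy'] := pal y [set c : 'I_5 | 2 <= c].
  by rewrite -sum1_card big_mkcond /= !big_ord_recl big_ord0 !inE.
have x'y' : within_steps (2 * #|T|) x' y'.
  by apply: steps_palettes => u; [have := x'L u | have := y'L u]; rewrite inE.
have [l lk w] := steps_cat (steps_cat xx' x'y') (steps_sym yy').
exists l => //; apply: leq_trans lk _; move: #|T| => k; rewrite -mulnn.
have [->|k0] := posnP k; first by [].
by rewrite mulnBr; nia.
Qed.

End Reconfigure.

Theorem mainTheorem1 (R : realType) (T : finType) (e : rel T)
  (e_sym : symmetric e) (e_irr : irreflexive e)
  (e_planar : planar R e)
  (no_C3 : ~ has_cycle e 3) (no_C5 : ~ has_cycle e 5) :
  (diam R (reconf e 5) <= (4 * #|T| ^ 2)%N%:R%:E)%E.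
Proof.
have PM := planar_has_plane_map e_sym e_irr e_planar.
have og := odd_girth7_no_cycle e_sym e_irr no_C3 no_C5.
apply: ge_ereal_sup => _ [[x y] _ <-] /=.
have [l lk [p [sp pp lp]]] := steps_diameter e_sym e_irr x y PM og.
(* [dist] ranges over paths without repetition, while the walk may revisit colourings. *)
case/shortenP: pp lp => p' pp' up' sub lp'.
apply: ge_ereal_inf; exists (size p')%:R%:E; first by exists p'.
rewrite lee_fin ler_nat; apply: leq_trans lk; rewrite -sp.
by case/andP: up' => _ up'; exact: uniq_leq_size up' sub.
Qed.
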